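(* Let $k\ge 1$. Let $\tilde{\mathfrak a}_k(x)=\sum_{n\ge 0}t_{k,n}x^n$, where $t_{k,n}$ is the number of unlabeled $k$-trees with $n$ hedra (that is, isomorphism classes of $k$-trees having exactly $n$ hedra). Let $\widetilde{\mathcal{CT}^Y_k}(\lambda)(x)$ (for $\lambda\vdash k$) and $\widetilde{\mathcal{CT}^{XY}_k}(\lambda)(x)$ (for $\lambda\vdash k+1$) be the $\Gamma$-ordinary generating functions of the $\mathfrak S_k$-species of $Y$-rooted $k$-coding trees and of the $\mathfrak S_{k+1}$-species of edge-rooted $k$-coding trees, respectively, evaluated at any permutation of cycle type $\lambda$. Then $$\tilde{\mathfrak a}_k(x)=\sum_{\lambda\vdash k+1}\frac1{z_\lambda}\widetilde{\mathcal{CT}^{XY}_k}(\lambda)(x)+\sum_{\lambda\vdash k}\frac1{z_\lambda}\widetilde{\mathcal{CT}^{Y}_k}(\lambda)(x)-\sum_{\lambda\vdash k}\frac1{z_\lambda}\widetilde{\mathcal{CT}^{XY}_k}(\lambda\cup\{1\})(x).$$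
   Context: **$k$-trees.** The complete graph $K_k$ is a $k$-tree, and any graph formed from a $k$-tree by adding one new vertex and joining it by edges to all vertices of some existing $k$-clique is a $k$-tree. A hedron of a $k$-tree is a $(k+1)$-clique; a front is a $k$-clique. **$k$-coding trees.** A $k$-coding tree is a finite tree with vertices colored black and white, each edge joining a black and a white vertex, in which every black vertex has exactly $k+1$ (white) neighbors and carries a cyclic ordering of them (white vertices may have any number of black neighbors; a single white vertex is allowed). $\mathcal{CT}_k$ is the two-sort species of $k$-coding trees with black vertices labeled by sort $X$ and white vertices by sort $Y$. $\mathcal{CT}_k^Y$ and $\mathcal{CT}_k^{XY}$ are the species of $k$-coding trees rooted at a white vertex and at an edge. **Actions.** $\mathfrak S_m$ is the symmetric group on $[m]=\{1,\dots,m\}$ and $\mathfrak S_k\subset\mathfrak S_{k+1}$ is the subgroup fixing $k+1$. For $\sigma\in\mathfrak S_{k+1}$, $i\in[k+1]$, let $\rho_i(\sigma)\in\mathfrak S_{k+1}$ be $a\mapsto\sigma(i+a)-\sigma(i)$, with sums and differences reduced modulo $k+1$ to representatives in $\{1,\dots,k+1\}$; $\rho_i(\sigma)$ fixes $k+1$. In a $\mathcal{CT}^Y_k$-structure, the cyclic order at each black vertex is linearized by putting its parent (the neighbor toward the root) last, in position $k+1$. Thus a $\mathcal{CT}_k^Y$-structure is a root label $y$ together with a set of structures $(x;W_1,\dots,W_k)$, with $x$ a black label and the $W_i$ $\mathcal{CT}_k^Y$-structures. Recursively, $\sigma\in\mathfrak S_k$ acts on a $\mathcal{CT}_k^Y$-structure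 by fixing $y$ and replacing each $(x;W_1,\dots,W_k)$ by $(x;W'_1,\dots,W'_k)$ with $W'_{\sigma(i)}=\rho_i(\sigma)\cdot W_i$. A $\mathcal{CT}^{XY}_k$-structure is written $(x;W_1,\dots,W_{k+1})$ with $x$ the root black vertex, the $W_i$ $\mathcal{CT}_k^Y$-structures and the white vertex of the root edge being the root of $W_{k+1}$; $\sigma\in\mathfrak S_{k+1}$ sends it to $(x;W'_1,\dots,W'_{k+1})$ with $W'_{\sigma(i)}=\rho_i(\sigma)\cdot W_i$. These actions commute with relabeling, so they make $\mathcal{CT}_k^Y$ an $\mathfrak S_k$-species and $\mathcal{CT}_k^{XY}$ an $\mathfrak S_{k+1}$-species. **$\Gamma$-cycle index and $\Gamma$-generating function.** For a two-sort species $F$ with an action of a group $\Gamma$ commuting with relabelings and $\gamma\in\Gamma$, $$Z^\Gamma_F(\gamma)=\sum_{m,n\ge0}\frac1{m!\,n!}\sum_{\mu\in\mathfrak S_m,\nu\in\mathfrak S_n}\left|\mathrm{Fix}(\gamma\cdot F[\mu,\nu])\right|p_\mu[x]\,p_\nu[y],$$ with $p_\mu[x]=\prod_i p_i[x]^{\mu_i}$, $\mu_i$ the number of $i$-cycles of $\mu$ (similarly for $y$). The $\Gamma$-ordinary generating function $\widetilde F(\gamma)(x)$ is obtained from $Z_F^\Gamma(\gamma)$ by substituting $p_i[x]=x^i$, $p_i[y]=1$ for all $i\ge1$. It is a class function of $\gamma$, so for symmetric groups $\widetilde F(\lambda)(x)$ denotes its value at any permutation of cycle type $\lambda$. **Partitions.**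 $z_\lambda=\prod_i i^{m_i}m_i!$, where $m_i$ is the number of parts of $\lambda$ equal to $i$; $\lambda\cup\{1\}$ is $\lambda$ with one extra part equal to $1$. *)

(* Defs.v *)
From mathcomp Require Import all_boot all_order all_algebra all_fingroup.
From mathcomp Require Import boolp classical_sets functions fsbigop.

Set Implicit Arguments.
Unset Strict Implicit.
Unset Printing Implicit Defensive.

Import GRing.Theory.

(* A formal power series over the rationals in one variable is its coefficient
   sequence nat -> rat.  Possibly infinite index sets are handled by the
   finitely supported sums \sum_(i \in A) F i of fsbigop; all those used here
   do have finite support. *)

Section KTrees.
Local Open Scope set_scope.
Variable T : finType.
Implicit Types (E : {set {set T}}) (S C : {set T}).

Definition simple_graph E : bool := [forall e in E, #|e| == 2].

Definition clique E S : bool :=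
  [forall u in S, forall v in S, (u != v) ==> ([set u; v] \in E)].

(* [ktree_on k E S]: the subgraph of E induced on S is a k-tree.  In the second
   rule, v is the new vertex and its neighbors in S are exactly those in C. *)
Inductive ktree_on (k : nat) E : {set T} -> Prop :=
| ktree_complete S : #|S| = k -> clique E S -> ktree_on k E S
| ktree_add S C v :
    ktree_on k E S -> v \notin S ->
    C \subset S -> #|C| = k -> clique E C ->
    (forall u, u \in S -> ([set v; u] \in E) = (u \in C)) ->
    ktree_on k E (v |: S).

Definition ktree (k : nat) E : Prop := simple_graph E /\ ktree_on k E [set: T].

Definition hedra (k : nat) E : {set {set T}} :=
  [set C | clique E C & #|C| == k.+1].

Definition graph_iso E E' : bool :=
  [exists s : {perm T}, E' == [set s @: (e : {set T}) | e in E]].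

Definition ktrees_hedra (k n : nat) : {set {set {set T}}} :=
  [set E | `[< ktree k E >] & #|hedra k E| == n].

End KTrees.

(* Isomorphism classes of k-trees with n hedra, summed over the number N of
   vertices; only N = n + k contributes. *)
Definition num_ktrees (k n : nat) : nat :=
  \big[addn/0%N]_(N \in [set: nat]%classic)
    #|equivalence_partition (@graph_iso 'I_N) (ktrees_hedra 'I_N k n)|.

Definition ktree_gf (k : nat) : nat -> rat := fun n => ((num_ktrees k n)%:R)%R.

Definition cycle_type (T : finType) (s : {perm T}) : seq nat :=
  sort geq [seq #|(o : {set T})| | o <- enum (porbits s)].

(* A partition is the nonincreasing list of its (positive) parts, so that
   [rcons l 1] is the partition l with one extra part 1. *)
Definition int_partition (n : nat) : set (seq nat) :=
  [set l | [/\ sorted geq l, all (leq 1) l & sumn l = n]]%classic.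

Definition zee (l : seq nat) : nat :=
  \prod_(1 <= i < (sumn l).+1) (i ^ count_mem i l * (count_mem i l)`!).

(* [structures A B] is the set of structures whose X-labels are A and whose
   Y-labels are B, as a subset of a finite type.  Only what enters the cycle
   index is recorded: transport along permutations of the labels, and the
   action of the elements of G. *)
Record gspecies (G : Type) := GSpecies {
  carrier : finType -> finType -> finType;
  structures : forall A B : finType, {set carrier A B};
  relabel : forall A B : finType,
    {perm A} -> {perm B} -> carrier A B -> carrier A B;
  gact : forall A B : finType, G -> carrier A B -> carrier A B
}.

Section CycleIndex.
Local Open Scope ring_scope.
Variables (G : Type) (F : gspecies G) (g : G).

Definition fixed_structures (m n : nat) (s : 'S_m) (t : 'S_n) :
    {set carrier F 'I_m 'I_n} :=
  [set S in structures F 'I_m 'I_n | gact g (relabel s t S) == S]%SET.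

(* The coefficient of p_l[x] p_r[y], where p_l is the product of the p_i over
   the parts i of l.  It vanishes unless l and r are partitions; a monomial with
   partitions l and r only arises from the permutations of cycle types l and r,
   hence from m = sumn l and n = sumn r. *)
Definition cycle_index (l r : seq nat) : rat :=
  ((sumn l)`!%:R * (sumn r)`!%:R)^-1 *
  \sum_(s : 'S_(sumn l) | cycle_type s == l)
    \sum_(t : 'S_(sumn r) | cycle_type t == r)
      #|fixed_structures s t|%:R.

(* Under p_i[x] = x^i and p_i[y] = 1, the monomial p_l[x] p_r[y] becomes
   x^(sumn l). *)
Definition ogf : nat -> rat := fun m =>
  \sum_(lr \in [set lr : seq nat * seq nat | sumn lr.1 = m]%classic)
    cycle_index lr.1 lr.2.

End CycleIndex.

Definition is_tree (T : finType) (e : rel T) : Prop :=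
  [/\ 0 < #|T|, forall u v, connect e u v
    & forall s : seq T, 2 < size s -> ~ ucycle e s].

Section CodingTrees.
Variables (k : nat) (A B : finType).

(* The black vertices are A and the white ones B.  The cyclic ordering of the
   neighbors of a black vertex a is given by the successor permutation c a, a
   cycle whose support is the set of neighbors of a. *)
Definition cyclic_orders : finType := {ffun A -> {perm B}}.
Implicit Types (c : cyclic_orders) (a x : A) (b w r : B) (v : A + B).

Definition adj c : rel (A + B) := fun u v =>
  match u, v with
  | inl a, inr b => c a b != b
  | inr b, inl a => c a b != b
  | _, _ => false
  end.

Definition cyclic_on_neighbors c : Prop := forall a, exists b,
  #|porbit (c a) b| = k.+1 /\ forall w, (c a w != w) = (w \in porbit (c a) b).

Definition coding_tree c : Prop := cyclic_on_neighbors c /\ is_tree (adj c).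

(* [toward c v a w]: w is the neighbor of the black vertex a in the direction
   of the vertex v (no w qualifies when v is a itself). *)
Definition toward c v a w : bool :=
  adj c (inl a) (inr w) &&
  connect [rel p q | [&& adj c p q, p != inl a & q != inl a]] (inr w) v.

(* The positions 1, ..., k+1 are elements of 'I_k.+1 with its addition modulo
   k+1, position k+1 being 0.  When the cyclic order at a is linearized with the
   neighbor w last, its position i is occupied by (c a)^i w. *)
Definition at_pos c a w (i : 'I_k.+1) : B := (c a ^+ i)%g w.

Lemma rho_subproof (i : 'I_k.+1) (s : 'S_k.+1) :
  injective (fun a : 'I_k.+1 => s (i + a) - s i)%R.
Proof. by move=> a b /addIr /perm_inj /addrI. Qed.

Definition rho (i : 'I_k.+1) (s : 'S_k.+1) : 'S_k.+1 := perm (@rho_subproof i s).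

(* Orient the tree toward v and let W be the subtree hanging from the white
   vertex w.  [local_perm c v s w a t]: in the recursive action of s on W, the
   positions at the black vertex a of W get permuted by t. *)
Inductive local_perm c v : 'S_k.+1 -> B -> A -> 'S_k.+1 -> Prop :=
| local_perm_here s w a :
    toward c v a w -> local_perm c v s w a s
| local_perm_below s w x (i : 'I_k.+1) a t :
    toward c v x w -> i != ord0 ->
    local_perm c v (rho i s) (at_pos c x w i) a t ->
    local_perm c v s w a t.

Definition seq_cycle (l : seq B) : {perm B} :=
  perm (can_inj (prev_next (undup_uniq l))).

(* The cyclic order at a once its positions, linearized with w last, have been
   permuted by t: the neighbor at position i goes to position t i. *)
Definition permute_at c a w (t : 'S_k.+1) : {perm B} :=
  seq_cycle [seq at_pos c a w ((t^-1)%g j) | j : 'I_k.+1].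

Definition relabel_orders (mu : {perm A}) (nu : {perm B}) c : cyclic_orders :=
  [ffun a => (c ((mu^-1)%g a) ^ nu)%g].

Definition ctY_set : {set cyclic_orders * B} :=
  [set cr | `[< coding_tree cr.1 >]]%SET.

Definition ctY_relabel (mu : {perm A}) (nu : {perm B})
    (cr : cyclic_orders * B) : cyclic_orders * B :=
  (relabel_orders mu nu cr.1, nu cr.2).

(* Here 'S_k permutes the positions 1, ..., k, position i+1 being the element
   i of 'I_k, i.e., [lift ord0 i] in 'I_k.+1. *)
Definition ctY_act (s : 'S_k) (cr : cyclic_orders * B) : cyclic_orders * B :=
  let: (c, r) := cr in
  ([ffun a => if [pick wt : B * 'S_k.+1 |
                    toward c (inr r) a wt.1 &&
                    `[< local_perm c (inr r) (lift_perm ord0 ord0 s) r a wt.2 >]]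
              is Some (w, t) then permute_at c a w t else c a],
   r).

(* In a tree rooted at the edge (x, r), the orientation is toward x, so that x
   is not below r, and r is last in the linear order at x. *)

Definition ctXY_set : {set cyclic_orders * (A * B)} :=
  [set cxr | `[< coding_tree cxr.1 >] &
             adj cxr.1 (inl cxr.2.1) (inr cxr.2.2)]%SET.

Definition ctXY_relabel (mu : {perm A}) (nu : {perm B})
    (cxr : cyclic_orders * (A * B)) : cyclic_orders * (A * B) :=
  (relabel_orders mu nu cxr.1, (mu cxr.2.1, nu cxr.2.2)).

Definition ctXY_act (s : 'S_k.+1) (cxr : cyclic_orders * (A * B)) :
    cyclic_orders * (A * B) :=
  let: (c, (x, r)) := cxr in
  ([ffun a =>
      if a == x then permute_at c x r s
      else if [pick wt : B * 'S_k.+1 |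
                 toward c (inl x) a wt.1 &&
                 `[< exists i : 'I_k.+1,
                     local_perm c (inl x) (rho i s) (at_pos c x r i) a wt.2 >]]
           is Some (w, t) then permute_at c a w t else c a],
   (x, at_pos c x r ((s^-1)%g ord0))).

End CodingTrees.

Definition CTY (k : nat) : gspecies 'S_k :=
  @GSpecies 'S_k (fun A B => (cyclic_orders A B * B)%type)
    (ctY_set k) ctY_relabel (@ctY_act k).

Definition CTXY (k : nat) : gspecies 'S_k.+1 :=
  @GSpecies 'S_k.+1 (fun A B => (cyclic_orders A B * (A * B))%type)
    (ctXY_set k) ctXY_relabel (@ctXY_act k).

(* Main.v *)
Require Import Defs.
From mathcomp Require Import all_boot all_order all_algebra all_fingroup.
From mathcomp Require Import boolp classical_sets functions fsbigop.
From mathcomp Require Import fintype finset zify ring.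

(** The idea is to replace cyclic orders by colours.  In a coding tree, colour the
    white vertices by the integers modulo [k+1] in such a way that the cyclic order
    at every black vertex increases the colour by 1; on a tree such a colouring exists
    and is determined by the colour of one white vertex.  Conversely, a bipartite tree
    whose white vertices are coloured so that each black vertex has exactly one
    neighbour of each colour (a coloured tree) determines the cyclic orders.  So a
    white-rooted coding tree is a coloured tree whose root has colour 0, and an
    edge-rooted coding tree is a coloured tree with a chosen black vertex, the root
    edge going to its neighbour of colour 0.  The recursion with [rho] is exactly what
    makes [sigma] act by composing the colouring with [sigma]: below a white vertex
    of colour [c], the element that acts is [rho c sigma] ([local_permE],
    [permute_at_recolour]).

    Let [A] and [B] be the sets of black and white labels.  The sum over partitions
    weighted by [1/z] is an average over the symmetric group ([class_average]), so
    each of the three terms of the formula is an average of numbers of fixed points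
    of elements [h] of the product of the symmetric groups of [A], [B] and the colours:
    fixed pairs (coloured tree, black vertex), (coloured tree, white vertex) and
    (coloured tree, edge).  For the last two, only the elements fixing the colour 0 and
    the roots of colour 0 are counted, which is compensated by the factor [k+1]
    ([sum_over_root_colour]).  A colour-preserving automorphism of a tree fixes one
    more vertex than it fixes edges ([tree_fixed_points]), hence the alternating sum
    counts the coloured trees fixed by [h], and the lemma of Cauchy and Frobenius turns
    the average into the number of orbits of coloured trees
    ([burnside_dissymmetry], [weighted_ogf_sum]).

    It remains to match these orbits with the isomorphism classes of k-trees.  A k-tree
    has a proper colouring with [k+1] colours, unique up to a permutation of the colours;
    its hedra and fronts, related by inclusion, form a tree, and colouring each front
    by the colour that it misses gives a coloured tree ([codes_tree]).  The k-tree is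
    recovered from the coloured tree: after the white vertices of colour [j] are
    removed, the components are the vertices of colour [j] ([codes_iso]), and every
    coloured tree arises in this way ([tree_graph_ktree], [tree_graph_codes]). *)

Set Implicit Arguments.
Unset Strict Implicit.
Unset Printing Implicit Defensive.

Import GRing.Theory Num.Theory.

(** * Bridges and automorphisms of trees *)

Lemma connect_ind (T : finType) (e : rel T) (P : T -> Prop) x y :
  P x -> (forall u v, P u -> e u v -> P v) -> connect e x y -> P y.
Proof.
move=> Px Pe /connectP[p pp ->]; elim: p x Px pp => //= z p IH x Px /andP[xz].
by apply: IH; apply: Pe xz.
Qed.

Lemma is_tree_iso (T U : finType) (e : rel T) (e' : rel U) (f : U -> T) :
  bijective f -> (forall x y, e' x y = e (f x) (f y)) -> is_tree e -> is_tree e'.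
Proof.
move=> [g fK gK] E [c0 cc acyc]; have fi := can_inj fK.
split; first by rewrite (bij_eq_card (Bijective fK gK)).
- move=> u v; rewrite -(fK v); apply: (@connect_ind _ e (fun t => connect e' u (g t)) (f u)) => //.
    by rewrite fK.
  by move=> x y ux xy; apply: connect_trans ux (connect1 _); rewrite E !gK.
- move=> s s2 /andP[cs us]; apply: (acyc (map f s)); first by rewrite size_map.
  rewrite /ucycle map_inj_uniq // us andbT.
  case: s cs {us s2} => //= x s; rewrite -map_rcons path_map.
  by apply: sub_path => a b; rewrite E.
Qed.

Section Trees.
Variables (T : finType) (e : rel T).

Definition del_edge u v : rel T := fun x y =>
  [&& e x y, ~~ ((x == u) && (y == v)) & ~~ ((x == v) && (y == u))].

Definition del_vertex v : rel T := [rel x y | [&& e x y, x != v & y != v]].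

Hypothesis symE : symmetric e.
Hypothesis eirr : irreflexive e.

Lemma del_edge_sym u v : symmetric (del_edge u v).
Proof. by move=> x y; rewrite /del_edge symE; case: (x == u); case: (x == v); case: (y == u);
  case: (y == v). Qed.

Lemma del_edgeC u v : del_edge u v =2 del_edge v u.
Proof. by move=> x y; rewrite /del_edge; case: (x == u); case: (x == v); case: (y == u);
  case: (y == v). Qed.

Lemma del_vertex_sym v : symmetric (del_vertex v).
Proof. by move=> x y; rewrite /del_vertex /= symE [(x != v) && _]andbC. Qed.

Hypothesis etree : is_tree e.

Let conn u v : connect e u v.
Proof. by case: etree. Qed.

(** Otherwise a simple path that joins the ends of the edge without using it closes up to a
    cycle. *)
Lemma bridge u v : e u v -> ~~ connect (del_edge u v) u v.
Proof.
move=> euv; apply/negP => /connectP[p0 /shortenP[p pp up _] lp {p0}].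
have [_ _ /(_ (u :: p))] := etree; apply.
  case: p lp pp up => [/= vu|a [|b p]] //.
    by rewrite vu eirr in euv.
  by rewrite /= => -> /andP[]; rewrite /del_edge !eqxx /= andbF.
rewrite /ucycle up andbT /= rcons_path -lp symE euv andbT.
by apply: sub_path pp => x y /and3P[].
Qed.

Lemma side_total u v t :
  connect (del_edge u v) u t || connect (del_edge u v) v t.
Proof.
have /connectP[p pp ->] := conn u t.
elim/last_ind: p pp => [|p x IH] /=; first by rewrite connect0.
rewrite rcons_path last_rcons => /andP[/IH {IH}].
set y := last u p => /orP IH eyx.
have [E|yx] := boolP (del_edge u v y x).
  by case: IH => IH; rewrite (connect_trans IH (connect1 E)) ?orbT.
move: yx; rewrite /del_edge eyx /= -negb_or negbK.
by case/orP => /andP[_ /eqP->]; rewrite connect0 ?orbT.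
Qed.

Lemma side_excl u v t : e u v ->
  connect (del_edge u v) u t -> ~~ connect (del_edge u v) v t.
Proof.
move=> euv ut; apply: contra (bridge euv) => vt.
by apply: connect_trans ut _; rewrite sym_connect_sym //; apply: del_edge_sym.
Qed.

(** A walk from [u] that avoids the edge [v u] cannot meet [v], for it would show that the
    edge is not a bridge. *)
Lemma del_vertexE u v t : e v u ->
  connect (del_vertex v) u t = connect (del_edge v u) u t.
Proof.
move=> evu; apply/idP/idP.
  apply: connect_sub => x y /and3P[exy xv yv]; apply: connect1.
  by rewrite /del_edge exy (negPf xv) (negPf yv) andbF.
move=> ut; case/connectP: (ut) => p pp lp; rewrite lp.
apply/connectP; exists p => //.
have nv x : connect (del_edge v u) u x -> x != v.
  move=> ux; apply: contraL ux => /eqP ->.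
  by rewrite sym_connect_sym ?bridge //; apply: del_edge_sym.
suff: forall x, connect (del_edge v u) u x -> path (del_edge v u) x p ->
    path (del_vertex v) x p by apply.
elim: p {pp lp} => //= y p IH x ux /andP[exy pp].
have uy := connect_trans ux (connect1 exy).
by rewrite (IH y) // /del_vertex /= !nv //; case/and3P: exy => ->.
Qed.

(** The first vertex after [v] on the simple path to [t]. *)
Lemma step_exists v t : t != v -> exists2 u, e v u & connect (del_vertex v) u t.
Proof.
move=> tv; have /connectP[p0 /shortenP[p pp up _] lp {p0}] := conn v t.
case: p pp up lp => [_ _ tv'|u p /=]; first by rewrite tv' /= eqxx in tv.
case/andP=> evu pp /andP[vp _] lp; exists u => //.
apply/connectP; exists p => //.
elim: p u pp vp {evu lp} => //= y p IH x /andP[exy pp].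
rewrite !inE !negb_or => /and3P[vx vy vp].
by rewrite (IH y) ?inE ?negb_or ?vy // /del_vertex /= exy !(eq_sym _ v) vx vy.
Qed.

(** Two such neighbours would be joined by a walk avoiding [v], so that neither of the
    edges to [v] would be a bridge. *)
Lemma step_uniq v t u u' : e v u -> e v u' ->
  connect (del_vertex v) u t -> connect (del_vertex v) u' t -> u = u'.
Proof.
move=> evu evu' ut u't; apply/eqP/negPn/negP => uu'.
have: connect (del_vertex v) u u'.
  by apply: connect_trans ut _; rewrite sym_connect_sym //; apply: del_vertex_sym.
rewrite del_vertexE // => c.
have: connect (del_edge v u) u v.
  apply: connect_trans c (connect1 _).
  rewrite /del_edge symE evu' eqxx andbT (eq_sym u' u) uu' andbT /=.
  by apply/negP => /andP[_ /eqP vu]; rewrite vu eirr in evu.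
by apply/negP; rewrite sym_connect_sym ?bridge //; apply: del_edge_sym.
Qed.

Lemma cross u v x y : e u v -> connect (del_edge u v) u x ->
  connect (del_edge u v) v y -> e x y -> x = u /\ y = v.
Proof.
move=> euv ux vy exy.
have [E|] := boolP (del_edge u v x y).
  by have := side_excl euv (connect_trans ux (connect1 E)); rewrite vy.
rewrite /del_edge exy /= -negb_or negbK => /orP[] /andP[/eqP xu /eqP yv] //.
by move: (bridge euv); rewrite xu in ux; rewrite ux.
Qed.

Lemma cross_connect (r : rel T) u v x y : e u v -> subrel r e ->
  connect (del_edge u v) u x -> connect (del_edge u v) v y ->
  connect r x y -> [/\ connect r x u, r u v & connect r v y].
Proof.
move=> euv sr ux vy /connectP[p pp lp].
elim: p x pp lp ux => [|z p IH] x /= => [_ yx|/andP[rxz pp] lp] ux.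
  by have := side_excl euv ux; rewrite -yx vy.
case/orP: (side_total u v z) => uz.
  by have [c1 c2 c3] := IH _ pp lp uz; split=> //; apply: connect_trans c1; apply: connect1.
have [xu zv] := cross euv ux uz (sr _ _ rxz).
by split; rewrite -?zv -?xu //; apply/connectP; exists p.
Qed.

(** Induction along the growth of a tree: each new vertex [y] is attached by an edge [w y], and
    the whole part [S] already built lies on the side of [w] of this bridge. *)
Lemma tree_growth (r : T) (P : {set T} -> Prop) :
  P [set r] ->
  (forall (S : {set T}) w y, P S -> r \in S -> w \in S -> y \notin S -> e w y ->
     (forall x, x \in S -> connect (del_edge w y) w x) -> P (y |: S)) ->
  P [set: T].
Proof.
move=> P0 PS.
pose good S := [/\ P S, r \in S & forall x, x \in S ->
  connect [rel p q | [&& e p q, p \in S & q \in S]] r x].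
have G0 : good [set r].
  by split; rewrite ?inE // => x; rewrite inE => /eqP ->; apply: connect0.
have grow m : m < #|T| -> exists2 S, good S & #|S| = m.+1.
  elim: m => [_|m IH mT]; first by exists [set r]; rewrite ?cards1.
  have [S [PSS rS cS] cardS] := IH (ltnW mT).
  have [z zS] : exists z, z \notin S.
    apply/existsP; rewrite -negb_forall; apply: contraTN mT => /forallP aS.
    by rewrite -leqNgt -cardS; apply/subset_leq_card/fintype.subsetP.
  have [w [y [wS yS ewy]]] : exists w y, [/\ w \in S, y \notin S & e w y].
    have /connectP[p pp lp] := conn r z; move: (r) rS pp lp.
    elim: p => [|y p IHp] w wS /=; first by move=> _ zw; rewrite zw wS in zS.
    case/andP=> ewy pp lp; have [yS|yS] := boolP (y \in S); first exact: IHp pp lp.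
    by exists w, y.
  exists (y |: S); last by rewrite cardsU1 yS cardS add1n.
  have sub a b : connect [rel p q | [&& e p q, p \in S & q \in S]] a b ->
    connect [rel p q | [&& e p q, p \in y |: S & q \in y |: S]] a b.
    apply: connect_sub => p q /and3P[epq pS qS]; apply: connect1.
    by rewrite /= epq !inE pS qS !orbT.
  split; last 1 first.
  - move=> x; rewrite !inE => /orP[/eqP ->|/cS]; last exact: sub.
    apply: connect_trans (sub _ _ (cS _ wS)) (connect1 _).
    by rewrite /= ewy !inE wS eqxx orbT.
  - apply: (PS S w) => // x xS.
    have sub' a b : connect [rel p q | [&& e p q, p \in S & q \in S]] a b ->
        connect (del_edge w y) a b.
      apply: connect_sub => p q /and3P[epq pS qS]; apply: connect1.
      rewrite /del_edge epq /=; apply/andP; split; apply/negP => /andP[/eqP a1 /eqP a2].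
        by rewrite -a2 qS in yS.
      by rewrite -a1 pS in yS.
    apply: (connect_trans (y := r)); last exact/sub'/cS.
    by rewrite sym_connect_sym; [exact/sub'/cS | exact: del_edge_sym].
  - by rewrite !inE rS orbT.
have T0 : 0 < #|T| by case: etree.
have [|S [PSS _ _] cS] := grow #|T|.-1; first by rewrite prednK.
suff -> : [set: T] = S by [].
by symmetry; apply/eqP; rewrite eqEcard finset.subsetT cardsT cS prednK /=.
Qed.

(** Edge weights on a tree are the differences of a potential, since a new vertex is adjacent
    to a single old one. *)
Lemma tree_potential (G : zmodType) (g : T -> T -> G) (r : T) :
  (forall x y, e x y -> g y x = - g x y)%R ->
  exists2 f : T -> G, f r = 0%R & forall x y, e x y -> f y = (f x + g x y)%R.
Proof.
move=> gN.
suff [f f0 ff] : exists2 f : T -> G, f r = 0%R &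
    forall x y, x \in [set: T] -> y \in [set: T] -> e x y -> f y = (f x + g x y)%R.
  by exists f => // x y; apply: ff; rewrite inE.
apply: (@tree_growth r (fun S => exists2 f : T -> G, f r = 0%R &
  forall x y, x \in S -> y \in S -> e x y -> f y = (f x + g x y)%R)) =>
  [|S w y [f f0 ff] rS wS yS ewy wy].
  exists (fun=> 0%R) => // x y; rewrite !inE => /eqP -> /eqP ->.
  by rewrite eirr.
have un x : x \in S -> e x y -> x = w.
  by move=> xS exy; have [] := cross ewy (wy _ xS) (connect0 _ _) exy.
exists (fun x => if x == y then (f w + g w y)%R else f x).
  by case: eqP => // ry; rewrite -ry rS in yS.
move=> x z; rewrite !inE.
case: (x =P y) => [-> _|_ /= xS]; case: (z =P y) => [->|_] /=.
- by rewrite eirr.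
- move=> zS eyz; have zw : z = w by apply: un; rewrite // symE.
  by rewrite zw (gN w y) // addrK.
- by move=> _ exy; rewrite (un x).
- by move=> zS exz; apply: ff.
Qed.

End Trees.

Section BipartiteCount.
Variables (A B : finType) (e : rel (A + B)).
Hypothesis symE : symmetric e.
Hypothesis eAA : forall a a', e (inl a) (inl a') = false.
Hypothesis eBB : forall b b', e (inr b) (inr b') = false.
Hypothesis etree : is_tree e.

Let eirr : irreflexive e.
Proof. by case=> x; rewrite ?eAA ?eBB. Qed.

Variable f : A + B -> A + B.
Hypothesis fhom : forall u v, e u v -> f u = f v \/ e (f u) (f v).
Hypothesis finv : forall u v, e u v -> f u = v -> f v = u -> False.

(** A vertex that moves under [f] steps along the edge that leads towards its image. *)
Definition steps v u := e v u && connect (del_vertex e v) u (f v).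

Lemma steps_count v (D : finType) (g : D -> A + B) : injective g ->
  (forall u, e v u -> exists d, u = g d) ->
  \sum_(d : D) steps v (g d) = (f v != v).
Proof.
move=> ginj gsurj; have [fv|fv] := eqVneq (f v) v; last first.
  have [u evu cu] := step_exists etree fv.
  have [d ud] := gsurj _ evu; rewrite (bigD1 d) //= big1 ?addn0.
    by rewrite /steps -ud evu cu.
  move=> d' dd'; apply/eqP; rewrite eqb0; apply: contra dd' => /andP[evd' cd'].
  by apply/eqP/ginj; rewrite -ud; apply: step_uniq cu; rewrite // eirr.
apply: big1 => d _; apply/eqP; rewrite eqb0; apply/negP => /andP[evu].
by rewrite fv del_vertexE // sym_connect_sym;
  [rewrite (negPf (bridge _ _ _ evu))|exact: del_edge_sym].
Qed.

(** If neither end of an edge steps across it, the images of the ends lie on the same sides as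
    the ends, so that both ends are fixed; if both ends step across it, they are exchanged,
      which is excluded. *)
Lemma steps_edge u v : e u v ->
  (steps u v + steps v u + ((f u == u) && (f v == v)) = 1)%N.
Proof.
move=> euv; have evu : e v u by rewrite symE.
have E1 : steps u v = connect (del_edge e u v) v (f u).
  by rewrite /steps euv del_vertexE.
have E2 : steps v u = connect (del_edge e u v) u (f v).
  by rewrite /steps evu del_vertexE // (eq_connect (del_edgeC e v u)).
have X := side_excl symE eirr etree euv.
have C := cross symE eirr etree euv.
have tot := side_total etree u v.
rewrite E1 E2.
have [c1|c1] := boolP (connect _ v (f u)).
  have [c2|c2] := boolP (connect _ u (f v)).
    have [fE|/[!(symE (f u))] fE] := fhom euv.
      by move: (X _ c2); rewrite -fE c1.
    by have [vu uv] := C _ _ c2 c1 fE; case: (finv euv uv vu).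
  case: eqP => //= fu; move: (bridge symE eirr etree euv) c1.
  by rewrite fu sym_connect_sym; [move/negPf-> | exact: del_edge_sym].
have [c2|c2] := boolP (connect _ u (f v)).
  case: (f v =P v) => [fv|_]; last by rewrite andbF.
  by move: (bridge symE eirr etree euv); rewrite -{2}fv c2.
have := tot (f u); rewrite (negPf c1) orbF => d1.
have := tot (f v); rewrite (negPf c2) /= => d2.
have [fE|fE] := fhom euv; first by move: (X _ d1); rewrite fE d2.
by have [-> ->] := C _ _ d1 d2 fE; rewrite !eqxx.
Qed.

Definition edge_set := [set ab : A * B | e (inl ab.1) (inr ab.2)].

(** Every moving vertex steps across exactly one edge, and every edge is crossed exactly once
    unless it is fixed: moving vertices are as many as edges that are not fixed. *)
Lemma fixed_count :
  (#|[set a | f (inl a) == inl a]| + #|[set b | f (inr b) == inr b]| + #|edge_set|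
  = #|A| + #|B| + #|[set ab in edge_set |
      (f (inl ab.1) == inl ab.1) && (f (inr ab.2) == inr ab.2)]|)%N.
Proof.
have s1 a : \sum_(b : B) steps (inl a) (inr b) = (f (inl a) != inl a).
  apply: steps_count => [b b' [] //|[a'|b]]; first by rewrite eAA.
  by exists b.
have s2 b : \sum_(a : A) steps (inr b) (inl a) = (f (inr b) != inr b).
  apply: steps_count => [a a' [] //|[a|b']]; last by rewrite eBB.
  by exists a.
pose F ab := ((f (inl ab.1) == inl ab.1) && (f (inr ab.2) == inr ab.2)) : bool.
have sE : \sum_(ab : A * B) (steps (inl ab.1) (inr ab.2) + steps (inr ab.2) (inl ab.1)) +
    \sum_(ab in edge_set) F ab = #|edge_set|.
  pose st (ab : A * B) := (steps (inl ab.1) (inr ab.2) + steps (inr ab.2) (inl ab.1))%N.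
  have -> : \sum_ab st ab = \sum_(ab in edge_set) st ab.
    rewrite [RHS]big_mkcond; apply: eq_bigr => -[a b] _; rewrite inE /=.
    by case: ifP => // eab; rewrite /st /steps /= (symE (inr b)) eab.
  rewrite -sum1_card -big_split /=; apply: eq_bigr => -[a b].
  by rewrite inE /= => eab; apply: steps_edge.
have sA : \sum_(ab : A * B) steps (inl ab.1) (inr ab.2) = \sum_a (f (inl a) != inl a).
  by rewrite -(pair_bigA _ (fun a b => nat_of_bool (steps (inl a) (inr b))));
    apply: eq_bigr => a _ /=.
have sB : \sum_(ab : A * B) steps (inr ab.2) (inl ab.1) = \sum_b (f (inr b) != inr b).
  rewrite -(pair_bigA _ (fun a b => nat_of_bool (steps (inr b) (inl a)))) exchange_big.
  by apply: eq_bigr => b _ /=.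
have cnt (D : finType) (p : pred D) : (#|[set d | p d]| + \sum_d ~~ p d = #|D|)%N.
  by rewrite -sum1dep_card big_mkcond -big_split /= -sum1_card; apply: eq_bigr => d _; case: (p d).
rewrite big_split /= sA sB in sE.
have c3 : \sum_(ab in edge_set) F ab = #|[set ab in edge_set | F ab]|.
  by rewrite -sum1dep_card big_mkcondr; apply: eq_bigr => ab _; case: (F ab).
rewrite c3 in sE; rewrite -/F.
have := cnt A (fun a => f (inl a) == inl a); have := cnt B (fun b => f (inr b) == inr b).
by move=> <- <-; rewrite -sE [in RHS]addnACA !addnA.
Qed.

End BipartiteCount.

Section BipartiteEuler.
Variables (A B : finType) (e : rel (A + B)).
Hypothesis symE : symmetric e.
Hypothesis eAA : forall a a', e (inl a) (inl a') = false.
Hypothesis eBB : forall b b', e (inr b) (inr b') = false.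
Hypothesis etree : is_tree e.

(** The case of a constant map, which fixes one vertex and no edge. *)
Lemma tree_euler : (#|edge_set e| + 1 = #|A| + #|B|)%N.
Proof.
have eirr : irreflexive e by case=> x; rewrite ?eAA ?eBB.
have /card_gt0P[r _] : 0 < #|{: A + B}| by case: etree.
have := @fixed_count A B e symE eAA eBB etree (fun=> r)
  (fun u v _ => or_introl erefl).
have rinv u v : e u v -> r = v -> r = u -> False.
  by move=> euv rv ru; rewrite -rv -ru eirr in euv.
move/(_ rinv); clear rinv.
set F1 := [set a | _]; set F2 := [set b | _]; set F3 := [set ab in _ | _].
have -> : F3 = finset.set0.
  by apply/setP => -[a b]; rewrite !inE; case: r @F1 @F2 @F3 => r; rewrite /= ?andbF.
suff -> : (#|F1| + #|F2| = 1)%N by rewrite cards0; lia.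
case: r @F1 @F2 @F3 => r F1 F2 _.
  have -> : F1 = [set r] by apply/setP => x; rewrite !inE eq_sym.
  by have -> : F2 = finset.set0; [apply/setP => x; rewrite !inE | rewrite cards0 cards1].
have -> : F2 = [set r] by apply/setP => x; rewrite !inE eq_sym.
by have -> : F1 = finset.set0; [apply/setP => x; rewrite !inE | rewrite cards0 cards1].
Qed.

(** An automorphism that preserves the two kinds of vertices cannot invert an edge. *)
Lemma tree_fixed_points (f : A + B -> A + B) :
  (forall u v, e u v -> e (f u) (f v)) -> (forall a, exists a', f (inl a) = inl a') ->
  (#|[set a | f (inl a) == inl a]| + #|[set b | f (inr b) == inr b]| =
   #|[set ab in edge_set e | (f (inl ab.1) == inl ab.1) && (f (inr ab.2) == inr ab.2)]| + 1)%N.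
Proof.
move=> fe fA.
have H := @fixed_count A B e symE eAA eBB etree f.
have {}H := H (fun u v euv => or_intror (fe u v euv)).
have finv u v : e u v -> f u = v -> f v = u -> False.
  move: u v => [a|b] [a'|b'] euv fu fv; rewrite ?eAA ?eBB // in euv.
    by have [a''] := fA a; rewrite fu.
  by have [a''] := fA a'; rewrite fv.
have := H finv; have := tree_euler; lia.
Qed.

End BipartiteEuler.

(** * Cycle types, conjugacy and centralisers of permutations *)

Section Cycles.
Variable T : finType.
Implicit Types (s t p : {perm T}) (x y z : T) (S : {set T}).

Lemma porbit_modn s x i : (s ^+ (i %% #|porbit s x|))%g x = (s ^+ i)%g x.
Proof.
rewrite [in RHS](divn_eq i #|porbit s x|) expgD permM mulnC expgM.
have sN : (s ^+ #|porbit s x|)%g x = x by rewrite permX iter_porbit.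
suff -> : ((s ^+ #|porbit s x|) ^+ (i %/ #|porbit s x|))%g x = x by [].
elim: (i %/ _)%N => [|q IH]; first by rewrite expg0 perm1.
by rewrite expgS permM sN.
Qed.

Lemma porbit_exp_inj s x i j : i < #|porbit s x| -> j < #|porbit s x| ->
  (s ^+ i)%g x = (s ^+ j)%g x -> i = j.
Proof.
move=> iN jN; rewrite !permX => E; apply/eqP.
have := nth_uniq x (s := traject s x #|porbit s x|) (i := i) (j := j).
rewrite size_traject !nth_traject // E eqxx => /(_ iN jN (uniq_traject_porbit s x)).
by move/esym.
Qed.

(** The exponents agree modulo the length of the cycle of [x], which is also that of [y]. *)
Lemma expg_perm_eq s t x y i j : #|porbit s x| = #|porbit t y| ->
  (s ^+ i)%g x = (s ^+ j)%g x -> (t ^+ i)%g y = (t ^+ j)%g y.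
Proof.
move=> c; rewrite -(porbit_modn s x i) -(porbit_modn s x j) => E.
have N0 : 0 < #|porbit s x| by rewrite lt0n card_porbit_neq0.
rewrite -(porbit_modn t y i) -(porbit_modn t y j) -c.
by rewrite (porbit_exp_inj _ _ E) ?ltn_mod.
Qed.

Lemma porbit_step s x : porbit s (s x) = porbit s x.
Proof. by have := porbit_perm s 1 x; rewrite expg1. Qed.

(** A permutation carrying [s] to [t] is determined by the images of one representative of each
    cycle of [s]; these can be chosen freely on [t]-cycles of the same lengths, provided that
    distinct cycles have images on distinct cycles. *)
Lemma conj_perm_exists s t (rho rho' : T -> T) :
  (forall z, rho z \in porbit s z) -> (forall z, rho (s z) = rho z) ->
  (forall z, rho' (s z) = rho' z) ->
  (forall z, #|porbit t (rho' z)| = #|porbit s z|) ->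
  (forall z z', porbit t (rho' z) = porbit t (rho' z') -> porbit s z = porbit s z') ->
  exists p, (forall z, p (s z) = t (p z)) /\ (forall z, p (rho z) = rho' z).
Proof.
move=> r1 r2 r2' r3 r4.
have inv (h : T -> T) : (forall z, h (s z) = h z) ->
    forall z z', z \in porbit s z' -> h z = h z'.
  move=> hs z z' /porbitP[i ->]; elim: i => [|i IH]; first by rewrite expg0 perm1.
  by rewrite expgSr permM hs.
have /choice[f fP] : forall z, exists w,
    exists i, z = (s ^+ i)%g (rho z) /\ w = (t ^+ i)%g (rho' z).
  move=> z; have /porbitP[i zi] : z \in porbit s (rho z) by rewrite porbit_sym.
  by exists ((t ^+ i)%g (rho' z)), i.
have fE z i : z = (s ^+ i)%g (rho z) -> f z = (t ^+ i)%g (rho' z).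
  move=> zi; have [j [zj ->]] := fP z.
  apply: (@expg_perm_eq s t (rho z)); last by rewrite -zj.
  by rewrite r3; move: (r1 z); rewrite -eq_porbit_mem => /eqP ->.
have finj : injective f.
  move=> z z' E; have [i [zi fi]] := fP z; have [j [zj fj]] := fP z'.
  have O : porbit s z = porbit s z'.
    apply: r4; rewrite -(porbit_perm t i) -fi E fj porbit_perm //.
  have zz' : z \in porbit s z' by rewrite -O porbit_id.
  have rr : rho z = rho z' by apply: inv.
  rewrite zi zj rr; apply: (@expg_perm_eq t s (rho' z)).
    by rewrite r3 -rr; move: (r1 z); rewrite -eq_porbit_mem => /eqP ->.
  by rewrite -fi E fj (inv rho' r2' _ _ zz').
exists (perm finj); split=> z; rewrite !permE.
  have [i [zi ->]] := fP z; rewrite (fE _ i.+1) ?r2' ?expgSr ?permM //.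
  by rewrite r2 -zi.
rewrite (fE _ 0) ?expg0 ?perm1; last by rewrite (inv rho r2 _ _ (r1 z)).
by rewrite (inv rho' r2' _ _ (r1 z)).
Qed.

Definition cycle_rep s z : T := odflt z [pick y in porbit s z].

Lemma cycle_rep_in s z : cycle_rep s z \in porbit s z.
Proof. by rewrite /cycle_rep; case: pickP => //= _; rewrite porbit_id. Qed.

Lemma cycle_rep_step s z : cycle_rep s (s z) = cycle_rep s z.
Proof.
rewrite /cycle_rep porbit_step; case: pickP => //= /(_ z).
by rewrite porbit_id.
Qed.

Definition cycles_in s S i := [set O in porbits s | (O \subset S) && (#|O| == i)].

Lemma porbit_closed s S : (forall x, x \in S -> s x \in S) ->
  forall x, x \in S -> porbit s x \subset S.
Proof.
move=> sS x xS; apply/fintype.subsetP => y /porbitP[i ->].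
elim: i => [|i IH]; first by rewrite expg0 perm1.
by rewrite expgSr permM sS.
Qed.

Lemma card_cycle_points s S i : (forall x, x \in S -> s x \in S) ->
  #|[set y in S | #|porbit s y| == i]| = (#|cycles_in s S i| * i)%N.
Proof.
move=> sS; apply: card_uniform_partition => [O|]; first by rewrite !inE => /and3P[_ _ /eqP].
apply/and3P; split.
- apply/eqP/setP => y; apply/bigcupP/idP.
    case=> O; rewrite !inE => /and3P[/imsetP[x _ ->] xS xi] yx.
    have /eqP E : porbit s y == porbit s x by rewrite eq_porbit_mem.
    by rewrite E xi andbT (fintype.subsetP xS).
  rewrite inE => /andP[yS yi]; exists (porbit s y); last exact: porbit_id.
  by rewrite !inE imset_f // porbit_closed.
- apply/finset.trivIsetP => O O'; rewrite !inE => /and3P[/imsetP[x _ ->] _ _].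
  case/and3P => /imsetP[x' _ ->] _ _; apply: contraR => /pred0Pn[y /andP[/= yx yx']].
  by move: yx yx'; rewrite -!eq_porbit_mem => /eqP <- /eqP <-.
- rewrite !inE negb_and; apply/orP; left; apply/imsetP => -[x _ E].
  by have := porbit_id s x; rewrite -E inE.
Qed.

Definition centr s S := ('C[s] :&: Sym S)%G.

Lemma centrP s S p : reflect ((forall z, p (s z) = s (p z)) /\ (forall z, z \notin S -> p z = z))
  (p \in centr s S).
Proof.
have memC : (p \in centr s S) = (p \in 'C[s]%g) && perm_on S p by rewrite !inE.
rewrite memC; apply: (iffP andP).
  case=> /cent1P c1 c2; split=> z; first by rewrite -!permM c1.
  by move=> zS; apply: out_perm c2 zS.
case=> c1 c2; split.
  by apply/cent1P/permP => z; rewrite !permM c1.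
by apply/fintype.subsetP => z; rewrite inE => pz; apply/negPn/negP => /c2 /eqP; rewrite (negPf pz).
Qed.

(** Two points on cycles of the same length are related by a permutation that commutes with [s]:
    a power of [s] if the cycles are the same, and otherwise an exchange of the two cycles. *)
Lemma centr_orbit s S x : (forall z, z \in S -> s z \in S) -> x \in S ->
  orbit 'P (centr s S) x = [set y in S | #|porbit s y| == #|porbit s x|].
Proof.
move=> sS xS; apply/setP => y; rewrite inE; apply/orbitP/andP => [[p]|[yS /eqP yx]].
  move=> /centrP[c1 c2] <-; rewrite /= apermE; split.
    apply/negPn/negP => pS; have /perm_inj px := c2 _ pS.
    by rewrite px xS in pS.
  have ci i z : p ((s ^+ i)%g z) = (s ^+ i)%g (p z).
    by elim: i z => [|i IH] z; rewrite ?expg0 ?perm1 // !expgS !permM IH c1.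
  have -> : porbit s (p x) = p @: porbit s x.
    apply/setP => z; apply/porbitP/imsetP => [[i ->]|[_ /porbitP[i ->] ->]].
      by exists ((s ^+ i)%g x); rewrite ?mem_porbit ?ci.
    by exists i; rewrite ci.
  by rewrite card_imset //; apply: perm_inj.
have memO a z : (s z \in porbit s a) = (z \in porbit s a).
  by rewrite -!eq_porbit_mem porbit_step.
have symO a z : z \in porbit s a -> porbit s z = porbit s a.
  by rewrite -eq_porbit_mem => /eqP.
have rI z : porbit s (cycle_rep s z) = porbit s z by apply/symO/cycle_rep_in.
have main (rho rho' : T -> T) : 
  (forall z, rho z \in porbit s z) -> (forall z, rho (s z) = rho z) ->
  (forall z, rho' (s z) = rho' z) ->
  (forall z, #|porbit s (rho' z)| = #|porbit s z|) ->
  (forall z z', porbit s (rho' z) = porbit s (rho' z') -> porbit s z = porbit s z') ->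
  (forall z, z \notin S -> rho' z = rho z) -> rho x = x -> rho' x = y ->
  exists2 p, p \in centr s S & p x = y.
  move=> r1 r2 r3 r4 r5 r6 rx r'x; have [p [p1 p2]] := conj_perm_exists r1 r2 r3 r4 r5.
  exists p; last by rewrite -{1}rx p2.
  apply/centrP; split=> // z zS.
  have /porbitP[i ->] : z \in porbit s (rho z) by rewrite porbit_sym.
  have -> : p ((s ^+ i)%g (rho z)) = (s ^+ i)%g (p (rho z)).
    by elim: i (rho z) => [|i IH] w; rewrite ?expg0 ?perm1 // !expgS !permM IH p1.
  by rewrite p2 r6.
have [xy|xy] := boolP (y \in porbit s x).
  apply: (main (fun z => if z \in porbit s x then x else cycle_rep s z)
               (fun z => if z \in porbit s x then y else cycle_rep s z)) => [z|z|z|z|z z'|z zS||].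
  - by case: ifP => [|_]; [rewrite porbit_sym | apply: cycle_rep_in].
  - by rewrite memO cycle_rep_step.
  - by rewrite memO cycle_rep_step.
  - by case: ifP => [/symO->|_]; rewrite ?rI ?(symO _ _ xy).
  - by case: ifP => [/symO->|_]; case: ifP => [/symO->|_]; rewrite ?rI ?(symO _ _ xy).
  - case: ifP => // zx; have := porbit_closed sS xS.
    by move/fintype.subsetP/(_ _ zx); rewrite (negPf zS).
  - by rewrite porbit_id.
  - by rewrite porbit_id.
have yx' : x \notin porbit s y by rewrite porbit_sym.
pose pick2 u v z := if z \in porbit s x then u else
  if z \in porbit s y then v else cycle_rep s z.
apply: (main (pick2 x y) (pick2 y x)) => [z|z|z|z|z z'|z zS||]; rewrite /pick2.
- by do 2 (case: ifP => [|_]; first by rewrite porbit_sym); apply: cycle_rep_in.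
- by rewrite !memO cycle_rep_step.
- by rewrite !memO cycle_rep_step.
- by case: ifP => [/symO->|_] //; case: ifP => [/symO->|_]; rewrite ?rI.
- case: ifP => [/symO->|zx]; last case: ifP => [/symO->|zy];
  (case: ifP => [/symO->|zx']; last case: ifP => [/symO->|zy']) => //; rewrite ?rI // => E.
  + by move/eqP: E; rewrite eq_porbit_mem porbit_sym zy'.
  + by move/eqP: E; rewrite eq_porbit_mem porbit_sym zx'.
  + by move/eqP: E; rewrite eq_porbit_mem zy.
  + by move/eqP: E; rewrite eq_porbit_mem zx.
- case: ifP => [zx|_]; first by have /fintype.subsetP/(_ _ zx) := porbit_closed sS xS;
  rewrite (negPf zS).
  by case: ifP => [zx|_] //; have /fintype.subsetP/(_ _ zx) := porbit_closed sS yS;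
    rewrite (negPf zS).
- by rewrite porbit_id.
- by rewrite porbit_id.
Qed.

(** A permutation that commutes with [s] and fixes [x] fixes the whole cycle of [x]. *)
Lemma centr_stab s S x : (forall z, z \in S -> s z \in S) -> x \in S ->
  'C_(centr s S)[x | 'P]%g = centr s (S :\: porbit s x).
Proof.
move=> sS xS; apply/setP => p; rewrite finset.in_setI.
apply/andP/centrP => [[/centrP[c1 c2] /astab1P /= px]|[c1 c2]].
  split=> // z; rewrite inE negb_and negbK => /orP[/porbitP[i ->]|/c2 //].
  elim: i => [|i IH]; first by rewrite expg0 perm1.
  by rewrite expgSr permM c1 IH.
split; last by apply/astab1P; rewrite /= apermE c2 // inE porbit_id.
by apply/centrP; split=> // z zS; rewrite c2 // inE (negPf zS) andbF.
Qed.

(** By induction on [S]: the orbit of a point of [S] on a cycle of length [i] consists of the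
    [i * m] points of [S] on such cycles, where [m] is their number, and its stabiliser
    is the same group for [S] without this cycle. *)
Lemma card_centr s N S : #|T| <= N -> (forall z, z \in S -> s z \in S) ->
  #|centr s S| = (\prod_(1 <= i < N.+1) (i ^ #|cycles_in s S i| * (#|cycles_in s S i|)`!))%N.
Proof.
move=> TN; move: {2}#|S| (leqnn #|S|) => m; elim: m S => [|m IH] S.
  rewrite leqn0 cards_eq0 => /eqP -> _.
  rewrite big1_seq => [|i /andP[_]]; last first.
    rewrite mem_index_iota => /andP[i0 _].
    suff -> : cycles_in s finset.set0 i = finset.set0 by rewrite cards0.
    apply/setP => O; rewrite !inE subset0; apply/and3P => -[_ /eqP -> ].
    by rewrite cards0 eq_sym -leqn0 leqNgt i0.
  apply/eqP/cards1P; exists 1%g; apply/setP => p; rewrite inE.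
  apply/centrP/eqP => [[_ h]|->]; last by split=> z; rewrite !perm1.
  by apply/permP => z; rewrite perm1 h ?inE.
move=> cS sS; have [S0|[x xS]] := set_0Vmem S.
  by apply: IH => //; rewrite S0 cards0.
pose O := porbit s x; pose n := #|O|.
have OS : O \subset S by apply: porbit_closed.
have n0 : 0 < n by rewrite lt0n card_porbit_neq0.
have nN : n <= N by apply: leq_trans TN; apply: max_card.
have sD z : z \in S :\: O -> s z \in S :\: O.
  rewrite !inE => /andP[zO zS]; rewrite sS // andbT.
  by move: zO; rewrite /O -!eq_porbit_mem porbit_step.
have cD : #|S :\: O| <= m.
  by have := cardsD S O; move: (finset.setIidPr OS) => -> ->; rewrite -/n; lia.
rewrite -(card_orbit_stab 'P (centr s S) x) centr_stab // centr_orbit //.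
rewrite (IH _ cD sD) card_cycle_points //.
have cyc i : cycles_in s (S :\: O) i =
    if i == n then cycles_in s S i :\ O else cycles_in s S i.
  apply/setP => P; have E : P \in porbits s -> (P \subset S :\: O) = (P != O) && (P \subset S).
    case/imsetP => y _ ->; rewrite finset.subsetD andbC; congr (_ && _).
    apply/idP/idP.
      apply: contraL => /eqP ->; apply/negP => /pred0P/(_ x).
      by rewrite /= porbit_id.
    apply: contraR => /pred0Pn[z /andP[/= zy zx]].
    by move: zy zx; rewrite /O -!eq_porbit_mem => /eqP <- /eqP <-.
  have [->|ni] := eqVneq; rewrite !inE; case Pp: (P \in porbits s); rewrite ?andbF //= E //.
    by rewrite andbA.
  case: (P =P O) => [PO|_] /=; last by [].
  by rewrite PO -/n (eq_sym n) (negPf ni) andbF.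
have OC : O \in cycles_in s S n by rewrite !inE imset_f // OS eqxx.
have nin : n \in index_iota 1 N.+1 by rewrite mem_index_iota n0 ltnS.
rewrite !(bigD1_seq n nin (iota_uniq _ _)) /= cyc eqxx.
rewrite mulnA; congr (_ * _)%N; last first.
  by apply: eq_bigr => i ni; rewrite cyc (negPf ni).
rewrite (cardsD1 O (cycles_in s S n)) OC /= add1n expnS factS -/O -/n.
by rewrite [(_.+1 * n)%N]mulnC mulnACA.
Qed.

Lemma count_cycle_type s i : count_mem i (cycle_type s) = #|cycles_in s [set: T] i|.
Proof.
rewrite /cycle_type count_sort count_map cardE -size_filter.
rewrite /enum_mem -!filter_predI; congr size; apply: eq_filter => O /=.
by rewrite !inE finset.subsetT andbC.
Qed.

(** Counting points instead of cycles characterises the cycle type by numbers that are easy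
    to transport along bijections. *)
Lemma cycle_type_points s i :
  #|[set y | #|porbit s y| == i]| = (count_mem i (cycle_type s) * i)%N.
Proof.
rewrite count_cycle_type -card_cycle_points //.
by apply: eq_card => y; rewrite !inE.
Qed.

Lemma cycle_type_gt0 s : all (leq 1) (cycle_type s).
Proof.
rewrite /cycle_type all_sort; apply/allP => _ /mapP[O + ->].
by rewrite mem_enum => /imsetP[x _ ->]; rewrite lt0n card_porbit_neq0.
Qed.

Lemma sumn_cycle_type s : sumn (cycle_type s) = #|T|.
Proof.
rewrite /cycle_type (perm_sumn (permEl (perm_sort _ _))) sumnE big_map big_enum /=.
rewrite -cardsT -[RHS]sum1_card -[LHS]big_enum.
rewrite (partition_big (porbit s) (mem (porbits s))) /=; last first.
  by move=> x _; apply: imset_f.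
rewrite big_enum /=; apply: eq_bigr => O /imsetP[x _ ->].
rewrite -sum1_card; apply: eq_bigl => y; by rewrite inE eq_porbit_mem.
Qed.

Lemma cycle_type_sorted s : sorted geq (cycle_type s).
Proof. by apply: sort_sorted => a b; apply: leq_total. Qed.

Lemma sorted_geq_eq (l l' : seq nat) : sorted geq l -> sorted geq l' ->
  all (leq 1) l -> all (leq 1) l' ->
  (forall i, (count_mem i l * i = count_mem i l' * i)%N) -> l = l'.
Proof.
move=> sl sl' al al' E; apply: (sorted_eq (leT := geq)) => //.
- by move=> a b c /= ba ac; apply: leq_trans ac ba.
- by move=> a b /=; rewrite andbC -eqn_leq => /eqP.
apply/allP => i _ /=; have [->|i0] := posnP i.
  have z m : all (leq 1) m -> count_mem 0 m = 0.
    by move=> am; apply/eqP; rewrite -leqn0 leqNgt -has_count -all_predC; apply: sub_all am => -[].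
  by rewrite !z.
by rewrite -(eqn_pmul2r i0) E.
Qed.

Lemma cycle_typeP s t :
  (forall i, #|[set y | #|porbit s y| == i]| = #|[set y | #|porbit t y| == i]|) ->
  cycle_type s = cycle_type t.
Proof.
move=> E; apply: sorted_geq_eq; rewrite ?cycle_type_sorted ?cycle_type_gt0 //.
by move=> i; rewrite -!cycle_type_points.
Qed.

Lemma porbit_conj s p x : porbit (s ^ p)%g (p x) = p @: porbit s x.
Proof.
have ci i z : ((s ^ p) ^+ i)%g (p z) = p ((s ^+ i)%g z) by rewrite -conjXg permJ.
apply/setP => z; apply/porbitP/imsetP => [[i ->]|[_ /porbitP[i ->] ->]].
  by exists ((s ^+ i)%g x); rewrite ?mem_porbit ?ci.
by exists i; rewrite ci.
Qed.

Lemma cycle_type_conj s p : cycle_type (s ^ p)%g = cycle_type s.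
Proof.
apply: cycle_typeP => i; rewrite -[in RHS](card_imset _ (@perm_inj _ p)).
apply: eq_card => y; rewrite inE -[in LHS](permKV p y) porbit_conj card_imset; last exact: perm_inj.
apply/idP/imsetP => [h|[z + ->]]; last by rewrite inE permK.
by exists ((p^-1)%g y); rewrite ?inE ?permKV.
Qed.

(** Match the cycles of the same rank in the two lists sorted by length. *)
Lemma cycle_type_conjugate s t : cycle_type s = cycle_type t -> exists p, t = (s ^ p)%g.
Proof.
move=> E; pose L r := sort (relpre (fun O : {set T} => #|O|) geq) (enum (porbits r)).
have Lct r : map (fun O : {set T} => #|O|) (L r) = cycle_type r by rewrite /L -sort_map.
have memL r O : (O \in L r) = (O \in porbits r) by rewrite mem_sort mem_enum.
have uL r : uniq (L r) by rewrite sort_uniq enum_uniq.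
have sL : size (L s) = size (L t)
  by rewrite -(size_map (fun O : {set T} => #|O|)) Lct E -Lct size_map.
pose th (z : T) := nth finset.set0 (L t) (index (porbit s z) (L s)).
have idx z : index (porbit s z) (L s) < size (L t).
  by rewrite -sL index_mem memL imset_f.
have thin z : th z \in porbits t by rewrite -memL mem_nth.
have thc z : #|th z| = #|porbit s z|.
  rewrite /th -(nth_map _ 0 (fun O : {set T} => #|O|)) // Lct -E -Lct (nth_map finset.set0) ?sL //.
  by rewrite nth_index // memL imset_f.
pose rho' z := odflt z [pick y in th z].
have rho'in z : rho' z \in th z.
  rewrite /rho'; case: pickP => // h; case/imsetP: (thin z) => x _ tx.
  by have := h x; rewrite tx porbit_id.
have thO z : porbit t (rho' z) = th z.
  case/imsetP: (thin z) (rho'in z) => x _ ->.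
  by rewrite -eq_porbit_mem => /eqP.
have [||||| p [p1 _]] := @conj_perm_exists s t (cycle_rep s) rho'.
- exact: cycle_rep_in.
- exact: cycle_rep_step.
- move=> z; have -> : rho' (s z) = odflt (s z) [pick y in th z] by rewrite /rho' /th porbit_step.
  have := rho'in z; rewrite /rho'; case: pickP => //= h zz; by have := h z; rewrite zz.
- by move=> z; rewrite thO thc.
- move=> z z'; rewrite !thO => /eqP; rewrite nth_uniq // => /eqP ii.
  rewrite -[porbit s z](nth_index finset.set0 (s := L s)) ?memL ?imset_f // ii.
  by rewrite nth_index // memL imset_f.
exists p; apply/permP => z; rewrite -{2}(permKV p z) permJ p1 permKV //.
Qed.

Lemma card_cent1 s : #|'C[s]%g| = zee (cycle_type s).
Proof.
rewrite /zee sumn_cycle_type.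
have -> : #|'C[s]%g| = #|centr s [set: T]|.
  apply: eq_card => p; rewrite in_setI; suff -> : p \in Sym [set: T] by rewrite andbT.
  by rewrite inE; apply/subsetP => z _; rewrite inE.
rewrite (card_centr (leqnn _)); last by move=> z; rewrite !inE.
by apply: eq_bigr => i _; rewrite count_cycle_type.
Qed.

Lemma card_cycle_type s :
  (#|[set t : {perm T} | cycle_type t == cycle_type s]| * zee (cycle_type s) = (#|T|)`!)%N.
Proof.
have -> : [set t : {perm T} | cycle_type t == cycle_type s] = (s ^: [set: {perm T}])%g.
  apply/setP => t; rewrite inE; apply/eqP/imsetP => [/esym/cycle_type_conjugate[p ->]|[p _ ->]].
    by exists p; rewrite ?inE.
  exact: cycle_type_conj.
have := LagrangeI [set: {perm T}]%G 'C[s]%G; rewrite -indexgI index_cent1 => L.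
rewrite -card_cent1 mulnC -(setTI 'C[s]%g) {}L -[#|T|]cardsT -card_Sym.
apply: eq_card => p.
by rewrite !inE; symmetry; apply/subsetP => z _; rewrite inE.
Qed.

End Cycles.

(** * Averages over a symmetric group as sums over partitions *)

(** Only the finitely many values of [v] contribute, the other fibers being empty. *)
Lemma fsum_fibers (R : nmodType) (T : finType) (I : choiceType) (A : set I) (v : T -> I)
    (F : I -> R) (G : T -> R) :
  (forall t, A (v t)) -> (forall i, A i -> F i = \sum_(t | v t == i) G t)%R ->
  (\sum_(i \in A) F i = \sum_t G t)%R.
Proof.
move=> Av FG; pose r := undup [seq v t | t <- enum T].
have memr t : v t \in r by rewrite mem_undup map_f ?mem_enum.
rewrite (@fsbigE _ _ _ _ A r) ?undup_uniq //; last 2 first.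
- by move=> i /=; rewrite mem_undup => /mapP[t _ ->].
- move=> i Ai ir; rewrite FG // big1 // => t /eqP vt.
  by rewrite -vt memr in ir.
rewrite big_seq_cond (eq_big (fun i => i \in r) (fun i => \sum_(t | v t == i) G t)%R); first last.
- move=> i /andP[_ Ai]; exact/FG/set_mem.
- move=> i; case ir: (i \in r) => //=.
  by move: ir; rewrite mem_undup => /mapP[t _ ->]; apply/mem_set/Av.
rewrite -big_seq (exchange_big_dep xpredT) //=; apply: eq_bigr => t _.
rewrite -big_filter; suff -> : [seq i <- r | v t == i] = [:: v t] by rewrite big_seq1.
under eq_filter do rewrite eq_sym.
by rewrite filter_pred1_uniq ?undup_uniq.
Qed.

(** The class of cycle type [l] has [n! / z_l] elements. *)
Lemma class_average (n : nat) (perm_of : seq nat -> 'S_n) (f : 'S_n -> rat) :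
  (forall l, int_partition n l -> cycle_type (perm_of l) = l) ->
  (forall s t, cycle_type s = cycle_type t -> f s = f t) ->
  (\sum_(l \in int_partition n) (zee l)%:R^-1 * f (perm_of l) = (n`!)%:R^-1 * \sum_s f s)%R.
Proof.
move=> h fc; rewrite big_distrr /=.
apply: (fsum_fibers (v := @cycle_type _)) => [s|l ln].
  by split; rewrite ?cycle_type_sorted ?cycle_type_gt0 ?sumn_cycle_type ?card_ord.
rewrite (eq_bigr (fun=> (n`!)%:R^-1 * f (perm_of l)))%R => [|s /eqP sl]; last first.
  by congr (_ * _)%R; apply: fc; rewrite sl h.
rewrite big_const iter_addr addr0 -mulrnAl; congr (_ * _)%R.
have := card_cycle_type (perm_of l); rewrite h // card_ord => /(congr1 (fun x => x%:R : rat))%R.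
rewrite natrM => E.
have n0 : ((n`!)%:R != 0 :> rat)%R by rewrite pnatr_eq0 -lt0n fact_gt0.
have z0 : ((zee l)%:R != 0 :> rat)%R by apply: contra n0 => /eqP z; rewrite -E z mulr0.
rewrite -[RHS]mulr_natl; apply: (mulIf z0); rewrite mulVf // mulrAC.
have -> : #|(fun s : 'S_n => cycle_type s == l)| = #|[set t : 'S_n | cycle_type t == l]|.
  by apply: eq_card => s; rewrite !inE.
by rewrite E mulfV.
Qed.

Lemma cycle_type_lift (n : nat) (s : 'S_n) :
  cycle_type (lift_perm ord0 ord0 s) = rcons (cycle_type s) 1.
Proof.
apply: sorted_geq_eq; rewrite ?cycle_type_sorted ?cycle_type_gt0 //.
- have al := cycle_type_gt0 s; have := cycle_type_sorted s.
  case: (cycle_type s) al => //= a l /andP[a0 al] sl.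
  rewrite rcons_path sl /=.
  by have := mem_last a l; rewrite inE => /orP[/eqP ->|/(allP al)].
- by rewrite all_rcons cycle_type_gt0.
move=> i; rewrite -cycle_type_points -cats1 count_cat mulnDl -cycle_type_points /= addn0.
set L := lift_perm _ _ _.
have O0 : porbit L ord0 = [set ord0].
  apply/setP => x; rewrite inE; apply/porbitP/eqP => [[j ->]|->]; last by exists 0;
    rewrite expg0 perm1.
  by elim: j => [|j IH]; rewrite ?expg0 ?perm1 // expgSr permM IH lift_perm_id.
have OL x : porbit L (lift ord0 x) = lift ord0 @: porbit s x.
  have ci j z : (L ^+ j)%g (lift ord0 z) = lift ord0 ((s ^+ j)%g z).
    by elim: j z => [|j IH] z; rewrite ?expg0 ?perm1 // !expgS !permM lift_perm_lift IH.
  apply/setP => z; apply/porbitP/imsetP => [[j ->]|[_ /porbitP[j ->] ->]].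
    by exists ((s ^+ j)%g x); rewrite ?mem_porbit ?ci.
  by exists j; rewrite ci.
rewrite -!sum1dep_card !big_mkcond big_ord_recl O0 cards1 /= addnC; congr (_ + _)%N.
  rewrite [RHS]big_mkcond; apply: eq_bigr => x _.
  by rewrite OL card_imset //; apply: lift_inj.
by case: eqP => [<-|].
Qed.

Lemma int_partition_rcons1 (n : nat) l : int_partition n l -> int_partition n.+1 (rcons l 1).
Proof.
case=> sl al nl; split; last by rewrite -cats1 sumn_cat nl /= addn0 addn1.
  case: l al sl {nl} => //= a l /andP[a0 al] sl; rewrite rcons_path sl /=.
  by have := mem_last a l; rewrite inE => /orP[/eqP ->|/(allP al)].
by rewrite all_rcons al.
Qed.

(** The sum over pairs of cycle types is a sum over pairs of permutations, which have a single
    possible size when [F] needs [m] labels of the second sort. *)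
Lemma ogfE (G : Type) (F : gspecies G) (g : G) (n m : nat) :
  (forall m', m' != m -> structures F 'I_n 'I_m' = set0) ->
  (ogf F g n = (n`!%:R * m`!%:R)^-1 *
     \sum_(s : 'S_n) \sum_(t : 'S_m) #|fixed_structures F g s t|%:R)%R.
Proof.
move=> F0; rewrite pair_bigA big_distrr /=.
apply: (fsum_fibers (v := fun st : 'S_n * 'S_m => (cycle_type st.1,
  cycle_type st.2))) => [st|[l r]].
  by rewrite /= sumn_cycle_type card_ord.
rewrite /= => ln; move: F0; rewrite -ln => {ln} F0.
have [rm|rm] := eqVneq (sumn r) m; last first.
  rewrite /cycle_index big1 ?mulr0; last first.
    move=> s _; apply: big1 => t _; apply/eqP; rewrite pnatr_eq0 cards_eq0.
    by rewrite /fixed_structures F0 //; apply/eqP/setP => S; rewrite !inE.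
  rewrite big1 // => -[s t] /eqP[_ /= E]; case/eqP: rm.
  by rewrite -E sumn_cycle_type card_ord.
rewrite -rm in F0 *; rewrite /cycle_index pair_big_dep big_distrr /=.
by apply: eq_bigl => -[s t]; rewrite xpair_eqE.
Qed.

(** * Coloured trees *)

Section CardRel.
Variables (X Y : finType) (P : {set X}) (Q : {set Y}) (R : X -> Y -> Prop).
Hypothesis RX : forall x, x \in P -> exists2 y, y \in Q & R x y.
Hypothesis RY : forall y, y \in Q -> exists2 x, x \in P & R x y.
Hypothesis RXu : forall x y y', x \in P -> y \in Q -> y' \in Q -> R x y -> R x y' -> y = y'.
Hypothesis RYu : forall x x' y, x \in P -> x' \in P -> y \in Q -> R x y -> R x' y -> x = x'.

Lemma card_rel : #|P| = #|Q|.
Proof.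
have inP (u : {x | x \in P}) : exists y, y \in Q /\ R (val u) y.
  by have [y yQ xy] := RX (valP u); exists y.
have [f fP] := choice inP.
have fi : injective f.
  move=> u v E; apply: val_inj; have [uQ uR] := fP u; have [vQ vR] := fP v.
  by apply: (RYu (valP u) (valP v) uQ uR); rewrite E.
have -> : Q = f @: {: {x | x \in P}}.
  apply/setP => y; apply/idP/imsetP => [yQ|[u _ ->]]; last by have [] := fP u.
  have [x xP xy] := RY yQ; exists (Sub x xP) => //.
  by have [fQ fR] := fP (Sub x xP); apply: RXu xy fR.
by rewrite card_imset // card_sig.
Qed.

End CardRel.

(** An equivariant one-to-one correspondence, given as a relation, preserves the number of fixed
    points. *)
Lemma card_rel_fix (X Y : finType) (P : {set X}) (Q : {set Y}) (R : X -> Y -> Prop)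
    (f : X -> X) (g : Y -> Y) :
  (forall x, x \in P -> exists2 y, y \in Q & R x y) ->
  (forall y, y \in Q -> exists2 x, x \in P & R x y) ->
  (forall x y y', x \in P -> y \in Q -> y' \in Q -> R x y -> R x y' -> y = y') ->
  (forall x x' y, x \in P -> x' \in P -> y \in Q -> R x y -> R x' y -> x = x') ->
  (forall x, x \in P -> f x \in P) -> (forall y, y \in Q -> g y \in Q) ->
  (forall x y, x \in P -> y \in Q -> R x y -> R (f x) (g y)) ->
  #|[set x in P | f x == x]| = #|[set y in Q | g y == y]|.
Proof.
move=> RX RY RXu RYu fP gQ Rfg; apply: (card_rel (R := R)) => [x|y|x y y'|x x' y].
- rewrite inE => /andP[xP /eqP fx]; have [y yQ xy] := RX x xP; exists y => //.
  rewrite inE yQ /=; apply/eqP; apply: (RXu x) => //; first exact: gQ.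
  by rewrite -fx; apply: Rfg.
- rewrite inE => /andP[yQ /eqP gy]; have [x xP xy] := RY y yQ; exists x => //.
  rewrite inE xP /=; apply/eqP; apply: (RYu _ _ y) => //; first exact: fP.
  by rewrite -gy; apply: Rfg.
- by rewrite !inE => /andP[xP _] /andP[yQ _] /andP[y'Q _]; apply: RXu.
- by rewrite !inE => /andP[xP _] /andP[x'P _] /andP[yQ _]; apply: RYu.
Qed.

Section Coloured.
Variables (k : nat) (A B : finType).
Implicit Types (a : A) (b : B) (i j : 'I_k.+1).

Definition inc (N : A -> {set B}) : rel (A + B) := fun u v =>
  match u, v with
  | inl a, inr b => b \in N a
  | inr b, inl a => b \in N a
  | _, _ => false
  end.

(** The white neighbours of each black vertex, and the colours of the white vertices. *)
Definition ctree : finType := ({ffun A -> {set B}} * {ffun B -> 'I_k.+1})%type.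
Implicit Types w : ctree.

Definition coloured_tree w : Prop := is_tree (inc w.1) /\
  forall a j, exists b, forall b', (b' \in w.1 a) && (w.2 b' == j) = (b' == b).

Definition coloured_trees : {set ctree} := [set w | `[< coloured_tree w >]].

Definition ctree_act w (h : {perm A} * {perm B} * 'S_k.+1) : ctree :=
  ([ffun a => h.1.2 @: w.1 ((h.1.1^-1)%g a)], [ffun b => h.2 (w.2 ((h.1.2^-1)%g b))]).

Lemma inc_sym N : symmetric (inc N).
Proof. by move=> [a|b] [a'|b']. Qed.

Lemma inc_irr N : irreflexive (inc N).
Proof. by case. Qed.

Lemma ctree_act_mem w h a b : (b \in (ctree_act w h).1 a) =
  ((h.1.2^-1)%g b \in w.1 ((h.1.1^-1)%g a)).
Proof.
rewrite ffunE; apply/imsetP/idP => [[b' b'N ->]|bN]; first by rewrite permK.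
by exists ((h.1.2^-1)%g b); rewrite ?permKV.
Qed.

Lemma ctree_act_tree w h : coloured_tree w -> coloured_tree (ctree_act w h).
Proof.
case=> T C; split.
  pose f (u : A + B) := match u with
    | inl a => inl ((h.1.1^-1)%g a) | inr b => inr ((h.1.2^-1)%g b) end : A + B.
  pose g (u : A + B) := match u with inl a => inl (h.1.1 a) | inr b => inr (h.1.2 b) end : A + B.
  apply: (is_tree_iso (f := f) _ _ T).
    by exists g => -[x|x]; rewrite /= ?permK ?permKV.
  by move=> [a|b] [a'|b'] //=; rewrite ctree_act_mem.
move=> a j; have [b bP] := C ((h.1.1^-1)%g a) ((h.2^-1)%g j).
exists (h.1.2 b) => b'; rewrite ctree_act_mem ffunE /=.
rewrite (canF_eq (permK h.2)) bP; apply/eqP/eqP => [<-|->]; by rewrite ?permK ?permKV.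
Qed.

Lemma ctree_act1 w : ctree_act w 1%g = w.
Proof.
case: w => N col; rewrite /ctree_act /=; congr pair; apply/ffunP => x; rewrite ffunE.
  rewrite /= invg1 perm1; apply/setP => b; apply/imsetP/idP => [[b' ? ->]|?];
    first by rewrite perm1.
  by exists b; rewrite ?perm1.
by rewrite /= invg1 !perm1.
Qed.

Lemma ctree_actM w h h' : ctree_act w (h * h')%g = ctree_act (ctree_act w h) h'.
Proof.
apply: injective_projections; apply/ffunP => x.
  by apply/setP => b; rewrite !ctree_act_mem /= !invMg !permM.
by rewrite !ffunE /= !invMg !permM.
Qed.

Lemma ctree_nb w : coloured_tree w ->
  exists nb : A -> 'I_k.+1 -> B,
    forall a j b', (b' \in w.1 a) && (w.2 b' == j) = (b' == nb a j).
Proof.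
case=> _ C; have [f fP] := choice (fun aj : A * 'I_k.+1 => C aj.1 aj.2).
by exists (fun a j => f (a, j)) => a j b'; apply: (fP (a, j)).
Qed.

Lemma ctree_card_nbrs w a : coloured_tree w -> #|w.1 a| = k.+1.
Proof.
case/ctree_nb => nb nbP; have nbin j : nb a j \in w.1 a /\ w.2 (nb a j) = j.
  by have := nbP a j (nb a j); rewrite eqxx => /andP[? /eqP].
have -> : w.1 a = nb a @: 'I_k.+1.
  apply/setP => b; apply/idP/imsetP => [bN|[j _ ->]]; last by have [] := nbin j.
  by exists (w.2 b) => //; apply/eqP; rewrite -nbP bN /=.
rewrite card_imset ?card_ord // => i j E.
by rewrite -(nbin i).2 E (nbin j).2.
Qed.

(** Euler's relation, with [k+1] edges at each black vertex. *)
Lemma ctree_card w : coloured_tree w -> (#|A| * k + 1 = #|B|)%N.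
Proof.
move=> wT; have [T _] := wT.
have := @tree_euler A B (inc w.1) (@inc_sym _) (fun _ _ => erefl) (fun _ _ => erefl) T.
suff -> : #|edge_set (inc w.1)| = (#|A| * k.+1)%N by rewrite mulnS; lia.
rewrite -sum1dep_card -(pair_big_dep xpredT (fun a b => b \in w.1 a) (fun _ _ => 1%N)) /=.
rewrite (eq_bigr (fun=> k.+1)) ?sum_nat_const // => a _.
by rewrite sum1_card ctree_card_nbrs.
Qed.

(** An element fixing a coloured tree is an automorphism of the underlying tree. *)
Lemma ctree_act_fixed_points w h : coloured_tree w -> ctree_act w h = w ->
  (#|[set a | h.1.1 a == a]| + #|[set b | h.1.2 b == b]| =
   #|[set ab : A * B | [&& ab.2 \in w.1 ab.1, h.1.1 ab.1 == ab.1 & h.1.2 ab.2 == ab.2]]| + 1)%N.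
Proof.
move=> [T _] hw.
pose f (u : A + B) := match u with inl a => inl (h.1.1 a) | inr b => inr (h.1.2 b) end : A + B.
have := @tree_fixed_points A B (inc w.1) (@inc_sym _) (fun _ _ => erefl) (fun _ _ => erefl) T f.
have mem a b : (h.1.2 b \in w.1 (h.1.1 a)) = (b \in w.1 a).
  by rewrite -{1}hw ctree_act_mem !permK.
have hom u v : inc w.1 u v -> inc w.1 (f u) (f v).
  by case: u v => [a|b] [a'|b'] //=; rewrite mem.
move/(_ hom (fun a => ex_intro _ _ erefl)) => E.
rewrite -[LHS]/(#|[set a | f (inl a) == inl a]| + #|[set b | f (inr b) == inr b]|)%N E.
by congr (_ + _)%N; apply: eq_card => -[a b]; rewrite !inE.
Qed.

End Coloured.

(** * Coding trees as coloured trees *)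

Section Coding.
Variables (k : nat) (A B : finType).
Hypothesis hk : 0 < k.
Implicit Types (a : A) (b : B) (i j : 'I_k.+1) (c : cyclic_orders A B) (w : ctree k A B).

Local Open Scope ring_scope.

Definition coded c w : Prop :=
  (forall a, w.1 a = [set b | c a b != b]) /\
  (forall a b, c a b != b -> w.2 (c a b) = w.2 b + Zp1).

Lemma coded_adj c w : coded c w -> adj c = inc w.1.
Proof. by case=> N _; apply/funext => -[a|b]; apply/funext => -[a'|b'] //=; rewrite N inE. Qed.

Lemma Zp1_neq0 : (Zp1 : 'I_k.+1) != 0.
Proof. by case: (k) hk. Qed.

Lemma Zp1_mulrn n : (Zp1 : 'I_k.+1) *+ n = inZp n.
Proof. by rewrite Zp_mulrn /Zp1 /=; apply: val_inj; rewrite /= modnMml mul1n. Qed.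

Lemma coded_exp c w a b n : coded c w -> b \in w.1 a ->
  ((c a ^+ n)%g b \in w.1 a) /\ w.2 ((c a ^+ n)%g b) = w.2 b + inZp n.
Proof.
case=> N col bN; elim: n => [|n [IH1 IH2]].
  by rewrite expg0 perm1 -Zp1_mulrn mulr0n addr0.
rewrite expgSr permM; have : c a ((c a ^+ n)%g b) != (c a ^+ n)%g b.
  by move: IH1; rewrite N inE.
move=> mv; split; first by rewrite N inE (inj_eq perm_inj).
by rewrite col // IH2 -!Zp1_mulrn mulrSr addrA.
Qed.

Lemma coded_at_pos c w a b i : coded c w -> b \in w.1 a ->
  (at_pos c a b i \in w.1 a) /\ w.2 (at_pos c a b i) = w.2 b + i.
Proof. by move=> cw bN; have := coded_exp i cw bN; rewrite valZpK. Qed.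

Lemma colour_inj w a b b' : coloured_tree w -> b \in w.1 a -> b' \in w.1 a ->
  w.2 b = w.2 b' -> b = b'.
Proof.
case=> _ /(_ a (w.2 b')) [b0 b0P] bN b'N E.
by have := b0P b; have := b0P b'; rewrite bN b'N E eqxx /= => /esym/eqP -> /esym/eqP ->.
Qed.

Lemma at_pos_colour c w a b b' : coded c w -> coloured_tree w -> b \in w.1 a -> b' \in w.1 a ->
  at_pos c a b (w.2 b' - w.2 b) = b'.
Proof.
move=> cw wT bN b'N; have [N col] := coded_at_pos (w.2 b' - w.2 b) cw bN.
by apply: (colour_inj wT N b'N); rewrite col addrC subrK.
Qed.

Lemma coded_coding_tree c w : coded c w -> coloured_tree w -> coding_tree k c.
Proof.
move=> cw wT; have [N col] := cw; split; last by rewrite (coded_adj cw); case: wT.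
move=> a; have [b bN] : exists b, b \in w.1 a.
  by apply/card_gt0P; rewrite (ctree_card_nbrs a wT).
have E b' : (c a b' != b') = (b' \in porbit (c a) b).
  transitivity (b' \in w.1 a); first by rewrite N inE.
  apply/idP/porbitP => [b'N|[i ->]]; last by have [] := coded_exp i cw bN.
  by exists (w.2 b' - w.2 b); rewrite -[LHS](at_pos_colour cw wT bN b'N).
exists b; split=> //; rewrite -(ctree_card_nbrs a wT); apply: eq_card => b'.
by rewrite -E N inE.
Qed.

(** The positions of the neighbours of a black vertex in its cyclic order, counted from a base
    point, serve as edge weights; the colouring is their potential. *)
Lemma coding_tree_colour c r : coding_tree k c ->
  exists w, [/\ coloured_tree w, coded c w & w.2 r = 0].
Proof.
case=> cyc T.
have /choice[base baseP] : forall a, exists b, #|porbit (c a) b| = k.+1 /\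
  forall x, (c a x != x) = (x \in porbit (c a) b) by [].
have /choice[idx idxP] : forall ab : A * B, exists i, c ab.1 ab.2 != ab.2 ->
    ab.2 = (c ab.1 ^+ i)%g (base ab.1).
  case=> a b; have [ca cb] := baseP a.
  case: (boolP (c a b != b)) => [|_]; last by exists 0.
  rewrite /= cb => /porbitP[n ->]; exists (inZp n) => _.
  by rewrite -[LHS]porbit_modn ca.
(* positions are only defined modulo [k+1], the length of the cycle *)
have idxE a b n : (c a b != b) -> b = (c a ^+ n)%g (base a) -> idx (a, b) = inZp n.
  move=> mv bn; have [ca cb] := baseP a; apply: val_inj => /=.
  apply: (@porbit_exp_inj _ (c a) (base a)); rewrite ?ca ?ltn_mod //.
  by rewrite -[in RHS]ca porbit_modn -bn -(idxP (a, b)).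
(* the weight of an edge is the position of its white end *)
pose g (u v : A + B) : 'I_k.+1 := match u, v with
  | inl a, inr b => idx (a, b) | inr b, inl a => - idx (a, b) | _, _ => 0 end.
have symE : symmetric (adj c) by move=> [a|b] [a'|b'].
have eirr : irreflexive (adj c) by case.
have gN u v : adj c u v -> g v u = - g u v.
  by case: u v => [a|b] [a'|b'] //= _; rewrite opprK.
have [f fr fE] := tree_potential symE eirr T (inr r) gN.
pose w : ctree k A B := ([ffun a => [set b | c a b != b]], [ffun b => f (inr b)]).
have cw : coded c w.
  split=> [a|a b mv]; first by rewrite ffunE.
  rewrite !ffunE (fE (inl a) (inr (c a b))); last by rewrite /= (inj_eq perm_inj).
  rewrite (fE (inl a) (inr b)) //= -addrA; congr (_ + _).
  rewrite (idxE a (c a b) (idx (a, b)).+1) ?(inj_eq perm_inj) //.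
    by rewrite -Zp1_mulrn mulrSr Zp1_mulrn valZpK.
  by rewrite expgSr permM -(idxP (a, b)).
exists w; split=> //; last by rewrite ffunE.
split; first by rewrite -(coded_adj cw).
move=> a j; have [ca cb] := baseP a.
have bN : base a \in w.1 a by rewrite ffunE inE cb porbit_id.
exists (at_pos c a (base a) (j - w.2 (base a))) => b.
have [aN acol] := coded_at_pos (j - w.2 (base a)) cw bN.
apply/andP/eqP => [[bw /eqP bj]|->]; last by rewrite aN acol addrC subrK eqxx.
rewrite ffunE inE cb in bw; case/porbitP: bw => n bn.
have [_ ncol] := coded_exp n cw bN; rewrite -bn bj in ncol.
rewrite ncol [w.2 _ + _]addrC addrK /at_pos bn.
by rewrite -porbit_modn ca.
Qed.

(** The difference of two colourings is constant around each black vertex, hence on the tree. *)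
Lemma coded_unique_tree c w w' r : coloured_tree w -> coloured_tree w' ->
  coded c w -> coded c w' -> w.2 r = w'.2 r -> w = w'.
Proof.
move=> wT w'T cw cw' rr; have [N col] := cw; have [N' col'] := cw'.
have EN : w.1 = w'.1 by apply/ffunP => a; rewrite N N'.
apply: injective_projections => //; apply/ffunP => b.
have [[_ conn _] _] := wT.
pose P (u : A + B) := match u with
  | inr b => w.2 b = w'.2 b | inl a => forall b, b \in w.1 a -> w.2 b = w'.2 b end.
have : P (inr b); last by [].
apply: (@connect_ind _ (inc w.1) P (inr r)) => //.
case=> [a|b1] [a'|b2] //= H; first exact: H.
move=> b1N b2 b2N; rewrite -(at_pos_colour cw wT b1N b2N).
have [_ ->] := coded_at_pos (w.2 b2 - w.2 b1) cw b1N.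
rewrite EN in b1N; have [_ ->] := coded_at_pos (w.2 b2 - w.2 b1) cw' b1N.
by rewrite H.
Qed.

Lemma coded_unique_orders c c' w : coloured_tree w -> coded c w -> coded c' w -> c = c'.
Proof.
move=> wT [N col] [N' col']; apply/ffunP => a; apply/permP => b.
have E : (c a b != b) = (c' a b != b) by move: (N' a); rewrite N => /setP/(_ b); rewrite !inE.
have [mv|] := boolP (c a b != b); last first.
  by move=> e1; move: (e1); rewrite E => /negPn/eqP ->; apply/eqP; rewrite negbK in e1.
have mv' := mv; rewrite E in mv'.
apply: (colour_inj (a := a) wT); rewrite ?N ?inE ?(inj_eq perm_inj) //.
  by have := N' a; rewrite N => /setP/(_ (c' a b)); rewrite !inE (inj_eq perm_inj) mv'.
by rewrite col // col'.
Qed.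

(** The neighbour of colour [j] is sent to the one of colour [j + 1], which is different since
    [k] is positive. *)
Lemma coloured_tree_orders w : coloured_tree w -> exists c, coded c w.
Proof.
move=> wT; have [nb nbP] := ctree_nb wT.
have nbin a j : nb a j \in w.1 a /\ w.2 (nb a j) = j.
  by have := nbP a j (nb a j); rewrite eqxx => /andP[? /eqP].
pose f a b := if b \in w.1 a then nb a (w.2 b + Zp1) else b.
have fi a : injective (f a).
  move=> b b'; rewrite /f; case: ifP => bN; case: ifP => b'N // E.
  - apply: (colour_inj wT bN b'N); apply: (addIr Zp1).
    by rewrite -(nbin a (w.2 b + Zp1)).2 E (nbin _ _).2.
  - by rewrite -E (nbin _ _).1 in b'N.
  - by rewrite E (nbin _ _).1 in bN.
exists [ffun a => perm (@fi a)].
have mv a b : (f a b != b) = (b \in w.1 a).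
  rewrite /f; case: ifP => bN; last by rewrite eqxx.
  apply/eqP => E; have := (nbin a (w.2 b + Zp1)).2; rewrite E => /eqP.
  by rewrite eq_sym addrC -subr_eq0 addrK (negPf Zp1_neq0).
split=> [a|a b]; first by apply/setP => b; rewrite inE ffunE permE mv.
by rewrite ffunE permE mv /f => bN; rewrite bN (nbin _ _).2.
Qed.

Lemma coded_relabel c w mu nu : coded c w ->
  coded (relabel_orders mu nu c) (ctree_act w (mu, nu, 1%g)).
Proof.
case=> N col.
have E a b : relabel_orders mu nu c a b = nu (c ((mu^-1)%g a) ((nu^-1)%g b)).
  by rewrite ffunE -[in LHS](permKV nu b) permJ.
have M a b : (relabel_orders mu nu c a b != b) = (c ((mu^-1)%g a) ((nu^-1)%g b) != (nu^-1)%g b).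
  by rewrite E (canF_eq (permK nu)).
split=> [a|a b]; first by apply/setP => b; rewrite ctree_act_mem N !inE M.
by rewrite M => mv; rewrite E !ffunE /= !perm1 permK col.
Qed.

Lemma seq_cycle_enum (g : 'I_k.+1 -> B) : injective g ->
  (forall j, seq_cycle [seq g i | i : 'I_k.+1] (g j) = g (j + Zp1)) /\
  (forall b, b \notin codom g -> seq_cycle [seq g i | i : 'I_k.+1] b = b).
Proof.
move=> gi; set l := [seq g i | i : 'I_k.+1].
have ul : uniq l by rewrite map_inj_uniq ?enum_uniq.
split=> [j|b bl]; rewrite permE undup_id // next_nth; last by rewrite (negPf bl).
have jl : g j \in l by apply: codom_f.
have il : index (g j) l = j.
  by rewrite /l /image_mem index_map // index_enum_ord.
have sl : size l = k.+1 by rewrite size_codom card_ord.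
have nl i x : nth x l i = g i.
  by rewrite (nth_map ord0) ?size_enum_ord // nth_ord_enum.
rewrite jl il; have := nl; have := sl; case: l {ul jl il sl nl} => // y p [sp] nl.
have y0 : y = g 0 by rewrite -(nl ord0 y).
have [jk|jk] := ltnP j k.
  rewrite (set_nth_default (g 0)) ?sp //.
  rewrite -[nth _ p j]/(nth (g 0) (y :: p) j.+1).
  have jE : j.+1 = (j + Zp1 : 'I_k.+1) :> nat.
    by rewrite /= modnDmr addn1 modn_small.
  by rewrite jE nl.
rewrite nth_default ?sp // y0; congr g; apply: val_inj => /=.
have -> : nat_of_ord j = k by apply/eqP; rewrite eqn_leq jk -ltnS ltn_ord.
by rewrite modnDmr addn1 modnn.
Qed.

Lemma rhoE i (s : 'S_k.+1) j : rho i s j = s (i + j) - s i.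
Proof. by rewrite permE. Qed.

(** The family [rho] is compatible with moving the origin of the positions twice; this is what
    makes the recursive action depend on the colour only. *)
Lemma rho_rho i j (s : 'S_k.+1) : rho j (rho i s) = rho (i + j) s.
Proof. by apply/permP => a; rewrite !rhoE opprB [LHS]addrA subrK addrA. Qed.

Definition recolour w (s : 'S_k.+1) := ctree_act w (1%g, 1%g, s).

Lemma recolour_mem w s a : (recolour w s).1 a = w.1 a.
Proof. by apply/setP => b; rewrite ctree_act_mem /= !invg1 !perm1. Qed.

Lemma recolour_col w s b : (recolour w s).2 b = s (w.2 b).
Proof. by rewrite ffunE /= invg1 perm1. Qed.

(** The condition at [a] for [c'] to be the cyclic order of the tree recoloured by [s]. *)
Definition recoded (c' : {perm B}) w (s : 'S_k.+1) a := (forall b, (c' b != b) = (b \in w.1 a)) /\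
  forall b, b \in w.1 a -> s (w.2 (c' b)) = s (w.2 b) + Zp1.

(** Position [j] after the permutation is occupied by the neighbour whose new colour is [z + j]. *)
Lemma permute_at_recolour c w a p z (s t : 'S_k.+1) : coded c w -> coloured_tree w ->
  p \in w.1 a -> (forall j, s (w.2 p + j) = z + t j) ->
  recoded (permute_at c a p t) w s a.
Proof.
move=> cw wT pN H.
pose g j := at_pos c a p ((t^-1)%g j).
have gN j : g j \in w.1 a by have [] := coded_at_pos ((t^-1)%g j) cw pN.
have gcol j : s (w.2 (g j)) = z + j.
  by have [_ ->] := coded_at_pos ((t^-1)%g j) cw pN; rewrite H permKV.
have gi : injective g.
  by move=> i j E; apply: (addrI z); rewrite -!gcol E.
have gsurj b : b \in w.1 a -> b = g (s (w.2 b) - z).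
  move=> bN; apply: (colour_inj wT bN (gN _)); apply: (@perm_inj _ s).
  by rewrite gcol [RHS]addrC subrK.
have [sc1 sc2] := seq_cycle_enum gi.
have memg b : (b \in codom g) = (b \in w.1 a).
  by apply/codomP/idP => [[j ->]|/gsurj ->]; [apply: gN | eexists].
split=> b.
  have [bN|bN] := boolP (b \in w.1 a); last by rewrite /permute_at sc2 ?eqxx // memg.
  rewrite [b in permute_at _ _ _ _ b](gsurj _ bN) [in X in _ != X](gsurj _ bN) sc1 (inj_eq gi).
  by rewrite addrC -subr_eq0 addrK (negPf Zp1_neq0).
by move=> /gsurj ->; rewrite sc1 !gcol addrA.
Qed.

Lemma coded_recolour c' w s : (forall a, recoded (c' a) w s a) -> coded c' (recolour w s).
Proof.
move=> H; split=> [a|a b]; first by apply/setP => b; rewrite recolour_mem inE (H a).1.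
by rewrite (H a).1 => bN; rewrite !recolour_col (H a).2.
Qed.

(** In the recursion the element acting below a white vertex [p] stays [rho] of the colour of
    [p]. *)
Lemma local_permE c w v s0 p0 a t s : coded c w -> local_perm c v s0 p0 a t ->
  s0 = rho (w.2 p0) s -> exists2 p, toward c v a p & t = rho (w.2 p) s.
Proof.
move=> cw; elim=> [s1 p a' tw ->|s1 p x i a' t' tw i0 _ IH E].
  by exists p.
apply: IH; rewrite E; have pN : p \in w.1 x.
  by move: tw => /andP[+ _]; rewrite (coded_adj cw).
by have [_ ->] := coded_at_pos i cw pN; rewrite rho_rho.
Qed.

(** The recursion reaches [a] by following the simple path from [p0] to [a]; every vertex of the
    path hangs from its predecessor since [v] can be reached from [p0] without meeting the path. *)
Lemma local_perm_exists c w v (s0 : 'S_k.+1) p0 a l : coded c w -> coloured_tree w ->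
  path (adj c) (inr p0) l -> uniq (inr p0 :: l) -> last (inr p0) l = inl a ->
  (forall x, x \in l -> connect (del_vertex (adj c) x) (inr p0) v) ->
  exists t, local_perm c v s0 p0 a t.
Proof.
move=> cw wT; have symE : symmetric (adj c) by move=> [x|b] [x'|b'].
elim: {l}(size l) {-2}l (leqnn (size l)) s0 p0 => [|m IH] [|[x|//] l] //= lm s0 p0.
case/andP => xp; rewrite ltnS in lm.
have tw : (forall y, y \in inl x :: l -> connect (del_vertex (adj c) y) (inr p0) v) ->
  toward c v x p0.
  by move=> /(_ (inl x)); rewrite inE eqxx => /(_ isT) cx; apply/andP.
move: tw; case: l lm => [|[//|b] l] /= lm tw.
  move=> _ _ [xa] /tw; rewrite xa => tw'; exists s0; exact: local_perm_here.
case/andP=> xb pl; rewrite !in_cons !negb_or => /and4P[/and3P[_ pb pl'] /andP[_ xl] bl ul] la av.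
have pN : p0 \in w.1 x by rewrite cw.1 inE.
have bN : b \in w.1 x by rewrite cw.1 inE.
pose i := w.2 b - w.2 p0.
have bi : at_pos c x p0 i = b by apply: at_pos_colour cw wT pN bN.
have [|||t tP] := IH l (ltnW lm) (rho i s0) b pl.
- by rewrite /= bl ul.
- exact: la.
- move=> y yl; have := av y; rewrite !inE yl !orbT => /(_ isT); apply: connect_trans.
  have yx : inl x != y by apply: contraNneq xl => ->.
  have yb : inr b != y by apply: contraNneq bl => ->.
  have yp : inr p0 != y by apply: contraNneq pl' => ->.
  apply: (connect_trans (y := inl x)); apply: connect1;
    rewrite /del_vertex /= ?yx ?yb ?yp ?andbT //.
exists t; apply: (local_perm_below (x := x) (i := i)) => //.
- exact: tw.
- by rewrite subr_eq0; apply: contraNneq pb => /(colour_inj wT bN pN) ->.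
- by rewrite bi.
Qed.

End Coding.

(** * Fixed structures of the two species of coding trees *)

Section Actions.
Variables (k : nat) (A B : finType).
Hypothesis hk : 0 < k.
Implicit Types (a : A) (b : B) (i j : 'I_k.+1) (c : cyclic_orders A B) (w : ctree k A B).

Local Open Scope ring_scope.

Lemma rho0 (s : 'S_k.+1) : s 0 = 0 -> rho 0 s = s.
Proof. by move=> s0; apply/permP => j; rewrite rhoE add0r s0 subr0. Qed.

Lemma adj_sym c : symmetric (adj c).
Proof. by move=> [x|b] [x'|b']. Qed.

Lemma adj_irr c : irreflexive (adj c).
Proof. by case. Qed.

Lemma toward_nbr c w v a p : coded c w -> toward c v a p -> p \in w.1 a.
Proof. by move=> cw /andP[+ _]; rewrite (coded_adj cw). Qed.

Lemma toward_uniq c w v a p p' : coded c w -> coloured_tree w ->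
  toward c v a p -> toward c v a p' -> p = p'.
Proof.
move=> cw [T _] /andP[e1 c1] /andP[e2 c2]; rewrite -(coded_adj cw) in T.
have := step_uniq (@adj_sym c) (@adj_irr c) T e1 e2 c1 c2.
by case.
Qed.

(** At a black vertex hanging from [p], the positions are permuted by [rho] of the colour of [p],
    which is the recolouring of its neighbours. *)
Lemma coded_ctY_act c w r (s : 'S_k) : coded c w -> coloured_tree w -> w.2 r = 0 ->
  coded (ctY_act s (c, r)).1 (recolour w (lift_perm ord0 ord0 s)).
Proof.
move=> cw wT r0; set s1 := lift_perm _ _ _.
have s10 : s1 0 = 0 by rewrite /s1 lift_perm_id.
apply: coded_recolour => a; rewrite /ctY_act /= ffunE.
case: pickP => [[p t] /= /andP[tp /asboolP lp]|none].
  have [|p' tp' tE] := local_permE cw lp (s := s1); first by rewrite r0 rho0.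
  rewrite (toward_uniq cw wT tp tp') tE.
  apply: (permute_at_recolour (z := s1 (w.2 p')) hk cw wT); first exact: toward_nbr tp'.
  by move=> j; rewrite rhoE [RHS]addrC subrK.
have [T _] := wT; rewrite -(coded_adj cw) in T; case: T => _ conn _.
have /connectP[p0 /shortenP[l pl ul _] ll {p0}] := conn (inr r) (inl a).
have [x _|t lt] := local_perm_exists (v := inr r) s1 cw wT pl ul (esym ll).
  exact: connect0.
have [|p tp _] := local_permE cw lt (s := s1); first by rewrite r0 rho0.
by have /negP[] := none (p, t); rewrite /= tp; apply/asboolP.
Qed.

(** As for white roots, except at the root black vertex, where the colours are the positions. *)
Lemma coded_ctXY_act c w x r (s : 'S_k.+1) : coded c w -> coloured_tree w ->
  r \in w.1 x -> w.2 r = 0 ->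
  let cxr := ctXY_act s (c, (x, r)) in
  [/\ coded cxr.1 (recolour w s), cxr.2.1 = x,
    cxr.2.2 \in w.1 x & (recolour w s).2 cxr.2.2 = 0].
Proof.
move=> cw wT rN r0 /=.
have [pN pcol] := coded_at_pos ((s^-1)%g ord0) cw rN.
split=> //; last by rewrite recolour_col pcol r0 add0r permKV.
apply: coded_recolour => a; rewrite ffunE.
have [->|ax] := eqVneq.
  by apply: (permute_at_recolour (z := 0) hk cw wT rN) => j; rewrite r0 !add0r.
have rhoc i : rho i s = rho (w.2 (at_pos c x r i)) s.
  by have [_ ->] := coded_at_pos i cw rN; rewrite r0 add0r.
case: pickP => [[p t] /= /andP[tp /asboolP[i lp]]|none].
  have [|p' tp' tE] := local_permE cw lp (s := s); first exact: rhoc.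
  rewrite (toward_uniq cw wT tp tp') tE.
  apply: (permute_at_recolour (z := s (w.2 p')) hk cw wT); first exact: toward_nbr tp'.
  by move=> j; rewrite rhoE [RHS]addrC subrK.
have [T _] := wT; rewrite -(coded_adj cw) in T; case: T => _ conn _.
have /connectP[p0 /shortenP[l pl ul _] ll {p0}] := conn (inl x) (inl a).
case: l pl ul ll => [_ _ [ax']|[//|b] l]; first by rewrite ax' eqxx in ax.
move=> /= /andP[xb pl] /andP[xl ul] ll.
have bN : b \in w.1 x by rewrite cw.1 inE.
have bE := at_pos_colour cw wT rN bN.
have [y yl|t lt] := local_perm_exists (v := inl x) (rho (w.2 b - w.2 r) s) cw wT pl ul (esym ll).
  apply: connect1; rewrite /del_vertex /= xb /=.
  move: ul xl => /= /andP[bl _]; rewrite inE /= => xl.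
  by apply/andP; split; [apply: contraNneq bl => -> | apply: contraNneq xl => ->].
have [|p tp _] := local_permE cw lt (s := s); first by rewrite -[in RHS]bE -rhoc.
have /negP[] := none (p, t); rewrite /= tp; apply/asboolP.
by exists (w.2 b - w.2 r); rewrite bE.
Qed.

Lemma ctree_act_recolour w mu nu (s : 'S_k.+1) :
  recolour (ctree_act w (mu, nu, 1%g)) s = ctree_act w (mu, nu, s).
Proof. by rewrite /recolour -ctree_actM; congr ctree_act; congr (_, _, _);
  rewrite ?mulg1 ?mul1g. Qed.

Definition fixedY (h : {perm A} * {perm B} * 'S_k.+1) : {set ctree k A B * B} :=
  [set wr | [&& wr.1 \in coloured_trees k A B, wr.1.2 wr.2 == 0,
     ctree_act wr.1 h == wr.1 & h.1.2 wr.2 == wr.2]].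

(** The root edge is not recorded: it goes from the black root to its neighbour of colour 0. *)
Definition fixedX (h : {perm A} * {perm B} * 'S_k.+1) : {set ctree k A B * A} :=
  [set wx | [&& wx.1 \in coloured_trees k A B,
     ctree_act wx.1 h == wx.1 & h.1.1 wx.2 == wx.2]].

Lemma card_fixedY (mu : {perm A}) (nu : {perm B}) (s : 'S_k) :
  #|[set S in ctY_set k A B | ctY_act s (ctY_relabel mu nu S) == S]| =
  #|fixedY (mu, nu, lift_perm ord0 ord0 s)|.
Proof.
set h := (mu, nu, _).
pose Q := [set wr : ctree k A B * B | (wr.1 \in coloured_trees k A B) && (wr.1.2 wr.2 == 0)].
pose R (cr : cyclic_orders A B * B) (wr : ctree k A B * B) := cr.2 = wr.2 /\ coded cr.1 wr.1.
have -> : fixedY h = [set wr in Q | (ctree_act wr.1 h, h.1.2 wr.2) == wr].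
  by apply/setP => -[w r]; rewrite !inE xpair_eqE -!andbA.
have QE w r : (w, r) \in Q -> coloured_tree w /\ w.2 r = 0.
  by rewrite !inE => /andP[/asboolP wT /eqP].
have inQ w r : coloured_tree w -> w.2 r = 0 -> (w, r) \in Q.
  by move=> wT r0; rewrite !inE r0 eqxx andbT; apply/asboolP.
have act c r w : coloured_tree w -> w.2 r = 0 -> coded c w ->
    coded (ctY_act s (ctY_relabel mu nu (c, r))).1 (ctree_act w h).
  move=> wT r0 cw; rewrite -ctree_act_recolour; apply: coded_ctY_act.
  - exact: coded_relabel.
  - exact: ctree_act_tree.
  - by rewrite ffunE /= permK perm1.
have h0 w r : w.2 r = 0 -> (ctree_act w h).2 (nu r) = 0.
  by move=> r0; rewrite ffunE /= permK r0 lift_perm_id.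
apply: (card_rel_fix (R := R)).
- move=> [c r]; rewrite inE => /asboolP /= cT.
  have [w [wT cw r0]] := coding_tree_colour r cT.
  by exists (w, r); rewrite ?inQ.
- move=> [w r] /QE[wT r0]; have [c cw] := coloured_tree_orders hk wT.
  exists (c, r) => //; rewrite inE; apply/asboolP; exact: coded_coding_tree cw wT.
- move=> [c r] [w r1] [w' r2] _ /QE[wT r0] /QE[w'T r0'] [/= E1 cw] [/= E2 cw'].
  subst r1 r2; congr pair; apply: (coded_unique_tree (r := r) wT w'T cw cw').
  by rewrite r0 r0'.
- move=> [c r] [c' r'] [w r1] _ _ /QE[wT r0] [/= E1 cw] [/= E2 cw'].
  subst r r'; congr pair; exact: coded_unique_orders wT cw cw'.
- move=> [c r]; rewrite !inE => /asboolP /= cT; apply/asboolP.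
  have [w [wT cw r0]] := coding_tree_colour r cT.
  by apply: coded_coding_tree (act _ _ _ wT r0 cw) _; apply: ctree_act_tree.
- by move=> [w r] /QE[wT r0]; apply: inQ; [apply: ctree_act_tree | apply: h0].
- move=> [c r] [w r1] _ /QE[wT r0] [/= E1 cw]; subst r1; split=> //.
  exact: act.
Qed.

Lemma card_fixedX (mu : {perm A}) (nu : {perm B}) (s : 'S_k.+1) :
  #|[set S in ctXY_set k A B | ctXY_act s (ctXY_relabel mu nu S) == S]| =
  #|fixedX (mu, nu, s)|.
Proof.
set h := (mu, nu, _).
pose Q := [set wx : ctree k A B * A | wx.1 \in coloured_trees k A B].
pose R (cr : cyclic_orders A B * (A * B)) (wx : ctree k A B * A) :=
  [/\ cr.2.1 = wx.2, coded cr.1 wx.1, cr.2.2 \in wx.1.1 wx.2 & wx.1.2 cr.2.2 = 0].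
have -> : fixedX h = [set wr in Q | (ctree_act wr.1 h, h.1.1 wr.2) == wr].
  by apply/setP => -[w r]; rewrite !inE xpair_eqE.
have QE w x : (w, x) \in Q -> coloured_tree w by rewrite !inE => /asboolP wT.
have inQ w x : coloured_tree w -> (w, x) \in Q.
  by move=> wT; rewrite !inE; apply/asboolP.
have act c x r w : coloured_tree w -> r \in w.1 x -> w.2 r = 0 -> coded c w ->
    R (ctXY_act s (ctXY_relabel mu nu (c, (x, r)))) (ctree_act w h, mu x).
  move=> wT rN r0 cw.
  have [|||| c1 c2 c3 c4] := @coded_ctXY_act (relabel_orders mu nu c) (ctree_act w (mu, nu, 1%g))
    (mu x) (nu r) s.
  - exact: coded_relabel.
  - exact: ctree_act_tree.
  - by rewrite ctree_act_mem !permK.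
  - by rewrite ffunE /= permK perm1.
  by rewrite ctree_act_recolour in c1 c4; split.
have PE c x r : (c, (x, r)) \in ctXY_set k A B -> exists w, coloured_tree w /\ R (c, (x, r)) (w, x).
  rewrite inE /= => /andP[/asboolP cT xr]; have [w [wT cw r0]] := coding_tree_colour r cT.
  by exists w; split=> //; split=> //=; rewrite cw.1 inE.
have inP c x r w : coloured_tree w -> R (c, (x, r)) (w, x) -> (c, (x, r)) \in ctXY_set k A B.
  move=> wT [/= _ cw rN _]; rewrite inE /=; apply/andP; split.
    by apply/asboolP; apply: coded_coding_tree cw wT.
  by move: rN; rewrite cw.1 inE.
apply: (card_rel_fix (R := R)).
- by move=> [c [x r]] /PE[w [wT wR]]; exists (w, x); rewrite ?inQ.
- move=> [w x] /QE wT; have [c cw] := coloured_tree_orders hk wT.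
  have [_ /(_ x 0)[r rP]] := wT; have := rP r; rewrite eqxx => /andP[rN /eqP r0].
  have rR : R (c, (x, r)) (w, x) by split.
  by exists (c, (x, r)) => //; apply: inP rR.
- move=> [c [x r]] [w x1] [w' x2] _ /QE wT /QE w'T [/= E1 cw rN r0] [/= E2 cw' _ r0'].
  subst x1 x2; congr pair; apply: (coded_unique_tree (r := r) wT w'T cw cw').
  by rewrite r0 r0'.
- move=> [c [x r]] [c' [x' r']] [w x1] _ _ /QE wT [/= E1 cw rN r0] [/= E2 cw' rN' r0'].
  subst x x'; rewrite (coded_unique_orders wT cw cw').
  by rewrite (colour_inj wT rN rN') // r0 r0'.
- move=> [c [x r]] /PE[w [wT [_ cw rN r0]]].
  move: (act _ _ _ _ wT rN r0 cw); move: (ctXY_act _ _) => [c' [x' r']] H.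
  have [/= E _ _ _] := H; subst x'; apply: inP H.
  exact: ctree_act_tree.
- by move=> [w x] /QE wT; apply/inQ/ctree_act_tree.
- move=> [c [x r]] [w x1] _ /QE wT [/= E1 cw rN r0]; subst x1; exact: act.
Qed.

End Actions.

(** * Orbits of coloured trees *)

(** The permutations of the positions [1, ..., k] are the permutations of the colours fixing 0. *)
Lemma lift_perm_image k : [set lift_perm ord0 ord0 s | s in [set: 'S_k]] =
  [set s : 'S_k.+1 | s ord0 == ord0].
Proof.
have linj : injective (@lift_perm k ord0 ord0).
  move=> s t /permP E; apply/permP => x; apply: (@lift_inj _ (ord0 : 'I_k.+1)).
  by rewrite -!(lift_perm_lift (ord0 : 'I_k.+1)) E.
apply/eqP; rewrite eqEcard; apply/andP; split.
  by apply/subsetP => _ /imsetP[s _ ->]; rewrite inE lift_perm_id.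
rewrite card_imset // cardsT card_Sn.
have -> : [set s : 'S_k.+1 | s ord0 == ord0] = Sym (~: [set ord0]).
  apply/setP => s; rewrite !inE; apply/eqP/subsetP => [s0 x|H].
    by rewrite !inE; apply: contraNneq => ->; rewrite s0.
  by apply/eqP/negPn/negP => s0; have := H ord0; rewrite !inE => /(_ s0).
by rewrite card_Sym cardsC1 card_ord.
Qed.

Lemma sum_lift_perm k (F : 'S_k.+1 -> nat) :
  \sum_(s : 'S_k.+1 | s ord0 == ord0) F s = \sum_(s : 'S_k) F (lift_perm ord0 ord0 s).
Proof.
rewrite (eq_bigl (fun s => s \in [set s : 'S_k.+1 | s ord0 == ord0])); last by move=> s;
  rewrite inE.
rewrite -lift_perm_image big_imset /=; last first.
  move=> s t _ _ /permP E; apply/permP => x; apply: (@lift_inj _ (ord0 : 'I_k.+1)).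
  by rewrite -!(lift_perm_lift (ord0 : 'I_k.+1)) E.
by apply: eq_bigl => s; rewrite inE.
Qed.

Section Burnside.
Variables (k : nat) (A B : finType).
Implicit Types (w : ctree k A B).
Local Notation group := ({perm A} * {perm B} * 'S_k.+1)%type.
Local Notation OM := (coloured_trees k A B).

Lemma coloured_treesP w : reflect (coloured_tree w) (w \in OM).
Proof. by rewrite inE; apply: asboolP. Qed.

Canonical ctree_action := TotalAction (@ctree_act1 k A B) (@ctree_actM k A B).

Lemma ctree_act_inj (g : group) : injective (@ctree_act k A B ^~ g).
Proof.
by move=> w w' /(congr1 (fun x => ctree_act x g^-1%g)); rewrite -!ctree_actM mulgV !ctree_act1.
Qed.

Lemma ctree_act_conj w (h g : group) :
  ctree_act (ctree_act w g) (h ^ g)%g = ctree_act (ctree_act w h) g.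
Proof. by rewrite -!ctree_actM -conjgC. Qed.

Lemma mem_ctree_act w (g : group) : (ctree_act w g \in OM) = (w \in OM).
Proof.
apply/coloured_treesP/coloured_treesP => [H|]; last exact: ctree_act_tree.
by have := ctree_act_tree g^-1%g H; rewrite -ctree_actM mulgV ctree_act1.
Qed.

Definition recolouring (q : 'S_k.+1) : group := (1%g, 1%g, q).

Lemma conj_recolouring mu nu (s q : 'S_k.+1) :
  ((mu, nu, s) ^ recolouring q)%g = (mu, nu, (s ^ q)%g) :> group.
Proof. by rewrite /conjg; congr (_, _, _); rewrite /= ?invg1 ?mulg1 ?mul1g. Qed.

(** Recolouring by [q] conjugates the action by [q]. *)
Lemma card_fixedX_conj mu nu (s q : 'S_k.+1) :
  #|@fixedX k A B (mu, nu, (s ^ q)%g)| = #|@fixedX k A B (mu, nu, s)|.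
Proof.
pose f (wx : ctree k A B * A) := (ctree_act wx.1 (recolouring q), wx.2).
have fi : injective f.
  move=> u v E; apply: injective_projections; last exact: (congr1 snd E).
  exact: (@ctree_act_inj (recolouring q) _ _ (congr1 fst E)).
rewrite -[RHS](card_imset _ fi); apply: eq_card => -[w x].
have [w' ->] : exists w', w = ctree_act w' (recolouring q).
  by exists (ctree_act w (recolouring q)^-1%g); rewrite -ctree_actM mulVg ctree_act1.
transitivity ((w', x) \in fixedX (mu, nu, s)); last first.
  by symmetry; exact: (mem_imset (mem (fixedX (mu, nu, s))) (w', x) fi).
rewrite !inE /=.
have := mem_ctree_act w' (recolouring q); rewrite !inE => ->.
rewrite -conj_recolouring ctree_act_conj (inj_eq (@ctree_act_inj _)).
by [].
Qed.

(** The root colour 0 is kept, for [q] fixes it. *)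
Lemma card_fixedY_conj mu nu (s q : 'S_k.+1) : q ord0 = ord0 ->
  #|@fixedY k A B (mu, nu, (s ^ q)%g)| = #|@fixedY k A B (mu, nu, s)|.
Proof.
move=> q0; pose f (wx : ctree k A B * B) := (ctree_act wx.1 (recolouring q), wx.2).
have fi : injective f.
  move=> u v E; apply: injective_projections; last exact: (congr1 snd E).
  exact: (@ctree_act_inj (recolouring q) _ _ (congr1 fst E)).
rewrite -[RHS](card_imset _ fi); apply: eq_card => -[w x].
have [w' ->] : exists w', w = ctree_act w' (recolouring q).
  by exists (ctree_act w (recolouring q)^-1%g); rewrite -ctree_actM mulVg ctree_act1.
transitivity ((w', x) \in fixedY (mu, nu, s)); last first.
  by symmetry; exact: (mem_imset (mem (fixedY (mu, nu, s))) (w', x) fi).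
rewrite !inE /=.
have := mem_ctree_act w' (recolouring q); rewrite !inE => ->.
rewrite -conj_recolouring ctree_act_conj (inj_eq (@ctree_act_inj _)).
suff -> : ((ctree_act w' (recolouring q)).2 x == ord0) = (w'.2 x == ord0) by [].
by rewrite ffunE /= invg1 perm1 -[X in _ == X]q0 (inj_eq perm_inj).
Qed.

(** A root fixed by [nu] has a colour fixed by [s].  Sorting by the colour of the root gives
    [k+1] sums, all equal to the one for colour 0 by conjugation with transpositions. *)
Lemma sum_over_root_colour (u : {ffun A -> {set B}} -> B -> nat) mu nu :
  (\sum_(s : 'S_k.+1) \sum_(w in OM | ctree_act w (mu, nu, s) == w)
     \sum_(r | nu r == r) u w.1 r =
  k.+1 * \sum_(s : 'S_k) \sum_(w in OM | ctree_act w (mu, nu, lift_perm ord0 ord0 s) == w)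
     \sum_(r | (nu r == r) && (w.2 r == ord0)) u w.1 r)%N.
Proof.
pose F j (sw : 'S_k.+1 * ctree k A B) :=
  \sum_(r | (nu r == r) && (sw.2.2 r == j)) u sw.2.1 r.
pose P (sw : 'S_k.+1 * ctree k A B) :=
  (sw.2 \in OM) && (ctree_act sw.2 (mu, nu, sw.1) == sw.2).
have E : \sum_(s : 'S_k.+1) \sum_(w in OM | ctree_act w (mu, nu, s) == w)
     \sum_(r | nu r == r) u w.1 r = \sum_(j : 'I_k.+1) \sum_(sw | P sw) F j sw.
  rewrite pair_big_dep [RHS]exchange_big /=; apply: eq_bigr => sw _.
  by rewrite (partition_big (fun r => sw.2.2 r) xpredT).
have shift j : \sum_(sw | P sw) F j sw = \sum_(sw | P sw) F ord0 sw.
  (* the transposition of 0 and [j] exchanges the roots of colours 0 and [j] *)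
  pose q : 'S_k.+1 := tperm ord0 j.
  pose f (sw : 'S_k.+1 * ctree k A B) := ((sw.1 ^ q)%g, ctree_act sw.2 (recolouring q)).
  have fK : involutive f.
    case=> s w; rewrite /f /=; congr (_, _); first by rewrite -conjgM tperm2 conjg1.
    rewrite -ctree_actM -[RHS]ctree_act1; congr ctree_act.
    by congr (_, _, _); rewrite /= ?mulg1 ?tperm2.
  rewrite (reindex f) /=; last by apply: onW_bij; exists f.
  apply: eq_big => [[s w]|[s w] _]; rewrite /P /F /=.
    by rewrite mem_ctree_act -conj_recolouring ctree_act_conj (inj_eq (@ctree_act_inj _)).
  apply: eq_big => r.
    rewrite [X in X == j](_ : _ = q (w.2 r)); last by rewrite ffunE /= invg1 perm1.
    by rewrite (canF_eq (permK q)) /q tpermV tpermR.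
  move=> _; congr u; apply/ffunP => a; apply/setP => b.
  by rewrite [LHS](ctree_act_mem w (recolouring q) a b) /= !invg1 !perm1.
rewrite E (eq_bigr _ (fun j _ => shift j)) sum_nat_const card_ord; congr (_ * _)%N.
rewrite -(sum_lift_perm (fun s => \sum_(w in OM | ctree_act w (mu, nu, s) == w)
   \sum_(r | (nu r == r) && (w.2 r == ord0)) u w.1 r)).
rewrite -(pair_big_dep xpredT (fun s w => P (s, w)) (fun s w => F ord0 (s, w))) /=.
rewrite (bigID (fun s : 'S_k.+1 => s ord0 == ord0)) /= [X in (_ + X)%N]big1 ?addn0 // => s s0.
apply: big1 => w /andP[_ /eqP ws]; apply: big1 => r /andP[/eqP rr /eqP r0].
case/eqP: s0; rewrite -r0 -[in RHS]ws ffunE /=.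
by rewrite -{2}rr permK.
Qed.

Lemma card_fixedX_sum (h : group) :
  #|@fixedX k A B h| = \sum_(w in OM | ctree_act w h == w) #|[set a | h.1.1 a == a]|.
Proof.
under eq_bigr do rewrite -sum1dep_card.
rewrite pair_big_dep -sum1_card /=; apply: eq_bigl => -[w a]; rewrite !inE /=.
by rewrite andbA.
Qed.

Lemma card_fixedY_sum mu nu (s : 'S_k.+1) :
  #|@fixedY k A B (mu, nu, s)| = \sum_(w in OM | ctree_act w (mu, nu, s) == w)
    \sum_(r | (nu r == r) && (w.2 r == ord0)) 1.
Proof.
rewrite pair_big_dep -sum1_card /=; apply: eq_bigl => -[w r]; rewrite !inE /=.
by rewrite -andbA; do !bool_congr; rewrite andbC.
Qed.

(** When the colour 0 is fixed, so is the neighbour of colour 0 of a fixed black vertex. *)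
Lemma card_fixedX_edges mu nu (s : 'S_k.+1) : s ord0 = ord0 ->
  #|@fixedX k A B (mu, nu, s)| = \sum_(w in OM | ctree_act w (mu, nu, s) == w)
    \sum_(r | (nu r == r) && (w.2 r == ord0)) #|[set a | (r \in w.1 a) && (mu a == a)]|.
Proof.
move=> s0; rewrite card_fixedX_sum; apply: eq_bigr => w /andP[/coloured_treesP wT /eqP ws].
under [RHS]eq_bigr do rewrite -sum1dep_card.
rewrite (exchange_big_dep (fun a => mu a == a)) /=; last by move=> r a _ /andP[].
rewrite -sum1dep_card; apply: eq_bigr => a /eqP aa.
have [_ /(_ a ord0)[r rP]] := wT.
rewrite (big_pred1 r) // => r'; rewrite aa eqxx andbT -andbA.
rewrite /= -rP [RHS]andbC; case: (w.2 r' =P ord0) => // r'0; rewrite ?andbF //=.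
case rN: (r' \in w.1 a); rewrite ?andbF // andbT.
have /eqP E1 : r' == r by rewrite -rP rN r'0 eqxx.
have /eqP E2 : nu r' == r.
  rewrite -rP -{1}ws ctree_act_mem permK -{1}aa permK rN /=.
  by rewrite -ws ffunE /= permK r'0 s0.
by rewrite [X in _ == X]E1 E2 eqxx.
Qed.

(** For each element of the group and each coloured tree that it fixes, the fixed vertices
    outnumber the fixed edges by 1; summing over the group counts the orbits. *)
Lemma burnside_dissymmetry :
  (\sum_(mu : {perm A}) \sum_(nu : {perm B})
     (\sum_(s : 'S_k.+1) #|@fixedX k A B (mu, nu, s)| +
      k.+1 * \sum_(s : 'S_k) #|@fixedY k A B (mu, nu, lift_perm ord0 ord0 s)|) =
   \sum_(mu : {perm A}) \sum_(nu : {perm B})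
      k.+1 * (\sum_(s : 'S_k) #|@fixedX k A B (mu, nu, lift_perm ord0 ord0 s)|) +
   #|[set orbit ctree_action [set: group] w | w in OM]| * ((#|A|)`! * (#|B|)`! * (k.+1)`!))%N.
Proof.
have acts : [acts [set: group], on OM | ctree_action].
  apply/actsP => g _ w; exact: mem_ctree_act.
have := Frobenius_Cauchy acts; rewrite cardsT !card_prod /= => FC.
have cS (T : finType) : #|{perm T}| = (#|T|)`!.
  by rewrite -[#|T|]cardsT -card_Sym; apply: eq_card => p; rewrite !inE; symmetry;
    apply/subsetP => z _; rewrite inE.
rewrite !cS card_ord in FC; rewrite -FC {FC}.
rewrite [in RHS](eq_bigl xpredT) => [|h]; last by rewrite in_setT.
rewrite [in RHS](eq_bigr (fun h : group => \sum_(w in OM | ctree_act w h == w) 1)); last first.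
  move=> h _; rewrite -sum1_card; apply: eq_bigl => w.
  by rewrite !inE sub1set inE.
have trip (F : group -> nat) : \sum_h F h =
    \sum_(mu : {perm A}) \sum_(nu : {perm B}) \sum_(s : 'S_k.+1) F (mu, nu, s).
  by rewrite pair_bigA pair_bigA; apply: eq_bigr => -[[]].
rewrite trip -big_split /=; apply: eq_bigr => mu _; rewrite -big_split /=; apply: eq_bigr => nu _.
under [in LHS]eq_bigr do rewrite card_fixedX_sum.
rewrite (eq_bigr _ (fun s _ => card_fixedY_sum mu nu (lift_perm ord0 ord0 s))).
rewrite (eq_bigr _ (fun s _ => card_fixedX_edges mu nu (lift_perm_id ord0 ord0 s))).
rewrite -(sum_over_root_colour (fun _ _ => 1%N)).
rewrite -(sum_over_root_colour (fun N r => #|[set a | (r \in N a) && (mu a == a)]|)).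
rewrite -!big_split /=; apply: eq_bigr => s _.
rewrite -!big_split /=; apply: eq_bigr => w /andP[/coloured_treesP wT /eqP ws].
rewrite sum1dep_card (ctree_act_fixed_points wT ws) /=; congr (_ + _)%N.
under [RHS]eq_bigr do rewrite -sum1dep_card.
rewrite (exchange_big_dep xpredT) //= pair_big_dep -sum1dep_card.
by apply: eq_bigl => -[a b] /=; case: (b \in _); case: (mu a == a); case: (nu b == b).
Qed.

End Burnside.

(** * The generating functions as a number of orbits *)

Section GeneratingFunctions.
Variable k : nat.
Hypothesis hk : 0 < k.
Variable n : nat.
Local Notation m := (n * k + 1)%N.
Local Open Scope ring_scope.

Lemma ctY_set_empty m' : m' != m -> ctY_set k 'I_n 'I_m' = finset.set0.
Proof.
move=> mm; apply/setP => -[c r]; rewrite !inE; apply/negP => /asboolP cT.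
have [w [wT _ _]] := coding_tree_colour r cT.
by have := ctree_card wT; rewrite !card_ord => E; rewrite E eqxx in mm.
Qed.

Lemma ctXY_set_empty m' : m' != m -> ctXY_set k 'I_n 'I_m' = finset.set0.
Proof.
move=> mm; apply/setP => -[c [x r]]; rewrite !inE; apply/negP => /andP[/asboolP cT _].
have [w [wT _ _]] := coding_tree_colour r cT.
by have := ctree_card wT; rewrite !card_ord => E; rewrite E eqxx in mm.
Qed.

Lemma ogf_CTY (s : 'S_k) : ogf (CTY k) s n = (n`!%:R * m`!%:R)^-1 *
  \sum_(mu : 'S_n) \sum_(nu : 'S_m) #|fixedY (mu, nu, lift_perm ord0 ord0 s)|%:R.
Proof.
rewrite (ogfE (F := CTY k) s ctY_set_empty); congr (_ * _).
apply: eq_bigr => mu _; apply: eq_bigr => nu _; congr (_%:R).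
exact: card_fixedY.
Qed.

Lemma ogf_CTXY (s : 'S_k.+1) : ogf (CTXY k) s n = (n`!%:R * m`!%:R)^-1 *
  \sum_(mu : 'S_n) \sum_(nu : 'S_m) #|fixedX (mu, nu, s)|%:R.
Proof.
rewrite (ogfE (F := CTXY k) s ctXY_set_empty); congr (_ * _).
apply: eq_bigr => mu _; apply: eq_bigr => nu _; congr (_%:R).
exact: card_fixedX.
Qed.

Lemma ogf_CTXY_class (s t : 'S_k.+1) : cycle_type s = cycle_type t ->
  ogf (CTXY k) s n = ogf (CTXY k) t n.
Proof.
move/cycle_type_conjugate => [q ->]; rewrite (ogf_CTXY s) (ogf_CTXY (s ^ q)%g).
apply: (congr1 (fun x => _ * x)).
apply: eq_bigr => mu _; apply: eq_bigr => nu _; apply: (congr1 (fun x => x%:R)).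
exact/esym/card_fixedX_conj.
Qed.

Lemma ogf_CTY_class (s t : 'S_k) : cycle_type s = cycle_type t ->
  ogf (CTY k) s n = ogf (CTY k) t n.
Proof.
move/cycle_type_conjugate => [q ->]; rewrite (ogf_CTY s) (ogf_CTY (s ^ q)%g).
apply: (congr1 (fun x => _ * x)).
apply: eq_bigr => mu _; apply: eq_bigr => nu _.
have -> : lift_perm ord0 ord0 (s ^ q)%g = ((lift_perm ord0 ord0 s) ^ (lift_perm ord0 ord0 q))%g.
  by rewrite /conjg lift_permV !lift_permM.
apply: (congr1 (fun x => x%:R)); symmetry; apply: card_fixedY_conj.
exact: lift_perm_id.
Qed.

(** All three sums over partitions are averages over symmetric groups, of orders [(k+1)!] and
    [k!]; the quotient [k+1] is the factor of the dissymmetry relation. *)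
Lemma weighted_ogf_sum (perm_of : seq nat -> 'S_k) (perm_of1 : seq nat -> 'S_k.+1) :
  (forall l, int_partition k l -> cycle_type (perm_of l) = l) ->
  (forall l, int_partition k.+1 l -> cycle_type (perm_of1 l) = l) ->
  \sum_(l \in int_partition k.+1) (zee l)%:R^-1 * ogf (CTXY k) (perm_of1 l) n
  + \sum_(l \in int_partition k) (zee l)%:R^-1 * ogf (CTY k) (perm_of l) n
  - \sum_(l \in int_partition k)
      (zee l)%:R^-1 * ogf (CTXY k) (perm_of1 (rcons l 1%N)) n =
  #|[set orbit (ctree_action k 'I_n 'I_m) [set: _] w | w in coloured_trees k 'I_n 'I_m]|%:R.
Proof.
move=> h h1.
have A1 := class_average (f := fun s => ogf (CTXY k) s n) h1 ogf_CTXY_class.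
have A2 := class_average (f := fun s => ogf (CTY k) s n) h ogf_CTY_class.
have A3 : \sum_(l \in int_partition k) (zee l)%:R^-1 * ogf (CTXY k) (perm_of1 (rcons l 1%N)) n =
  (k`!)%:R^-1 * \sum_s ogf (CTXY k) (lift_perm ord0 ord0 s) n.
  rewrite -(class_average (f := fun s => ogf (CTXY k) (lift_perm ord0 ord0 s) n) h); last first.
    by move=> s t E; apply: ogf_CTXY_class; rewrite !cycle_type_lift E.
  apply: eq_fsbigr => l /set_mem ll; apply: (congr1 (fun x => _ * x)); apply: ogf_CTXY_class.
  by rewrite h1 ?cycle_type_lift ?h //; apply: int_partition_rcons1.
apply: (etrans (congr2 (fun x y => x - y) (congr2 (fun x y => x + y) A1 A2) A3)).
rewrite (eq_bigr _ (fun s _ => ogf_CTXY s)) (eq_bigr _ (fun s _ => ogf_CTY s)).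
rewrite (eq_bigr _ (fun s _ => ogf_CTXY (lift_perm ord0 ord0 s))).
rewrite -!mulr_sumr.
have := @burnside_dissymmetry k 'I_n 'I_m; rewrite !card_ord factS.
move/(congr1 (fun x => x%:R : rat)); rewrite natrD natrM.
set orb := #|_|%:R.
have swap (C : finType) (F : {perm 'I_n} -> {perm 'I_m} -> C -> nat) :
    (\sum_mu \sum_nu \sum_s F mu nu s)%N%:R = \sum_s \sum_mu \sum_nu (F mu nu s)%:R :> rat.
  rewrite natr_sum; under eq_bigr => mu _ do rewrite natr_sum.
  under eq_bigr => mu _ do under eq_bigr => nu _ do rewrite natr_sum.
  rewrite [RHS]exchange_big; apply: eq_bigr => mu _.
  by rewrite [RHS]exchange_big.
under [in LHS]eq_bigr do rewrite big_split /=.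
rewrite big_split /= natrD swap.
under [X in (_ + X%:R)]eq_bigr do rewrite -big_distrr /=.
rewrite -big_distrr /= natrM swap.
have -> : (\sum_(mu : {perm 'I_n}) \sum_(nu : {perm 'I_m})
      k.+1 * \sum_(s : 'S_k) #|fixedX (mu, nu, lift_perm ord0 ord0 s)| =
    k.+1 * \sum_(mu : {perm 'I_n}) \sum_(nu : {perm 'I_m})
      \sum_(s : 'S_k) #|fixedX (mu, nu, lift_perm ord0 ord0 s)|)%N.
  by rewrite big_distrr; apply: eq_bigr => mu _; rewrite big_distrr.
rewrite !natrM swap.
set SX := \sum_(s : 'S_k.+1) _; set SY := \sum_(s : 'S_k) \sum_mu \sum_nu #|fixedY _|%:R.
set SE := \sum_(s : 'S_k) _ => E.
have f0 j : j`!%:R != 0 :> rat by rewrite pnatr_eq0 -lt0n fact_gt0.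
have k0 : k.+1%:R != 0 :> rat by rewrite pnatr_eq0.
have n0 := f0 n; have m0 := f0 m; have kf := f0 k.
apply: (mulIf n0); apply: (mulIf m0); apply: (mulIf k0); apply: (mulIf kf).
transitivity (SX + k.+1%:R * SY - k.+1%:R * SE); first by field; rewrite m0 n0 kf nat1r k0.
by rewrite E; ring.
Qed.

End GeneratingFunctions.

(** * Cliques and colourings of k-trees *)

Lemma ucycle_two_nbrs (T : eqType) (e : rel T) s y : ucycle e s -> 2 < size s -> y \in s ->
  exists x x', [/\ x != x', x \in s, x' \in s, e y x & e x' y].
Proof.
move=> /andP[cs us] s2 ys; have [i s' E] := rot_to ys.
have ms x : (x \in y :: s') = (x \in s) by rewrite -E mem_rot.
move: s2 us cs; rewrite -(size_rot i) -(rot_uniq i) -(rot_cycle i) E.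
case: s' ms {E} => [|x [|z s']] //= ms _ /andP[_ /andP[xs _]] /andP[yx].
rewrite rcons_path => /andP[_ /andP[_ ly]].
exists x, (last z s'); split=> //.
- by apply: contraNneq xs => ->; rewrite mem_last.
- by rewrite -ms !inE eqxx orbT.
- by rewrite -ms !inE; have := mem_last z s'; rewrite !inE => ->; rewrite !orbT.
Qed.

Lemma perm_extends (T U : finType) (S : {set T}) (f g : T -> U) :
  {in S &, injective f} -> {in S &, injective g} ->
  exists s : {perm U}, {in S, forall x, g x = s (f x)}.
Proof.
move=> fi gi.
pose L (h : T -> U) := [seq h x | x <- enum S] ++ enum (~: (h @: S)).
have uL h : {in S &, injective h} -> uniq (L h).
  move=> hi; rewrite cat_uniq enum_uniq andbT map_inj_in_uniq ?enum_uniq /=; last first.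
    by move=> x y; rewrite !mem_enum; apply: hi.
  apply/hasPn => y; rewrite mem_enum inE; apply: contra => /mapP[x].
  by rewrite mem_enum => xS ->; apply: imset_f.
have mL h y : y \in L h.
  rewrite mem_cat mem_enum inE; case: (boolP (y \in h @: S)) => [|_]; last by rewrite orbT.
  by case/imsetP => x xS ->; rewrite map_f ?mem_enum.
have sL h : {in S &, injective h} -> size (L h) = #|U|.
  move=> hi; rewrite -(card_uniqP (uL h hi)); apply: eq_card => y.
  by rewrite mL inE.
pose p y := nth y (L g) (index y (L f)).
have il y : index y (L f) < size (L g) by rewrite (sL g gi) -(sL f fi) index_mem mL.
have pi : injective p.
  move=> y z E; have := nth_uniq y (il y) (il z) (uL g gi).
  rewrite -[nth y _ _]/(p y) (set_nth_default z) // -[nth z _ _]/(p z) E eqxx => /esym/eqP.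
  by move/(congr1 (nth y (L f))); rewrite !nth_index.
exists (perm pi) => x xS; rewrite permE /p.
have ix : index x (enum S) < size (enum S) by rewrite index_mem mem_enum.
have -> : index (f x) (L f) = index x (enum S).
  rewrite index_cat map_f ?mem_enum //.
  have -> : f x = nth (f x) (map f (enum S)) (index x (enum S)).
    by rewrite (nth_map x) // nth_index ?mem_enum.
  by rewrite index_uniq ?size_map //; have := uL f fi; rewrite cat_uniq => /andP[].
rewrite nth_cat size_map ix (nth_map x) // nth_index ?mem_enum //.
Qed.

Section KTreeFacts.
Variables (T : finType) (k : nat) (E : {set {set T}}).
Implicit Types (S C t : {set T}) (u v : T).

Lemma cliqueP S : reflect (forall u v, u \in S -> v \in S -> u != v -> [set u;
  v] \in E) (clique E S).
Proof.
apply: (iffP 'forall_in_forall_inP) => [H u v uS vS uv|H u uS v vS].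
  by have /implyP := H u uS v vS; apply.
by apply/implyP; apply: H.
Qed.

Lemma clique_sub S S' : S' \subset S -> clique E S -> clique E S'.
Proof.
move=> /subsetP sS /cliqueP H; apply/cliqueP => u v uS vS; apply: H; exact: sS.
Qed.

(** The hedra and fronts contained in [S]. *)
Definition small_cliques S : {set {set T}} :=
  [set t | [&& clique E t, t \subset S & (#|t| == k) || (#|t| == k.+1)]].

Definition nested : rel {set T} := fun t t' => (t \proper t') || (t' \proper t).

Definition nested_in S u : rel {set T} := fun t t' =>
  [&& nested t t', t \in small_cliques S, t' \in small_cliques S, u \in t & u \in t'].

Definition nested_on S : rel {set T} := fun t t' =>
  [&& nested t t', t \in small_cliques S & t' \in small_cliques S].

Definition proper_colouring S (f : T -> 'I_k.+1) :=
  forall u v, u \in S -> v \in S -> u != v -> [set u; v] \in E -> f u != f v.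

(** What is preserved when a vertex is added to a k-tree: inclusion makes a tree of the hedra and
    fronts, those which contain a given vertex are connected, and colourings are unique. *)
Record ktree_facts S : Prop := KTreeFacts {
  kt_acyclic : forall s : seq {set T}, all (mem (small_cliques S)) s -> 2 < size s ->
    ~ ucycle nested s;
  kt_connected : forall t t', t \in small_cliques S -> t' \in small_cliques S ->
    connect (nested_on S) t t';
  kt_star : forall u t t', t \in small_cliques S -> t' \in small_cliques S ->
    u \in t -> u \in t' -> connect (nested_in S u) t t';
  kt_front : exists2 t, t \in small_cliques S & #|t| = k;
  kt_edge : forall u v, u \in S -> v \in S -> (u == v) || ([set u; v] \in E) ->
    exists2 t, t \in small_cliques S & (u \in t) && (v \in t);
  kt_hedra : (#|[set t in small_cliques S | #|t| == k.+1]| + k = #|S|)%N;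
  kt_colouring : exists f, proper_colouring S f;
  kt_colouring_unique : forall f g, proper_colouring S f -> proper_colouring S g ->
    exists s : 'S_k.+1, {in S, forall u, g u = s (f u)}
}.

Lemma nested_sym : symmetric nested.
Proof. by move=> t t'; rewrite /nested orbC. Qed.

Lemma clique_colouring_inj S f t : proper_colouring S f -> t \subset S -> clique E t ->
  {in t &, injective f}.
Proof.
move=> fS /subsetP tS /cliqueP tc u v ut vt fuv; apply/eqP/negPn/negP => uv.
by have := fS u v (tS _ ut) (tS _ vt) uv (tc _ _ ut vt uv); rewrite fuv eqxx.
Qed.

Lemma front_colours f t : {in t &, injective f} -> #|t| = k ->
  forall j : 'I_k.+1, (forall u, u \in t -> f u != j) -> f @: t = [set~ j].
Proof.
move=> fi tk j fj; apply/eqP; rewrite eqEcard card_in_imset // cardsC1 card_ord tk leqnn andbT.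
by apply/subsetP => _ /imsetP[u ut ->]; rewrite !inE fj.
Qed.

Hypothesis hk : 0 < k.

Lemma ktree_facts_base S : #|S| = k -> clique E S -> ktree_facts S.
Proof.
move=> Sk Sc.
have KS t : (t \in small_cliques S) = (t == S).
  rewrite inE; apply/and3P/eqP => [[_ tS tk]|->]; last by rewrite Sc subxx Sk eqxx.
  by apply/eqP; rewrite eqEcard tS Sk /=; case/orP: tk => /eqP ->.
split.
- move=> s sK s2 /andP[_ us]; have : size s <= 1.
    apply: (uniq_leq_size (s2 := [:: S]) us) => t ts.
    by have := allP sK t ts; rewrite /= KS inE.
  by rewrite leqNgt (ltnW s2).
- by move=> t t'; rewrite !KS => /eqP -> /eqP ->.
- by move=> u t t'; rewrite !KS => /eqP -> /eqP ->.
- by exists S; rewrite ?KS.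
- by move=> u v uS vS _; exists S; rewrite ?KS ?uS.
- suff -> : [set t in small_cliques S | #|t| == k.+1] = set0 by rewrite cards0.
  apply/setP => t; rewrite in_set KS in_set0; apply/negP => /andP[/eqP -> /eqP].
  by rewrite Sk; lia.
- pose f u : 'I_k.+1 := inord (index u (enum S)).
  exists f => u v uS vS uv _; apply: contra uv => /eqP fuv.
  have ix z : z \in S -> index z (enum S) < k.+1.
    by move=> zS; rewrite ltnS -Sk cardE index_size.
  have := congr1 val fuv; rewrite /f /= !inordK ?ix // => /(congr1 (nth u (enum S))).
  by rewrite !nth_index ?mem_enum // => ->.
- move=> f g fS gS; apply: perm_extends.
    exact: clique_colouring_inj fS (subxx _) Sc.
  exact: clique_colouring_inj gS (subxx _) Sc.
Qed.

(** The cliques that are new contain [v], so that they lie in the new hedron [v |: C]; a new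
    front is only adjacent to this hedron, and the only old clique adjacent to it is [C]. *)
Lemma ktree_facts_step S C v : ktree_facts S -> v \notin S -> C \subset S -> #|C| = k ->
  clique E C -> (forall u, u \in S -> ([set v; u] \in E) = (u \in C)) -> ktree_facts (v |: S).
Proof.
case=> acyc conn star front edge hed [f0 f0S] uniq vS CS Ck Cc vE.
pose H := v |: C; pose S' := v |: S.
have vC : v \notin C by apply: contra vS; apply: (subsetP CS).
have Hk : #|H| = k.+1 by rewrite cardsU1 vC Ck.
have HC : clique E H.
  apply/cliqueP => x y; rewrite !inE => /orP[/eqP ->|xC] /orP[/eqP ->|yC] xy.
  - by rewrite eqxx in xy.
  - by rewrite vE // (subsetP CS).
  - by rewrite setUC vE // (subsetP CS).
  - by move/cliqueP: Cc; apply.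
have nvS x : x \in S -> (x == v) = false by move=> xS; apply: contraNF vS => /eqP <-.
have CK : C \in small_cliques S by rewrite inE Cc CS Ck eqxx.
have K' t : t \in small_cliques S' -> v \in t -> t \subset H.
  rewrite inE => /and3P[/cliqueP tc tS _] vt; apply/subsetP => u ut; rewrite !inE.
  have [//|uv] := eqVneq u v; rewrite /= -vE ?tc // 1?eq_sym //.
  by have := subsetP tS u ut; rewrite !inE (negPf uv).
have Kold t : t \in small_cliques S' -> v \notin t -> t \in small_cliques S.
  rewrite !inE => /and3P[-> tS ->] vt; rewrite andbT /=; apply/subsetP => u ut.
  by have := subsetP tS u ut; rewrite !inE => /orP[/eqP uv|//]; rewrite -uv ut in vt.
have Ksub t : t \in small_cliques S -> t \in small_cliques S' /\ v \notin t.
  rewrite !inE => /and3P[-> tS ->]; rewrite (subset_trans tS (subsetUr _ _)); split=> //.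
  by apply: contra vS; apply: (subsetP tS).
have HK : H \in small_cliques S'.
  by rewrite inE HC Hk eqxx orbT andbT; apply: setUS.
have size_le t : t \in small_cliques S' -> k <= #|t| <= k.+1.
  by rewrite inE => /and3P[_ _ /orP[] /eqP ->]; rewrite leqnn leqnSn.
have tH t : t \in small_cliques S' -> v \in t -> t = H \/ (#|t| = k /\ nested t H).
  move=> tK vt; have tsub := K' t tK vt.
  have [|kt] := leqP k.+1 #|t|; first by move=> kt; left; apply/eqP; rewrite eqEcard tsub Hk.
  right; have tk : #|t| = k by apply/eqP; rewrite eqn_leq -ltnS kt; case/andP: (size_le t tK).
  by split=> //; rewrite /nested properEcard tsub tk Hk ltnSn.
(* a new front is adjacent to the new hedron only *)
have n1 t t' : t \in small_cliques S' -> t' \in small_cliques S' -> v \in t -> #|t| = k ->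
    nested t t' -> t' = H.
  move=> tK t'K vt tk /orP[] /[!properEcard] /andP[tt' ct]; last first.
    by move: ct; rewrite tk ltnNge; case/andP: (size_le t' t'K) => ->.
  have [//|[t'k _]] := tH t' t'K (subsetP tt' v vt).
  by rewrite tk t'k ltnn in ct.
(* the old front [C] is the only old neighbour of the new hedron *)
have n2 t' : t' \in small_cliques S' -> nested H t' -> v \notin t' -> t' = C.
  move=> t'K /orP[] /[!properEcard] /andP[tt' ct] vt'.
    by move: ct; rewrite Hk ltnNge; case/andP: (size_le t' t'K) => _ ->.
  apply/eqP; rewrite eqEcard Ck; have /andP[-> _] := size_le t' t'K; rewrite andbT.
  apply/subsetP => u ut; have := subsetP tt' u ut; rewrite !inE => /orP[/eqP uv|//].
  by rewrite -uv ut in vt'.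
have CH : nested C H by rewrite /nested properEcard subsetUr Ck Hk ltnSn.
have on_sub t t' : connect (nested_on S) t t' -> connect (nested_on S') t t'.
  apply: connect_sub => a b /and3P[ab aK bK]; apply: connect1.
  by rewrite /nested_on ab (Ksub _ aK).1 (Ksub _ bK).1.
have in_sub u t t' : connect (nested_in S u) t t' -> connect (nested_in S' u) t t'.
  apply: connect_sub => a b /and3P[ab aK /and3P[bK ua ub]]; apply: connect1.
  by rewrite /nested_in ab (Ksub _ aK).1 (Ksub _ bK).1 ua ub.
have on_sym : connect_sym (nested_on S').
  by apply: sym_connect_sym => a b; rewrite /nested_on nested_sym [_ && (b \in _)]andbC.
have in_sym u : connect_sym (nested_in S' u).
  apply: sym_connect_sym => a b; rewrite /nested_in nested_sym.
  by do ![case: (_ \in _)]; rewrite ?andbF.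
split.
- move=> s sK s2 cs.
  have inK t : t \in s -> t \in small_cliques S' by move=> ts; apply: (allP sK).
  have no_front t : t \in s -> v \in t -> #|t| = k -> False.
    move=> ts vt tk; have [x [x' [xx' xs x's tx x't]]] := ucycle_two_nbrs cs s2 ts.
    rewrite nested_sym in x't; case/eqP: xx'.
    by rewrite (n1 _ _ (inK _ ts) (inK _ xs) vt tk tx) (n1 _ _ (inK _ ts) (inK _ x's) vt tk x't).
  have no_H : H \in s -> False.
    move=> Hs; have [x [x' [xx' xs x's Hx x'H]]] := ucycle_two_nbrs cs s2 Hs.
    rewrite nested_sym in x'H; case/eqP: xx'.
    have nv y : y \in s -> nested H y -> v \notin y.
      move=> ys Hy; apply/negP => vy; have [yH|[yk _]] := tH y (inK _ ys) vy;
        last exact: no_front ys vy yk.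
      by move: Hy; rewrite yH /nested properxx.
    by rewrite (n2 _ (inK _ xs) Hx (nv _ xs Hx)) (n2 _ (inK _ x's) x'H (nv _ x's x'H)).
  apply: (acyc s) => //; apply/allP => t ts; apply: Kold; first exact: inK.
  apply/negP => vt; have [tE|[tk _]] := tH t (inK _ ts) vt; last exact: no_front ts vt tk.
  by apply: no_H; rewrite -tE.
- have toC t : t \in small_cliques S' -> connect (nested_on S') C t.
    move=> tK; have [vt|vt] := boolP (v \in t); last exact/on_sub/conn/Kold.
    have cH : connect (nested_on S') C H.
      by apply: connect1; rewrite /nested_on CH HK (Ksub _ CK).1.
    have [-> //|[_ nt]] := tH t tK vt.
    by apply: connect_trans cH _; apply: connect1; rewrite /nested_on nested_sym nt HK tK.
  by move=> t t' tK t'K; apply: connect_trans (toC _ t'K); rewrite on_sym toC.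
- move=> u t t' tK t'K ut ut'.
  have toH x : x \in small_cliques S' -> u \in x -> v \in x -> connect (nested_in S' u) H x.
    move=> xK ux vx; have [-> //|[_ nx]] := tH x xK vx; apply: connect1.
    by rewrite /nested_in nested_sym nx HK xK ux (subsetP (K' x xK vx)).
  have [uv|uv] := eqVneq u v.
    subst u; apply: connect_trans (toH t' t'K ut' ut').
    by rewrite in_sym; apply: toH.
  have toS x : x \in small_cliques S' -> u \in x ->
      exists y, [/\ y \in small_cliques S, u \in y & connect (nested_in S' u) y x].
    move=> xK ux; have [vx|vx] := boolP (v \in x); last by exists x; rewrite Kold.
    have uC : u \in C by have := subsetP (K' x xK vx) u ux; rewrite !inE (negPf uv).
    exists C; split=> //; apply: connect_trans (toH x xK ux vx); apply: connect1.
    by rewrite /nested_in CH (Ksub _ CK).1 HK uC !inE uC orbT.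
  have [y [yK uy cy]] := toS t tK ut; have [y' [y'K uy' cy']] := toS t' t'K ut'.
  apply: connect_trans cy'; apply: (connect_trans (y := y)); first by rewrite in_sym.
  exact/in_sub/star.
- by have [t tK tk] := front; exists t => //; apply: (Ksub _ tK).1.
- move=> x y; rewrite !inE => /orP[/eqP ->|xS] /orP[/eqP ->|yS] xy.
  + by exists H => //; rewrite !inE eqxx.
  + exists H => //; move: xy; rewrite eq_sym nvS //= vE // => yC.
    by rewrite !inE eqxx yC orbT.
  + exists H => //; move: xy; rewrite nvS //= setUC vE // => xC.
    by rewrite !inE eqxx xC orbT.
  + by have [t tK tx] := edge x y xS yS xy; exists t => //; apply: (Ksub _ tK).1.
- have -> : [set t in small_cliques S' | #|t| == k.+1] =
            H |: [set t in small_cliques S | #|t| == k.+1].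
    apply/setP => t; rewrite in_set in_setU1 in_set.
    apply/andP/orP => [[tK tk]|[/eqP ->|/andP[tK tk]]].
    + have [vt|vt] := boolP (v \in t); last by right; rewrite Kold.
      left; have [->|[tk' _]] := tH t tK vt; first by [].
      by rewrite tk' eqn_leq ltnn andbF in tk.
    + by rewrite HK Hk.
    + by rewrite (Ksub _ tK).1.
  rewrite [RHS]cardsU1 vS [in LHS]cardsU1 in_set.
  have -> : (H \in small_cliques S) = false.
    by apply/negP => /Ksub[_]; rewrite !inE eqxx.
  by rewrite -hed addnA.
- have [j jC] : exists j, j \notin f0 @: C.
    apply/existsP; rewrite -negb_forall; apply/negP => /forallP all.
    have : #|f0 @: C| <= k by have := leq_imset_card f0 C; rewrite Ck.
    suff -> : f0 @: C = [set: 'I_k.+1] by rewrite cardsT card_ord ltnn.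
    by apply/setP => j; rewrite all inE.
  exists (fun u => if u == v then j else f0 u) => x y; rewrite !inE.
  have jx z : z \in C -> f0 z != j by move=> zC; apply: contraNneq jC => <-; apply: imset_f.
  move=> /orP[/eqP ->|xS] /orP[/eqP ->|yS] xy; rewrite ?eqxx ?nvS //.
  + by rewrite eqxx in xy.
  + by rewrite vE // => /jx; rewrite eq_sym.
  + by rewrite setUC vE // => /jx.
  + exact: f0S.
- move=> f g fS' gS'.
  have res h : proper_colouring S' h -> proper_colouring S h.
    by move=> hS x y xS yS; apply: hS; rewrite !inE ?xS ?yS orbT.
  have [s sP] := uniq f g (res f fS') (res g gS'); exists s => u.
  rewrite !inE => /orP[/eqP ->|]; last exact: sP.
  (* the front [C] misses exactly the colour of [v] *)
  have miss h : proper_colouring S' h -> h @: C = [set~ h v].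
    move=> hS; apply: front_colours => // [|x xC].
      exact: clique_colouring_inj (res h hS) CS Cc.
    have xS := subsetP CS x xC.
    apply: hS; rewrite /S' ?in_setU1 ?eqxx ?xS ?orbT ?nvS //.
    by rewrite setUC vE.
  have gC : g @: C = s @: (f @: C).
    rewrite -imset_comp; apply: eq_in_imset => x xC /=; apply: sP; exact: (subsetP CS).
  apply/esym/eqP/negPn/negP => sg.
  have : s (f v) \in g @: C by rewrite miss // !inE.
  by rewrite gC mem_imset ?miss ?inE ?eqxx //; apply: perm_inj.
Qed.

Lemma ktree_on_facts S : ktree_on k E S -> ktree_facts S.
Proof.
elim=> [S' Sk Sc|S' C v _ IH vS CS Ck Cc vE]; first exact: ktree_facts_base.
exact: ktree_facts_step IH vS CS Ck Cc vE.
Qed.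

End KTreeFacts.

(** * The coloured tree of a k-tree *)

Definition fronts (T : finType) (k : nat) (E : {set {set T}}) : {set {set T}} :=
  [set t | clique E t & #|t| == k].

Definition off_colour k (A B : finType) (w : ctree k A B) (j : 'I_k.+1) (u : A + B) :=
  if u is inr b then w.2 b != j else true.

(** The white vertices of colour [j] are removed; the components of [link w j] are the vertices
    of colour [j] of the k-tree. *)
Definition link k (A B : finType) (w : ctree k A B) (j : 'I_k.+1) : rel (A + B) := fun u v =>
  [&& inc w.1 u v, off_colour w j u & off_colour w j v].

Lemma perm_of_same_image (A U : finType) (f g : A -> U) :
  injective f -> injective g -> (forall y, (y \in codom f) = (y \in codom g)) ->
  exists p : {perm A}, forall x, g (p x) = f x.
Proof.
move=> fi gi fg.
have /choice[p pP] : forall x, exists y, g y = f x.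
  by move=> x; have := codom_f f x; rewrite fg => /codomP[y ->]; exists y.
have pinj : injective p by move=> x y E; apply: fi; rewrite -!pP E.
by exists (perm pinj) => x; rewrite permE.
Qed.

Section Codes.
Variables (k : nat) (A B V : finType).
Hypothesis hk : 0 < k.
Implicit Types (E : {set {set V}}) (w : ctree k A B) (h : A + B -> {set V}) (f : V -> 'I_k.+1).

(** [h] labels the hedra by [A] and the fronts by [B]; the colour of a front is the one that
    [f] does not take on it. *)
Record codes E f h w : Prop := Codes {
  codes_colouring : proper_colouring E [set: V] f;
  codes_inj : injective h;
  codes_hedra : forall t, (t \in hedra k E) = (t \in codom (h \o inl));
  codes_fronts : forall t, (t \in fronts k E) = (t \in codom (h \o inr));
  codes_inc : forall a b, (b \in w.1 a) = (h (inr b) \subset h (inl a));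
  codes_colour : forall b x, x \in h (inr b) -> f x != w.2 b
}.

Section OneCode.
Variables (E : {set {set V}}) (f : V -> 'I_k.+1) (h : A + B -> {set V}) (w : ctree k A B).
Hypothesis c : codes E f h w.

Lemma codes_hedron a : clique E (h (inl a)) /\ #|h (inl a)| = k.+1.
Proof.
have : h (inl a) \in hedra k E by rewrite (codes_hedra c) (codom_f (h \o inl)).
by rewrite inE => /andP[? /eqP].
Qed.

Lemma codes_front b : clique E (h (inr b)) /\ #|h (inr b)| = k.
Proof.
have : h (inr b) \in fronts k E by rewrite (codes_fronts c) (codom_f (h \o inr)).
by rewrite inE => /andP[? /eqP].
Qed.

Lemma codes_clique u : clique E (h u).
Proof. by case: u => [a|b]; [case: (codes_hedron a) | case: (codes_front b)]. Qed.

Lemma codes_cliqueP t : reflect (exists u, t = h u) (t \in small_cliques k E [set: V]).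
Proof.
apply: (iffP idP) => [|[u ->]].
  rewrite inE subsetT /= andb_orr => /orP[] tc.
    have : t \in fronts k E by rewrite inE.
    by rewrite (codes_fronts c) => /codomP[b ->]; exists (inr b).
  have : t \in hedra k E by rewrite inE.
  by rewrite (codes_hedra c) => /codomP[a ->]; exists (inl a).
rewrite inE codes_clique subsetT /=; case: u => [a|b].
  by rewrite (codes_hedron a).2 eqxx orbT.
by rewrite (codes_front b).2 eqxx.
Qed.

Lemma codes_nested u v : nested (h u) (h v) = inc w.1 u v.
Proof.
rewrite /nested !properEcard; case: u v => [a|b] [a'|b'] /=;
  rewrite ?(codes_hedron _).2 ?(codes_front _).2.
- by rewrite ltnn !andbF.
- by rewrite ltnSn andbT ltnNge leqnSn andbF /= (codes_inc c).
- by rewrite ltnSn andbT ltnNge leqnSn andbF orbF /= (codes_inc c).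
- by rewrite ltnn !andbF.
Qed.

Lemma codes_colour_inj u : {in h u &, injective f}.
Proof. exact: clique_colouring_inj (codes_colouring c) (subsetT _) (codes_clique u). Qed.

Lemma codes_front_colours b : f @: h (inr b) = [set~ w.2 b].
Proof.
apply: front_colours; first exact: codes_colour_inj.
  by case: (codes_front b).
by move=> x xb; apply: (codes_colour c).
Qed.

Lemma codes_hedron_colours a : f @: h (inl a) = [set: 'I_k.+1].
Proof.
apply/eqP; rewrite eqEcard subsetT cardsT card_ord card_in_imset; last exact: codes_colour_inj.
by rewrite (codes_hedron a).2 leqnn.
Qed.

Lemma codes_vertex u j : off_colour w j u -> exists2 x, x \in h u & f x = j.
Proof.
case: u => [a|b] /= jb.
  have : j \in f @: h (inl a) by rewrite codes_hedron_colours inE.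
  by case/imsetP => x xa ->; exists x.
have : j \in f @: h (inr b) by rewrite codes_front_colours !inE eq_sym.
by case/imsetP => x xa ->; exists x.
Qed.

Lemma codes_off x u : x \in h u -> off_colour w (f x) u.
Proof. by case: u => [a|b] //= xb; rewrite eq_sym; apply: (codes_colour c). Qed.

(** Adjacent cliques that both have a vertex of colour [f x] have the same one. *)
Lemma link_same_vertex x x' u u' : x \in h u -> x' \in h u' -> f x = f x' ->
  connect (link w (f x)) u u' -> x = x'.
Proof.
move=> xu x'u' fx cu.
suff xu' : x \in h u' by apply: (codes_colour_inj xu' x'u').
apply: (@connect_ind _ (link w (f x)) (fun u => x \in h u) u u') => //.
move=> [a|b] [a'|b'] //= xv /and3P[/= bN ov ov'].
  have [y yb fy] := codes_vertex (u := inr b') ov'.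
  rewrite (codes_inc c) in bN.
  by rewrite -(codes_colour_inj (subsetP bN _ yb) xv fy).
by rewrite (codes_inc c) in bN; apply: (subsetP bN).
Qed.

Hypothesis kt : ktree k E.

Let facts : ktree_facts k E [set: V].
Proof. by apply: ktree_on_facts => //; case: kt. Qed.

(** A hedron has one front for each colour, obtained by removing the vertex of this colour. *)
Lemma codes_tree : coloured_tree w.
Proof.
split.
  split.
  - have [t tK _] := kt_front facts; case/codes_cliqueP: tK => u _.
    by apply/card_gt0P; exists u.
  - move=> u v; have := kt_connected facts (t := h u) (t' := h v).
    move=> H; have {H}cuv : connect (nested_on k E [set: V]) (h u) (h v).
      by apply: H; apply/codes_cliqueP; eexists.
    apply: (@connect_ind _ _ (fun t => forall v, h v = t ->
      connect (inc w.1) u v) _ _ _ _ cuv) => //.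
      by move=> v' /(codes_inj c) ->.
    move=> t t' IH /and3P[tt' /codes_cliqueP[v' E1] _] v'' E2; subst t t'.
    by apply: connect_trans (IH v' erefl) (connect1 _); rewrite -codes_nested.
  - move=> s s2 /andP[cs us]; apply: (kt_acyclic facts (s := map h s)).
    + by apply/allP => _ /mapP[u _ ->]; apply/codes_cliqueP; exists u.
    + by rewrite size_map.
    rewrite /ucycle map_inj_uniq ?us ?andbT; last exact: codes_inj c.
    case: s cs {us s2} => //= u s; rewrite -map_rcons path_map.
    by apply: sub_path => x y /=; rewrite codes_nested.
move=> a j; have [x xa fx] := codes_vertex (u := inl a) (j := j) isT.
have [ac asz] := codes_hedron a.
have tf : h (inl a) :\ x \in fronts k E.
  rewrite inE (clique_sub _ ac) ?subD1set //=.
  by have := cardsD1 x (h (inl a)); rewrite xa asz add1n => /eqP; rewrite eqSS eq_sym.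
move: (tf); rewrite (codes_fronts c) => /codomP[b /= hb].
exists b => b'; rewrite (codes_inc c); apply/andP/eqP => [[sb /eqP cb]|->].
  have sub : h (inr b') \subset h (inl a) :\ x.
    apply/subsetP => y yb; rewrite !inE (subsetP sb) // andbT.
    by apply: contraNneq (codes_colour c yb) => ->; rewrite fx cb.
  have /codes_inj : h (inr b') = h (inr b).
    apply/eqP; rewrite eqEcard (codes_front b).2 (codes_front b').2 leqnn andbT -hb //.
  by move=> /(_ E f w c)[].
rewrite -hb subD1set; split=> //.
have : f x \notin f @: h (inr b).
  rewrite -hb; apply/imsetP => -[y]; rewrite !inE => /andP[yx ya] fxy.
  by move: yx; rewrite (codes_colour_inj xa ya fxy) eqxx.
by rewrite codes_front_colours !inE negbK fx eq_sym.
Qed.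

(** The cliques containing [x] are connected, and none of them misses the colour of [x]. *)
Lemma codes_link x u u' : x \in h u -> x \in h u' -> connect (link w (f x)) u u'.
Proof.
move=> xu xu'.
have cuu' : connect (nested_in k E [set: V] x) (h u) (h u').
  by apply: (kt_star facts) => //; apply/codes_cliqueP; eexists.
apply: (@connect_ind _ _ (fun t => forall v, h v = t ->
  connect (link w (f x)) u v) _ _ _ _ cuu') => //.
  by move=> v' /(codes_inj c) ->.
move=> t t' IH /and5P[tt' /codes_cliqueP[v' E1] _ xt xt'] v'' E2; subst t t'.
apply: connect_trans (IH v' erefl) (connect1 _).
by rewrite /link -codes_nested tt' !codes_off.
Qed.

Lemma codes_cover x y : (x == y) || ([set x; y] \in E) -> exists u, (x \in h u) && (y \in h u).
Proof.
move=> xy; have [|||t /codes_cliqueP[u ->]] := kt_edge facts (u := x) (v := y); rewrite ?inE //.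
by exists u.
Qed.

End OneCode.

Lemma codes_act E f h w (g : {perm A} * {perm B} * 'S_k.+1) : codes E f h w ->
  exists f' h', codes E f' h' (ctree_act w g).
Proof.
move=> c.
pose r (u : A + B) := match u with
  | inl a => inl ((g.1.1^-1)%g a) | inr b => inr ((g.1.2^-1)%g b) end : A + B.
have ri : injective r by move=> [a|b] [a'|b'] [] // /perm_inj ->.
exists (g.2 \o f), (h \o r); split.
- by move=> x y xV yV xy xyE /=; rewrite (inj_eq perm_inj); apply: (codes_colouring c).
- by apply: inj_comp ri; apply: codes_inj c.
- move=> t; rewrite (codes_hedra c); apply/codomP/codomP => -[a ->] /=.
    by exists (g.1.1 a); rewrite /= permK.
  by eexists; reflexivity.
- move=> t; rewrite (codes_fronts c); apply/codomP/codomP => -[b ->] /=.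
    by exists (g.1.2 b); rewrite /= permK.
  by eexists; reflexivity.
- by move=> a b; rewrite ctree_act_mem (codes_inc c).
- by move=> b x xb; rewrite ffunE /= (inj_eq perm_inj); apply: (codes_colour c).
Qed.

(** Two codes of one k-tree differ by a renaming of the hedra, of the fronts and of the colours. *)
Lemma codes_orbit E f h w f' h' w' : ktree k E -> codes E f h w -> codes E f' h' w' ->
  exists g : {perm A} * {perm B} * 'S_k.+1, w' = ctree_act w g.
Proof.
move=> kt c c'.
have facts : ktree_facts k E [set: V] by apply: ktree_on_facts => //; case: kt.
have [s sP] := kt_colouring_unique facts (codes_colouring c) (codes_colouring c').
have [mu muP] : exists mu : {perm A}, forall a, h' (inl (mu a)) = h (inl a).
  apply: (@perm_of_same_image _ _ (h \o inl) (h' \o inl)).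
  - by move=> x y /(codes_inj c) [].
  - by move=> x y /(codes_inj c') [].
  - by move=> t; rewrite -(codes_hedra c) -(codes_hedra c').
have [nu nuP] : exists nu : {perm B}, forall b, h' (inr (nu b)) = h (inr b).
  apply: (@perm_of_same_image _ _ (h \o inr) (h' \o inr)).
  - by move=> x y /(codes_inj c) [].
  - by move=> x y /(codes_inj c') [].
  - by move=> t; rewrite -(codes_fronts c) -(codes_fronts c').
exists (mu, nu, s); apply: injective_projections; apply/ffunP => x.
  apply/setP => b; rewrite ctree_act_mem /= -[in LHS](permKV mu x) -[in LHS](permKV nu b).
  by rewrite (codes_inc c) (codes_inc c') muP nuP.
rewrite ffunE /= -[in LHS](permKV nu x); set b := (nu^-1)%g x.
apply/eqP/negPn/negP => ne.
have : w'.2 (nu b) \in f' @: h' (inr (nu b)).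
  rewrite nuP; have -> : f' @: h (inr b) = s @: (f @: h (inr b)).
    by rewrite -imset_comp; apply: eq_in_imset => y _; apply: sP; rewrite inE.
  rewrite (codes_front_colours c) -(permKV s (w'.2 _)) mem_imset; last exact: perm_inj.
  by rewrite !inE; apply: contra ne => /eqP <-; rewrite (permKV s).
by rewrite (codes_front_colours c') !inE eqxx.
Qed.

End Codes.

Section Transport.
Variables (k : nat) (A B V V' : finType).
Hypothesis hk : 0 < k.
Implicit Types (w : ctree k A B).

Definition graph_image (p : V -> V') (E : {set {set V}}) : {set {set V'}} :=
  [set p @: (e : {set V}) | e in E].

(** A vertex corresponds to the vertex of the same colour in any clique with the same label;
    whether two cliques share their vertex of a given colour is read off the coloured tree. *)
Lemma codes_iso E E' f f' h h' w : ktree k E -> ktree k E' ->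
  codes E f h w -> codes (E' : {set {set V'}}) f' h' w ->
  exists2 p : V -> V', injective p & E' = graph_image p E.
Proof.
move=> kt kt' c c'.
pose R x y := exists u, [/\ x \in h u, y \in h' u & f x = f' y].
have Rfun x y y' : R x y -> R x y' -> y = y'.
  case=> u [xu yu fxy] [u' [xu' yu' fxy']].
  apply: (link_same_vertex c' yu yu'); first by rewrite -fxy.
  by rewrite -fxy; apply: (codes_link hk c kt).
have Rinj x x' y : R x y -> R x' y -> x = x'.
  case=> u [xu yu fxy] [u' [xu' yu' fxy']].
  apply: (link_same_vertex c xu xu'); first by rewrite fxy'.
  by rewrite fxy; apply: (codes_link hk c' kt').
have Rex u x : x \in h u -> exists2 y, y \in h' u & R x y.
  move=> xu; have [y yu fy] := codes_vertex c' (codes_off c xu).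
  by exists y => //; exists u.
have Rex' u y : y \in h' u -> exists2 x, x \in h u & R x y.
  move=> yu; have [x xu fx] := codes_vertex c (codes_off c' yu).
  by exists x => //; exists u.
have /choice[p pP] : forall x, exists y, R x y.
  move=> x; have [|u /andP[xu _]] := codes_cover hk c kt (x := x) (y := x); first by rewrite eqxx.
  by have [y _ xy] := Rex u x xu; exists y.
have pi : injective p by move=> x x' E1; apply: (Rinj x x' (p x)); rewrite // E1.
exists p => //.
have pair (U : finType) (D : {set {set U}}) e : ktree k D -> e \in D ->
    exists x y, [/\ x != y, e = [set x; y] & [set x; y] \in D].
  move=> [/forall_inP sD _] eD; have /cards2P[x [y [xy ee]]] := sD e eD.
  by exists x, y; rewrite -ee.
apply/setP => e; apply/idP/imsetP => [eE|[e0 eE ->]].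
  have [x' [y' [xy -> xyE]]] := pair _ _ _ kt' eE.
  have [|u /andP[xu yu]] := codes_cover hk c' kt' (x := x') (y := y'); first by rewrite xyE orbT.
  have [x xhu Rx] := Rex' _ _ xu; have [y yhu Ry] := Rex' _ _ yu.
  have px : p x = x' by apply: Rfun Rx.
  have py : p y = y' by apply: Rfun Ry.
  exists [set x; y]; last by rewrite imsetU1 imset_set1 px py.
  have /cliqueP := codes_clique c u; apply=> //.
  by apply: contraNneq xy => xy; rewrite -px -py xy.
have [x [y [xy -> xyE]]] := pair _ _ _ kt eE.
have [|u /andP[xu yu]] := codes_cover hk c kt (x := x) (y := y); first by rewrite xyE orbT.
have [x' xhu Rx] := Rex _ _ xu; have [y' yhu Ry] := Rex _ _ yu.
have px : p x = x' by apply: Rfun Rx.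
have py : p y = y' by apply: Rfun Ry.
rewrite imsetU1 imset_set1 px py.
have /cliqueP := codes_clique c' u; apply=> //.
by rewrite -px -py (inj_eq pi).
Qed.

Variables (p : V -> V') (q : V' -> V).
Hypotheses (pK : cancel p q) (qK : cancel q p).

Lemma graph_image_pair (E : {set {set V}}) x y : ([set p x; p y] \in graph_image p E) = ([set x;
  y] \in E).
Proof.
have pi := can_inj pK.
have -> : [set p x; p y] = p @: [set x; y] by rewrite imsetU1 imset_set1.
by rewrite /graph_image mem_imset //; apply: imset_inj.
Qed.

Lemma clique_image E (S : {set V}) : clique (graph_image p E) (p @: S) = clique E S.
Proof.
have pi := can_inj pK.
apply/cliqueP/cliqueP => [H x y xS yS xy|H _ _ /imsetP[x xS ->] /imsetP[y yS ->]].
  by rewrite -graph_image_pair H ?imset_f // (inj_eq pi).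
by rewrite (inj_eq pi) graph_image_pair; apply: H.
Qed.

Lemma imsetK_can (S : {set V'}) : p @: (q @: S) = S.
Proof. by rewrite -imset_comp (eq_imset _ qK) imset_id. Qed.

Lemma ktree_image E : ktree k E -> ktree k (graph_image p E).
Proof.
have pi := can_inj pK.
case=> /forall_inP sE kE; split.
  by apply/forall_inP => _ /imsetP[e eE ->]; rewrite card_imset // sE.
have -> : [set: V'] = p @: [set: V].
  by apply/setP => y; rewrite !inE -(qK y) imset_f.
elim: kE => [S Sk Sc|S C v _ IH vS CS Ck Cc vE].
  by apply: ktree_complete; rewrite ?card_imset ?clique_image.
rewrite imsetU1; apply: (ktree_add (C := p @: C)) => //.
- by rewrite mem_imset.
- exact: imsetS.
- by rewrite card_imset.
- by rewrite clique_image.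
- by move=> _ /imsetP[u uS ->]; rewrite graph_image_pair mem_imset // vE.
Qed.

Lemma codes_image E f h w : codes E f h w ->
  exists f' h', codes (graph_image p E) f' h' w.
Proof.
have pi := can_inj pK.
move=> c; exists (f \o q), (fun u => p @: h u); split.
- move=> x y _ _ xy xyE /=; apply: (codes_colouring c); rewrite ?inE //.
    by rewrite (inj_eq (can_inj qK)).
  by rewrite -graph_image_pair !qK.
- by move=> u v /(imset_inj pi)/(codes_inj c).
- move=> t; rewrite -(imsetK_can t) inE clique_image card_imset //.
  have := codes_hedra c (q @: t); rewrite inE => ->.
  apply/codomP/codomP => -[a /= E1]; exists a => /=; first by rewrite E1.
  exact: imset_inj E1.
- move=> t; rewrite -(imsetK_can t) inE clique_image card_imset //.
  have := codes_fronts c (q @: t); rewrite inE => ->.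
  apply/codomP/codomP => -[a /= E1]; exists a => /=; first by rewrite E1.
  exact: imset_inj E1.
- move=> a b; rewrite (codes_inc c); apply/idP/idP; first exact: imsetS.
  move=> /subsetP H; apply/subsetP => x xb; have := H (p x); rewrite !mem_imset //; exact.
- by move=> b _ /imsetP[x xb ->] /=; rewrite pK; apply: (codes_colour c).
Qed.

End Transport.

(** * The k-tree of a coloured tree *)

Section KTreeCode.
Variables (k : nat) (V : finType) (E : {set {set V}}).
Hypothesis hk : 0 < k.
Hypothesis kt : ktree k E.

Let facts : ktree_facts k E [set: V].
Proof. by apply: ktree_on_facts => //; case: kt. Qed.

Lemma card_hedra : (#|hedra k E| + k = #|V|)%N.
Proof.
rewrite -[RHS]cardsT -(kt_hedra facts); congr (_ + k)%N; apply: eq_card => t.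
rewrite !inE subsetT /=; case: (#|t| == k.+1); rewrite ?andbF ?andbT //.
by rewrite orbT andbT.
Qed.

Lemma ktree_has_code : exists f h (w : ctree k 'I_#|hedra k E| 'I_#|fronts k E|), codes E f h w.
Proof.
have [f fE] := kt_colouring facts.
pose h (u : 'I_#|hedra k E| + 'I_#|fronts k E|) : {set V} :=
  match u with inl a => enum_val a | inr b => enum_val b end.
have hA a : h (inl a) \in hedra k E by apply: enum_valP.
have hB b : h (inr b) \in fronts k E by apply: enum_valP.
pose w : ctree k 'I_#|hedra k E| 'I_#|fronts k E| :=
  ([ffun a => [set b | h (inr b) \subset h (inl a)]],
   [ffun b => odflt ord0 [pick j | j \notin f @: h (inr b)]]).
exists f, h, w; split=> //.
- have szA a : #|h (inl a)| = k.+1 by have := hA a; rewrite inE => /andP[_ /eqP].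
  have szB b : #|h (inr b)| = k by have := hB b; rewrite inE => /andP[_ /eqP].
  move=> [a|b] [a'|b'] E1.
  + by congr inl; apply: enum_val_inj.
  + by have := szA a; rewrite E1 szB => /n_Sn.
  + by have := szA a'; rewrite -E1 szB => /n_Sn.
  + by congr inr; apply: enum_val_inj.
- move=> t; apply/idP/codomP => [tE|[a ->]]; last exact: hA.
  by exists (enum_rank_in tE t); rewrite /= enum_rankK_in.
- move=> t; apply/idP/codomP => [tE|[b ->]]; last exact: hB.
  by exists (enum_rank_in tE t); rewrite /= enum_rankK_in.
- by move=> a b; rewrite ffunE inE.
- move=> b x xb; rewrite ffunE; case: pickP => [j jb|none] /=.
    by apply: contraNneq jb => <-; apply: imset_f.
  have : #|f @: h (inr b)| <= k.
    by have := leq_imset_card f (h (inr b)); have := hB b; rewrite inE => /andP[_ /eqP ->].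
  suff -> : f @: h (inr b) = [set: 'I_k.+1] by rewrite cardsT card_ord ltnn.
  by apply/setP => j; rewrite in_setT; apply/negbNE; rewrite none.
Qed.

(** Euler's relation for the tree of hedra and fronts. *)
Lemma card_fronts : (#|fronts k E| = #|hedra k E| * k + 1)%N.
Proof.
have [f [h [w c]]] := ktree_has_code.
by have := ctree_card (codes_tree hk c kt); rewrite !card_ord => ->.
Qed.

End KTreeCode.

Section TreeToKTree.
Variables (k : nat) (A B : finType) (w : ctree k A B).
Hypothesis hk : 0 < k.
Hypothesis wT : coloured_tree w.
Implicit Types (u v : A + B) (j : 'I_k.+1).

Lemma link_sym j : symmetric (link w j).
Proof. by move=> u v; rewrite /link inc_sym [off_colour _ _ _ && _]andbC. Qed.

Let lsym j := sym_connect_sym (@link_sym j).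

Lemma link_inc j : subrel (link w j) (inc w.1).
Proof. by move=> u v /and3P[]. Qed.

Lemma connect_off_colour j u v : off_colour w j u -> connect (link w j) u v -> off_colour w j v.
Proof.
by move=> ou; apply: (@connect_ind _ _ (fun v => off_colour w j v)) => // x y _ /and3P[].
Qed.

(** A vertex is a colour together with the chosen representative of a component. *)
Definition is_vertex (x : 'I_k.+1 * (A + B)) :=
  off_colour w x.1 x.2 && (fingraph.root (link w x.1) x.2 == x.2).
Definition vertex : finType := {x | is_vertex x}.
Implicit Types x y : vertex.

Definition vcol x : 'I_k.+1 := (val x).1.
(** The vertices of the clique labelled by [u]. *)
Definition vset u : {set vertex} :=
  [set x | off_colour w (vcol x) u && connect (link w (vcol x)) u (val x).2].

Lemma vset_inj u x y : x \in vset u -> y \in vset u -> vcol x = vcol y -> x = y.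
Proof.
rewrite !inE => /andP[_ cx] /andP[_ cy] E; apply: val_inj; apply: injective_projections => //.
have /andP[_ /eqP <-] := valP x; have /andP[_ /eqP <-] := valP y.
rewrite -/(vcol x) -/(vcol y) -E; apply/(fingraph.rootP (lsym _)).
by rewrite -E in cy; apply: connect_trans cy; rewrite lsym.
Qed.

Lemma vset_ex u j : off_colour w j u -> exists2 x, x \in vset u & vcol x = j.
Proof.
move=> ou; have cr := connect_root (link w j) u.
have xP : is_vertex (j, fingraph.root (link w j) u).
  by rewrite /is_vertex /= (connect_off_colour ou cr) (fingraph.root_root (@lsym j)) eqxx.
by exists (Sub (j, fingraph.root (link w j) u) xP); rewrite ?inE /vcol ?SubK //= ou.
Qed.

Lemma vset_link u v x : x \in vset u -> x \in vset v -> connect (link w (vcol x)) u v.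
Proof.
rewrite !inE => /andP[_ cu] /andP[_ cv]; apply: connect_trans cu _.
by rewrite lsym.
Qed.

Lemma vset_connect u v x : x \in vset u -> connect (link w (vcol x)) u v -> x \in vset v.
Proof.
rewrite !inE => /andP[ou cu] cuv; rewrite (connect_off_colour ou cuv) /=.
by apply: connect_trans cu; rewrite lsym.
Qed.

Lemma vset_cover x : x \in vset (val x).2.
Proof. by rewrite inE connect0 andbT; case/andP: (valP x). Qed.

Lemma vset_off u x : x \in vset u -> off_colour w (vcol x) u.
Proof. by rewrite inE => /andP[]. Qed.

Lemma card_vset u : #|vset u| = #|[set j | off_colour w j u]|.
Proof.
rewrite -(card_in_imset (f := vcol)); last by move=> x y xu yu; exact: (vset_inj xu yu).
apply: eq_card => j; rewrite inE; apply/imsetP/idP => [[x xu ->]|/vset_ex[x xu <-]].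
  exact: vset_off.
by exists x.
Qed.

Lemma card_vset_black a : #|vset (inl a)| = k.+1.
Proof.
rewrite card_vset; have -> : [set j | off_colour w j (inl a)] = [set: 'I_k.+1].
  by apply/setP => j; rewrite !in_setT.
by rewrite cardsT card_ord.
Qed.

Lemma card_vset_white b : #|vset (inr b)| = k.
Proof.
rewrite card_vset; have -> : [set j | off_colour w j (inr b)] = [set~ w.2 b].
  by apply/setP => j; rewrite in_setC1 inE eq_sym.
by rewrite cardsC1 card_ord.
Qed.

Lemma vset_inc a b : b \in w.1 a -> vset (inr b) \subset vset (inl a).
Proof.
move=> bN; apply/subsetP => x xb; apply: (vset_connect xb); apply: connect1.
by have := vset_off xb; rewrite /link /= bN => ->.
Qed.

Definition tree_graph : {set {set vertex}} :=
  [set e : {set vertex} | (#|e| == 2) && [exists u, e \subset vset u]].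

Lemma tree_graphP x y : x != y ->
  reflect (exists2 u, x \in vset u & y \in vset u) ([set x; y] \in tree_graph).
Proof.
move=> xy; rewrite inE cards2 xy /=; apply: (iffP existsP) => [[u]|[u xu yu]].
  by rewrite subUset !sub1set => /andP[xu yu]; exists u.
by exists u; rewrite subUset !sub1set xu yu.
Qed.

Lemma vset_clique u : clique tree_graph (vset u).
Proof. by apply/cliqueP => x y xu yu xy; apply/tree_graphP => //; exists u. Qed.

(** The front opposite to [z] is the neighbour of [a] which has the colour of [z]. *)
Lemma vset_minus a z : z \in vset (inl a) -> exists b, vset (inl a) :\ z = vset (inr b).
Proof.
move=> za; have [_ /(_ a (vcol z))[b bP]] := wT.
have := bP b; rewrite eqxx => /andP[bN /eqP bz]; exists b; apply/esym/eqP.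
rewrite eqEcard card_vset_white; apply/andP; split; last first.
  by have := cardsD1 z (vset (inl a)); rewrite za card_vset_black add1n => /eqP;
    rewrite eqSS => /eqP <-.
apply/subsetP => x xb; rewrite !inE; apply/andP; split.
  apply: contraTneq xb => ->; apply: contraT; rewrite negbK => /vset_off /=.
  by rewrite bz eqxx.
by have := subsetP (vset_inc bN) x xb; rewrite inE.
Qed.

Definition vertices_of (S : {set A + B}) : {set vertex} := \bigcup_(u in S) vset u.

(** The invariant for a growing part [S] of the tree.  Fronts are compared with all white
    vertices, including those not yet in [S]. *)
Definition grown (S : {set A + B}) := [/\ ktree_on k tree_graph (vertices_of S),
  #|vertices_of S| = (k + #|[set a | inl a \in S]|)%N,
  forall F : {set vertex}, F \subset vertices_of S -> clique tree_graph F -> #|F| = k ->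
    exists b, F = vset (inr b) &
  forall H : {set vertex}, H \subset vertices_of S -> clique tree_graph H -> #|H| = k.+1 ->
    exists a, H = vset (inl a)].

Lemma grown_root b : grown [set inr b].
Proof.
have vE : vertices_of [set inr b] = vset (inr b) by rewrite /vertices_of big_set1.
rewrite /grown vE; split.
- by apply: ktree_complete; [exact: card_vset_white | exact: vset_clique].
- rewrite card_vset_white; suff -> : [set a | inl a \in [set (inr b : A + B)]] = set0
  by rewrite cards0 addn0.
  by apply/setP => a; rewrite !inE.
- move=> F Fb _ Fk; exists b; apply/eqP.
  by rewrite eqEcard Fb Fk card_vset_white leqnn.
- by move=> H /subset_leq_card; rewrite card_vset_white => Hk _ H1; rewrite H1 ltnn in Hk.
Qed.

Lemma grown_white (S : {set A + B}) a b : grown S -> inl a \in S -> inr b \notin S -> b \in w.1 a ->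
  grown (inr b |: S).
Proof.
case=> g1 g2 g3 g4 aS bS bN.
have vE : vertices_of (inr b |: S) = vertices_of S.
  rewrite /vertices_of bigcup_setU big_set1; apply/setUidPr.
  by apply: subset_trans (vset_inc bN) _; apply: bigcup_sup.
rewrite /grown vE; split=> //; rewrite g2; congr (_ + _)%N; apply: eq_card => a'.
by rewrite !inE.
Qed.

(** Only the vertex [z] of [a] opposite to the front [b] is new.  The labels of the cliques that
    contain [z] are joined to [a] without crossing the bridge from [a] to [b], beyond which lies
    [S]; so [z] is not a vertex of [S], and a vertex of [S] sharing a clique with [z] survives
    the crossing, that is, belongs to the front [b]. *)
Lemma grown_black (S : {set A + B}) a b : grown S -> inr b \in S -> inl a \notin S -> b \in w.1 a ->
  (forall u, u \in S -> connect (del_edge (inc w.1) (inr b) (inl a)) (inr b) u) ->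
  grown (inl a |: S).
Proof.
case=> g1 g2 g3 g4 bS aS bN side.
have [T _] := wT.
have eab : inc w.1 (inl a) (inr b) by [].
have sideS u : u \in S -> connect (del_edge (inc w.1) (inl a) (inr b)) (inr b) u.
  by move=> /side; rewrite (eq_connect (del_edgeC _ _ _)).
(* a link walk from the side of [a] to [S] uses the edge from [a] to [b] *)
have crossing j u v : connect (del_edge (inc w.1) (inl a) (inr b)) (inl a) u ->
    v \in S -> connect (link w j) u v ->
    [/\ connect (link w j) u (inl a), link w j (inl a) (inr b) & connect (link w j) (inr b) v].
  move=> au vS; apply: (@cross_connect _ _ (@inc_sym _ _ w.1) (@inc_irr _ _ w.1) T _ _ _ _ _ eab).
  - exact: link_inc.
  - exact: au.
  - exact: sideS.
have [z za zc] : exists2 z, z \in vset (inl a) & vcol z = w.2 b by apply: vset_ex.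
(* the component of [z] cannot cross from [a] to [b], which has the colour of [z] *)
have nolink : link w (w.2 b) (inl a) (inr b) = false by rewrite /link /= eqxx !andbF.
have zS : z \notin vertices_of S.
  apply/bigcupP => -[u uS zu]; have := vset_link za zu; rewrite zc => cau.
  by have [_] := crossing _ _ _ (connect0 _ _) uS cau; rewrite nolink.
have zb : z \notin vset (inr b) by apply/negP => /vset_off /=; rewrite zc eqxx.
have aE : vset (inl a) = z |: vset (inr b).
  apply/esym/eqP; rewrite eqEcard cardsU1 zb card_vset_white card_vset_black leqnn andbT.
  by rewrite subUset sub1set za vset_inc.
have bsub : vset (inr b) \subset vertices_of S by apply: bigcup_sup.
have vE : vertices_of (inl a |: S) = z |: vertices_of S.
  rewrite /vertices_of bigcup_setU big_set1 aE -setUA; congr (_ |: _).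
  exact/setUidPr.
have adjz x : x \in vertices_of S -> ([set z; x] \in tree_graph) = (x \in vset (inr b)).
  move=> xS; have zx : z != x by apply: contraNneq zS => ->.
  apply/tree_graphP/idP => // [[u zu xu]|xb]; last first.
    by exists (inl a) => //; apply: (subsetP (vset_inc bN)).
  case/bigcupP: xS => v vS xv; have cuv := vset_link xu xv.
  have au : connect (del_edge (inc w.1) (inl a) (inr b)) (inl a) u.
    case/orP: (side_total T (inl a) (inr b) u) => // bu.
    have := vset_link za zu; rewrite zc => cau.
    have [_] := cross_connect (@inc_sym _ _ w.1) (@inc_irr _ _ w.1) T eab (@link_inc _)
      (connect0 _ _) bu cau.
    by rewrite nolink.
  have [_ _ cbv] := crossing _ _ _ au vS cuv.
  by apply: (vset_connect xv); rewrite lsym.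
have clq (F : {set vertex}) : F \subset z |: vertices_of S -> clique tree_graph F ->
    F \subset vertices_of S \/ (z \in F /\ F \subset vset (inl a)).
  move=> FS /cliqueP Fc; have [zF|zF] := boolP (z \in F); [right; split=> // | left];
    apply/subsetP => x xF; have := subsetP FS x xF; rewrite in_setU1 => /orP[/eqP xz|xS] //.
  - by rewrite xz.
  - rewrite aE in_setU1 -adjz // Fc ?orbT //.
    by apply: contraNneq zS => ->.
  - by rewrite xz (negPf zF) in xF.
rewrite /grown vE; split.
- apply: (ktree_add (C := vset (inr b))) => //; [exact: card_vset_white|exact: vset_clique].
- rewrite cardsU1 zS g2 /= addnCA; congr (_ + _)%N.
  have -> : [set a' | inl a' \in inl a |: S] = a |: [set a' | inl a' \in S].
    by apply/setP => a'; rewrite !inE.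
  by rewrite cardsU1 inE aS.
- move=> F FS Fc Fk; have [/g3 H|[zF Fa]] := clq F FS Fc; first exact: H.
  have [y yE] : exists y, vset (inl a) :\: F = [set y].
    apply/cards1P; rewrite cardsD (setIidPr Fa) Fk card_vset_black.
    by rewrite subSnn.
  have ya : y \in vset (inl a).
    have : y \in vset (inl a) :\: F by rewrite yE set11.
    by rewrite inE => /andP[].
  have [b' b'E] := vset_minus ya; exists b'; rewrite -b'E -yE.
  by rewrite setDDr setDv set0U (setIidPr Fa).
- move=> H HS Hc Hk; have [/g4 G|[zH Ha]] := clq H HS Hc; first exact: G.
  by exists a; apply/eqP; rewrite eqEcard Ha Hk card_vset_black leqnn.
Qed.

Lemma grown_all : grown [set: A + B].
Proof.
have [T _] := wT; have [b _] : exists b : B, b \in [set: B].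
  by apply/card_gt0P; rewrite cardsT -(ctree_card wT) addn1.
apply: (@tree_growth _ _ (@inc_sym _ _ w.1) T (inr b)) => //; first exact: grown_root.
move=> S [a'|b'] [a|b''] gS _ uS vS //= bN side.
  exact: grown_white gS uS vS bN.
exact: grown_black gS uS vS bN side.
Qed.

Lemma vertices_all : vertices_of [set: A + B] = [set: vertex].
Proof.
by apply/setP => x; rewrite in_setT; apply/bigcupP; exists (val x).2;
  [rewrite in_setT | exact: vset_cover].
Qed.

Lemma tree_graph_ktree : ktree k tree_graph.
Proof.
split; first by apply/forall_inP => e; rewrite inE => /andP[].
by have [] := grown_all; rewrite vertices_all.
Qed.

Lemma card_vertex : #|{: vertex}| = (#|A| + k)%N.
Proof.
have [_ c _ _] := grown_all; rewrite -cardsT -vertices_all c addnC; congr (_ + k)%N.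
by rewrite -cardsT; apply: eq_card => a; rewrite !inE.
Qed.

(** All hedra and fronts are of the form [vset u]; that they are distinct for distinct [u] follows
    by counting, since a k-tree on [#|A| + k] vertices has [#|A|] hedra and [#|B|] fronts. *)
Lemma tree_graph_codes : codes tree_graph vcol vset w.
Proof.
have [_ _ g3 g4] := grown_all; rewrite vertices_all in g3 g4.
have kt := tree_graph_ktree.
have hE : hedra k tree_graph = (vset \o inl) @: [set: A].
  apply/setP => H; rewrite inE; apply/andP/imsetP => [[Hc /eqP Hk]|[a _ ->]].
    by have [a ->] := g4 H (subsetT _) Hc Hk; exists a.
  by rewrite vset_clique card_vset_black.
have fE : fronts k tree_graph = (vset \o inr) @: [set: B].
  apply/setP => F; rewrite inE; apply/andP/imsetP => [[Fc /eqP Fk]|[b _ ->]].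
    by have [b ->] := g3 F (subsetT _) Fc Fk; exists b.
  by rewrite vset_clique card_vset_white.
have cH : #|hedra k tree_graph| = #|A|.
  by have := card_hedra hk kt; rewrite card_vertex => /addIn.
have cF : #|fronts k tree_graph| = #|B|.
  by rewrite (card_fronts hk kt) cH (ctree_card wT).
have iA : injective (vset \o inl).
  have /imset_injP inj : #|(vset \o inl) @: [set: A]| == #|[set: A]| by rewrite -hE cH cardsT.
  by move=> x y; apply: inj; rewrite in_setT.
have iB : injective (vset \o inr).
  have /imset_injP inj : #|(vset \o inr) @: [set: B]| == #|[set: B]| by rewrite -fE cF cardsT.
  by move=> x y; apply: inj; rewrite in_setT.
split.
- move=> x y _ _ xy /(tree_graphP xy)[u xu yu]; apply: contraNneq xy => xyc.
  by apply/eqP; exact: (vset_inj xu yu xyc).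
- move=> [a|b] [a'|b'] E1.
  + by congr inl; apply: iA.
  + by have := card_vset_black a; rewrite E1 card_vset_white => /n_Sn.
  + by have := card_vset_black a'; rewrite -E1 card_vset_white => /n_Sn.
  + by congr inr; apply: iB.
- move=> t; rewrite hE; apply/imsetP/codomP => [[a _ ->]|[a ->]]; by exists a.
- move=> t; rewrite fE; apply/imsetP/codomP => [[a _ ->]|[a ->]]; by exists a.
- move=> a b; apply/idP/idP => [|sub]; first exact: vset_inc.
  have [z za zc] : exists2 z, z \in vset (inl a) & vcol z = w.2 b by apply: vset_ex.
  have [_ /(_ a (w.2 b))[b' b'P]] := wT; have := b'P b'; rewrite eqxx => /andP[b'N /eqP b'c].
  suff /iB -> : vset (inr b) = vset (inr b') by [].
  have off b1 : w.2 b1 = w.2 b -> z \notin vset (inr b1).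
    by move=> e1; apply/negP => /vset_off /=; rewrite zc e1 eqxx.
  have full b1 : w.2 b1 = w.2 b -> vset (inr b1) \subset vset (inl a) ->
      vset (inr b1) = vset (inl a) :\ z.
    move=> e1 s1; apply/eqP; rewrite eqEcard; apply/andP; split.
      by rewrite subsetD1 s1 off.
    rewrite card_vset_white.
    by have := cardsD1 z (vset (inl a)); rewrite za card_vset_black add1n => /eqP;
      rewrite eqSS => /eqP <-.
  by rewrite (full b) // (full b') // vset_inc.
- by move=> b x /vset_off /=; rewrite eq_sym.
Qed.

End TreeToKTree.

(** * Isomorphism classes of k-trees *)

Section GraphIso.
Variable T : finType.
Implicit Types E : {set {set T}}.

Lemma graph_isoP E E' : reflect (exists s : {perm T}, E' = graph_image s E) (graph_iso E E').
Proof. by apply: (iffP existsP) => -[s sE]; exists s; apply/eqP. Qed.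

Lemma graph_image_comp (p q : T -> T) E : graph_image p (graph_image q E) = graph_image (p \o q) E.
Proof. by rewrite /graph_image -imset_comp; apply: eq_imset => e; rewrite /= -imset_comp. Qed.

Lemma graph_iso_sym E E' : graph_iso E E' -> graph_iso E' E.
Proof.
move=> /graph_isoP[s ->]; apply/graph_isoP; exists (s^-1)%g.
rewrite graph_image_comp -[LHS]imset_id; apply: eq_imset => e.
by rewrite -[LHS]imset_id; apply: eq_imset => x; rewrite /= permK.
Qed.

Lemma graph_iso_trans E E' E'' : graph_iso E E' -> graph_iso E' E'' -> graph_iso E E''.
Proof.
move=> /graph_isoP[s ->] /graph_isoP[t ->]; apply/graph_isoP; exists (s * t)%g.
rewrite graph_image_comp; apply: eq_imset => e; apply: eq_imset => x.
by rewrite /= permM.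
Qed.

Lemma graph_iso_refl E : graph_iso E E.
Proof.
apply/graph_isoP; exists 1%g; rewrite -[LHS]imset_id; apply: eq_imset => e.
by rewrite -[LHS]imset_id; apply: eq_imset => x; rewrite perm1.
Qed.

End GraphIso.

Section CountKTrees.
Variables (k n : nat).
Hypothesis hk : 0 < k.
Local Notation m := (n * k + 1)%N.
Local Notation group := ({perm 'I_n} * {perm 'I_m} * 'S_k.+1)%type.
Local Notation ctree_orbits := [set orbit (ctree_action k 'I_n 'I_m) [set: group] w
  | w in coloured_trees k 'I_n 'I_m].

Lemma ktrees_hedraP (T : finType) (E : {set {set T}}) :
  reflect (ktree k E /\ #|hedra k E| = n) (E \in ktrees_hedra T k n).
Proof.
by rewrite inE; apply: (iffP andP) => -[/asboolP kt /eqP E1].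
Qed.

Lemma ktrees_hedra_card (T : finType) (E : {set {set T}}) :
  E \in ktrees_hedra T k n -> #|T| = (n + k)%N.
Proof. by move=> /ktrees_hedraP[kt <-]; rewrite (card_hedra hk kt). Qed.

Lemma ktree_code_exists (T : finType) (E : {set {set T}}) : E \in ktrees_hedra T k n ->
  exists f h (w : ctree k 'I_n 'I_m), codes E f h w.
Proof.
move=> /ktrees_hedraP[kt nE]; have := ktree_has_code hk kt.
by rewrite (card_fronts hk kt) nE.
Qed.

Lemma code_ktree_exists (w : ctree k 'I_n 'I_m) : coloured_tree w ->
  exists f h (E : {set {set 'I_(n + k)}}), E \in ktrees_hedra 'I_(n + k) k n /\ codes E f h w.
Proof.
move=> wT; have cV : #|{: vertex w}| = (n + k)%N by rewrite (card_vertex wT) card_ord.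
pose p (x : vertex w) : 'I_(n + k) := cast_ord cV (enum_rank x).
pose q (i : 'I_(n + k)) : vertex w := enum_val (cast_ord (esym cV) i).
have pK : cancel p q by move=> x; rewrite /p /q cast_ordK enum_rankK.
have qK : cancel q p by move=> i; rewrite /p /q enum_valK cast_ordKV.
have kt := tree_graph_ktree wT.
have [f [h c]] := codes_image pK qK (tree_graph_codes hk wT).
exists f, h, (graph_image p (tree_graph w)); split=> //.
have kt' := ktree_image pK qK kt.
apply/ktrees_hedraP; split=> //.
by have := card_hedra hk kt'; rewrite card_ord => /addIn.
Qed.

(** Both sets are matched by the relation of having a code in common. *)
Lemma card_ktree_classes :
  #|equivalence_partition (@graph_iso 'I_(n + k)) (ktrees_hedra 'I_(n + k) k n)| =
  #|ctree_orbits|.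
Proof.
pose D := ktrees_hedra 'I_(n + k) k n.
pose R (Y : {set {set {set 'I_(n + k)}}}) (X : {set ctree k 'I_n 'I_m}) :=
  exists E w f h, [/\ E \in Y, w \in X & codes E f h w].
have YE Y E : Y \in equivalence_partition (@graph_iso _) D -> E \in Y ->
    E \in D /\ Y = [set E' in D | graph_iso E E'].
  case/imsetP => E0 E0D ->; rewrite inE => /andP[ED E0E]; split=> //.
  apply/setP => E'; rewrite [LHS]in_set [RHS]in_set; apply: andb_id2l => _; apply/idP/idP.
    exact: graph_iso_trans (graph_iso_sym E0E).
  exact: graph_iso_trans E0E.
have XE X w : X \in ctree_orbits ->
    w \in X -> coloured_tree w /\ X = orbit (ctree_action k 'I_n 'I_m) [set: group] w.
  case/imsetP => w0 /coloured_treesP w0T -> w0w; split; last by apply/esym/orbit_eqP.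
  by case/orbitP: w0w => g _ <-; apply: ctree_act_tree.
have code_iso E (w : ctree k 'I_n 'I_m) f h E' f' h' g : E \in D -> E' \in D -> codes E f h w ->
    codes E' f' h' (ctree_act w g) -> graph_iso E E'.
  move=> /ktrees_hedraP[kt _] /ktrees_hedraP[kt' _] c c'.
  have := codes_act g^-1%g c'; rewrite -ctree_actM mulgV ctree_act1 => -[f'' [h'' c'']].
  have [p pi ->] := codes_iso hk kt kt' c c''.
  apply/graph_isoP; exists (perm pi); apply: eq_imset => e; apply: eq_imset => x.
  by rewrite permE.
apply: (card_rel (R := R)).
- move=> Y YP; case/imsetP: (YP) => E ED YE0.
  have EY : E \in Y by rewrite YE0 inE ED graph_iso_refl.
  have [f [h [w c]]] := ktree_code_exists ED; have /ktrees_hedraP[kt _] := ED.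
  exists (orbit (ctree_action k 'I_n 'I_m) [set: group] w).
    by apply/imset_f/coloured_treesP; apply: codes_tree c kt.
  by exists E, w, f, h; split=> //; apply: orbit_refl.
- move=> X /imsetP[w /coloured_treesP wT ->]; have [f [h [E [ED c]]]] := code_ktree_exists wT.
  exists [set E' in D | graph_iso E E']; first exact: imset_f.
  by exists E, w, f, h; split; rewrite ?orbit_refl // inE ED graph_iso_refl.
- move=> Y X X' YP XP X'P [E [w [f [h [EY wX c]]]]] [E' [w' [f' [h' [E'Y w'X' c']]]]].
  have [wT ->] := XE _ _ XP wX; have [w'T ->] := XE _ _ X'P w'X'.
  have [ED YE1] := YE _ _ YP EY; have /ktrees_hedraP[kt _] := ED.
  have [E'D _] := YE _ _ YP E'Y; have /ktrees_hedraP[kt' _] := E'D.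
  move: E'Y; rewrite YE1 inE => /andP[_ /graph_isoP[s E's]].
  have [f'' [h'' c'']] := codes_image (permK s) (permKV s) c; rewrite -E's in c''.
  have [g ->] := codes_orbit hk kt' c'' c'.
  apply/orbit_eqP; rewrite orbit_sym; apply/orbitP; exists g; rewrite ?inE //.
- move=> Y Y' X YP Y'P XP [E [w [f [h [EY wX c]]]]] [E' [w' [f' [h' [E'Y' w'X c']]]]].
  have [ED ->] := YE _ _ YP EY; have [E'D ->] := YE _ _ Y'P E'Y'.
  have [wT X1] := XE _ _ XP wX; move: w'X; rewrite X1 => /orbitP[g _ gw].
  have {}gw : ctree_act w g = w' := gw; rewrite -gw in c'.
  have EE' := code_iso _ _ _ _ _ _ _ _ ED E'D c c'.
  apply/setP => E0; rewrite [LHS]in_set [RHS]in_set; apply: andb_id2l => _; apply/idP/idP.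
    exact: graph_iso_trans (graph_iso_sym EE').
  exact: graph_iso_trans EE'.
Qed.

(** A k-tree with [n] hedra has [n + k] vertices. *)
Lemma num_ktreesE : num_ktrees k n =
  #|ctree_orbits|.
Proof.
rewrite -card_ktree_classes /num_ktrees.
rewrite (@fsbigE _ _ _ _ _ [:: (n + k)%N]) //.
  by rewrite big_cons big_nil ifT; [exact: addn0 | exact: mem_set].
move=> N _; rewrite inE => Nnk.
suff -> : ktrees_hedra 'I_N k n = set0 by apply/eqP; rewrite cards_eq0; apply/eqP/setP => Y;
  rewrite inE; apply/imsetP => -[E]; rewrite inE.
apply/setP => E; rewrite in_set0; apply/negP => /ktrees_hedra_card.
by rewrite card_ord => NE; rewrite NE eqxx in Nnk.
Qed.

End CountKTrees.

Local Open Scope ring_scope.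

Theorem corollary6p5 (k : nat) (hk : (1 <= k)%N)
    (perm_of : seq nat -> 'S_k) (perm_of1 : seq nat -> 'S_k.+1)
    (h : forall l, int_partition k l -> cycle_type (perm_of l) = l)
    (h1 : forall l, int_partition k.+1 l -> cycle_type (perm_of1 l) = l) :
  forall n : nat,
  ktree_gf k n =
    \sum_(l \in int_partition k.+1) (zee l)%:R^-1 * ogf (CTXY k) (perm_of1 l) n
  + \sum_(l \in int_partition k) (zee l)%:R^-1 * ogf (CTY k) (perm_of l) n
  - \sum_(l \in int_partition k)
      (zee l)%:R^-1 * ogf (CTXY k) (perm_of1 (rcons l 1%N)) n.
Proof.
by move=> n; rewrite (weighted_ogf_sum hk n h h1) /ktree_gf (num_ktreesE n hk).
Qed.
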